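(* Let $V$ be an irreducible, infinite-dimensional, completely pointed $U_q(\mathfrak{sl}_{n+1})$-module and let $v^+\in V^+$ be given. Then the action of $U_q(\mathfrak{sl}_{n+1})$ on $V$ can be extended to an action of $U_q(\mathfrak{gl}_{n+1})$ on $V$ such that for all $i\neq j$ in $\{1,\dots,n+1\}$ $$E_{-\varepsilon_i+\varepsilon_j}E_{\varepsilon_i-\varepsilon_j}\cdot v^+=[\bar K_i;1][\bar K_j;0]\cdot v^+ ,$$ and moreover, for every $i\in\{1,\dots,n\}$ and every weight vector $v_\lambda\in V$, $$F_iE_i\cdot v_\lambda=[\bar K_i;1][\bar K_{i+1};0]\cdot v_\lambda .$$
   Context: Let $\mathbb F$ be a field of characteristic $0$ closed under quadratic extensions (every quadratic polynomial over $\mathbb F$ has a root in $\mathbb F$), let $q\in\mathbb F$ be nonzero and not a root of unity, and let $n\ge 1$. Write $[2]_q=q+q^{-1}$. $U_q(\mathfrak{gl}_{n+1})$ is the associative unital $\mathbb F$-algebra with generators $E_i,F_i$ ($1\le i\le n$), $\bar K_j^{\pm1}$ ($1\le j\le n+1$) and relations: $\bar K_j\bar K_j^{-1}=\bar K_j^{-1}\bar K_j=1$, $\bar K_i\bar K_j=\bar K_j\bar K_i$; $\bar K_jE_i\bar K_j^{-1}=q^{\delta_{ij}-\delta_{j,i+1}}E_i$, $\bar K_jF_i\bar K_j^{-1}=q^{-(\delta_{ij}-\delta_{j,i+1})}F_i$; $[E_i,F_j]=\delta_{ij}\frac{\bar K_i\bar K_{i+1}^{-1}-\bar K_i^{-1}\bar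 K_{i+1}}{q-q^{-1}}$; $[E_i,E_j]=[F_i,F_j]=0$ for $|i-j|>1$; $E_i^2E_j-[2]_qE_iE_jE_i+E_jE_i^2=0$ and $F_i^2F_j-[2]_qF_iF_jF_i+F_jF_i^2=0$ for $|i-j|=1$. $U_q(\mathfrak{sl}_{n+1})$ is the subalgebra generated by $E_i,F_i$ and $K_i^{\pm1}$, $K_i:=\bar K_i\bar K_{i+1}^{-1}$ ($1\le i\le n$). For an invertible element $K$ (a Laurent monomial in the $\bar K_i$) and $j\in\mathbb Z$, $[K;j]=\frac{q^jK-q^{-j}K^{-1}}{q-q^{-1}}$. Root vectors. $\Phi=\{\varepsilon_i-\varepsilon_j: 1\le i\ne j\le n+1\}$ is the root system of $\mathfrak{sl}_{n+1}$, $\Phi^+=\{\varepsilon_i-\varepsilon_j:i<j\}$. Lusztig's automorphisms $T_i$ ($1\le i\le n$) of $U_q(\mathfrak{sl}_{n+1})$ are: $T_i(E_i)=-F_iK_i$, $T_i(E_j)=q^{-1}E_jE_i-E_iE_j$ if $|i-j|=1$, $T_i(E_j)=E_j$ otherwise; $T_i(F_i)=-K_i^{-1}E_i$, $T_i(F_j)=-F_jF_i+qF_iF_j$ if $|i-j|=1$, $T_i(F_j)=F_j$ otherwise; $T_i(K_i)=K_i^{-1}$, $T_i(K_j)=K_iK_j$ if $|i-j|=1$, $T_i(K_j)=K_j$ otherwise. For $i<j$, $E_{\varepsilon_i-\varepsilon_j}=T_iT_{i+1}\cdots T_{j-2}(E_{j-1})$ and $E_{-\varepsilon_i+\varepsilon_j}=T_iT_{i+1}\cdots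 T_{j-2}(F_{j-1})$ (so $E_{\varepsilon_i-\varepsilon_{i+1}}=E_i$, $E_{-\varepsilon_i+\varepsilon_{i+1}}=F_i$). These are the root vectors attached to the reduced expression $w_0=s_1s_2\cdots s_n\,s_1s_2\cdots s_{n-1}\cdots s_1s_2s_1$. Modules. For a $U_q(\mathfrak{sl}_{n+1})$-module $V$ and $\lambda\in(\mathbb F^\times)^n$, the weight space is $V_\lambda=\{v\in V: K_iv=\lambda_iv\ \forall i\}$; its nonzero elements are weight vectors. $V$ is a weight module if it is the direct sum of its weight spaces. $V$ is completely pointed if it is a weight module all of whose nonzero weight spaces are one-dimensional. For $V$ irreducible, set $N=\{\beta\in\Phi: \forall v\in V\ \exists k>0,\ E_\beta^kv=0\}$, $T=\{\beta\in\Phi:\forall v\in V\setminus\{0\},\ E_\beta v\ne0\}$, $N_s=N\cap(-N)$, $T_s=T\cap(-T)$, $N_a=N\setminus N_s$, $T_a=T\setminus T_s$, $N_s^+=\Phi^+\cap N_s$, and $V^+=\{v\in V:E_\beta v=0\ \forall\beta\in N_a\cup N_s^+\}$. *)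

(* Defs.v *)
From HB Require Import structures.
From mathcomp Require Import all_boot all_order all_algebra.
From mathcomp Require Import boolp.

Set Implicit Arguments.
Unset Strict Implicit.
Unset Printing Implicit Defensive.

Import Order.TTheory GRing.Theory Num.Theory.
Local Open Scope ring_scope.
Local Open Scope quotient_scope.

(* Noncommutative polynomial expressions over F in the letters X, before any
   identification. *)
Inductive term (F X : Type) : Type :=
| Gen of X
| TZero
| TOne
| TOpp of term F X
| TAdd of term F X & term F X
| TMul of term F X & term F X
| TScale of F & term F X.

Arguments Gen {F X} _.
Arguments TZero {F X}.
Arguments TOne {F X}.

Declare Scope ncterm_scope.
Delimit Scope ncterm_scope with ncT.
Bind Scope ncterm_scope with term.
Arguments TScale {F X} _%_ring_scope _%_ncterm_scope.
Notation "0" := TZero : ncterm_scope.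
Notation "1" := TOne : ncterm_scope.
Notation "- t" := (TOpp t) : ncterm_scope.
Notation "t + u" := (TAdd t u) : ncterm_scope.
Notation "t - u" := (TAdd t (TOpp u)) : ncterm_scope.
Notation "t * u" := (TMul t u) : ncterm_scope.
Notation "c *: t" := (TScale c t) : ncterm_scope.

Fixpoint teval (F : fieldType) (X : Type) (A : algType F) (g : X -> A)
    (t : term F X) : A :=
  match t with
  | Gen x => g x
  | TZero => 0
  | TOne => 1
  | TOpp u => - teval g u
  | TAdd u v => teval g u + teval g v
  | TMul u v => teval g u * teval g v
  | TScale c u => c *: teval g u
  end.

Fixpoint tsubst (F X Y : Type) (g : X -> term F Y) (t : term F X) : term F Y :=
  match t with
  | Gen x => g x
  | TZero => TZero
  | TOne => TOne
  | TOpp u => TOpp (tsubst g u)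
  | TAdd u v => TAdd (tsubst g u) (tsubst g v)
  | TMul u v => TMul (tsubst g u) (tsubst g v)
  | TScale c u => TScale c (tsubst g u)
  end.

(* The congruence generated by the axioms of associative unital F-algebras and
   the relations r; terms modulo alg_cong r form the F-algebra presented by the
   generators X and the relations r. *)
Inductive alg_cong (F : fieldType) (X : Type) (r : term F X -> term F X -> Prop) :
    term F X -> term F X -> Prop :=
| ac_rel t u of r t u : alg_cong r t u
| ac_refl t : alg_cong r t t
| ac_sym t u of alg_cong r t u : alg_cong r u t
| ac_trans u t v of alg_cong r t u & alg_cong r u v : alg_cong r t v
| ac_opp t t' of alg_cong r t t' : alg_cong r (- t) (- t')
| ac_add t t' u u' of alg_cong r t t' & alg_cong r u u' :
    alg_cong r (t + u) (t' + u')
| ac_mul t t' u u' of alg_cong r t t' & alg_cong r u u' :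
    alg_cong r (t * u) (t' * u')
| ac_scale c t t' of alg_cong r t t' : alg_cong r (c *: t) (c *: t')
| ac_addA t u v : alg_cong r (t + (u + v)) (t + u + v)
| ac_addC t u : alg_cong r (t + u) (u + t)
| ac_add0 t : alg_cong r (0 + t) t
| ac_addN t : alg_cong r (- t + t) 0
| ac_mulA t u v : alg_cong r (t * (u * v)) (t * u * v)
| ac_mul1l t : alg_cong r (1 * t) t
| ac_mul1r t : alg_cong r (t * 1) t
| ac_mulDl t u v : alg_cong r ((t + u) * v) (t * v + u * v)
| ac_mulDr t u v : alg_cong r (t * (u + v)) (t * u + t * v)
| ac_scaleA a b t : alg_cong r (a *: (b *: t)) ((a * b)%R *: t)
| ac_scale1 t : alg_cong r (1%R *: t) t
| ac_scaleDr a t u : alg_cong r (a *: (t + u)) (a *: t + a *: u)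
| ac_scaleDl a b t : alg_cong r ((a + b)%R *: t) (a *: t + b *: t)
| ac_scaleAl a t u : alg_cong r (a *: (t * u)) ((a *: t) * u)
| ac_scaleAr a t u : alg_cong r (a *: (t * u)) (t * (a *: u)).

(* Indices are shifted down by one: the generators E_i, F_i, K_i are indexed by
   'I_n = {0, .., n-1} and the \bar K_j by 'I_n.+1 = {0, .., n}.  For i : 'I_n,
   lo i and hi i are the indices i and i+1 in 'I_n.+1. *)
Definition lo (n : nat) (i : 'I_n) : 'I_n.+1 := widen_ord (leqnSn n) i.
Definition hi (n : nat) (i : 'I_n) : 'I_n.+1 := lift ord0 i.

Definition adjacent (i j : nat) : bool := (i.+1 == j) || (j.+1 == i).
Definition distant (i j : nat) : bool := (i.+1 < j)%N || (j.+1 < i)%N.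

Inductive gl_gen (n : nat) : Type :=
| GE of 'I_n | GF of 'I_n | GK of 'I_n.+1 | GKinv of 'I_n.+1.

Section QuantumGl.
Variables (F : fieldType) (q : F) (n : nat).

Local Notation E i := (Gen (GE i)).
Local Notation F_ i := (Gen (GF i)).
Local Notation K j := (Gen (GK j)).
Local Notation Kinv j := (Gen (GKinv j)).

Definition eps_pairing (j : 'I_n.+1) (i : 'I_n) : int :=
  (j == lo i)%:Z - (j == hi i)%:Z.

Inductive gl_rel : term F (gl_gen n) -> term F (gl_gen n) -> Prop :=
| rel_KKinv j : gl_rel (K j * Kinv j) 1
| rel_KinvK j : gl_rel (Kinv j * K j) 1
| rel_KK i j : gl_rel (K i * K j) (K j * K i)
| rel_KE j i : gl_rel (K j * E i * Kinv j) (q ^ (eps_pairing j i) *: E i)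
| rel_KF j i : gl_rel (K j * F_ i * Kinv j) (q ^ (- eps_pairing j i) *: F_ i)
| rel_EF i : gl_rel (E i * F_ i - F_ i * E i)
    ((q - q^-1)^-1 *: (K (lo i) * Kinv (hi i) - Kinv (lo i) * K (hi i)))
| rel_EF_neq i j of i != j : gl_rel (E i * F_ j - F_ j * E i) 0
| rel_EE (i j : 'I_n) of distant i j : gl_rel (E i * E j - E j * E i) 0
| rel_FF (i j : 'I_n) of distant i j : gl_rel (F_ i * F_ j - F_ j * F_ i) 0
| rel_serreE (i j : 'I_n) of adjacent i j :
    gl_rel (E i * E i * E j - (q + q^-1) *: (E i * E j * E i) + E j * E i * E i)
      0
| rel_serreF (i j : 'I_n) of adjacent i j :
    gl_rel (F_ i * F_ i * F_ j - (q + q^-1) *: (F_ i * F_ j * F_ i)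
            + F_ j * F_ i * F_ i)
      0.

HB.instance Definition _ := gen_eqMixin (term F (gl_gen n)).
HB.instance Definition _ := gen_choiceMixin (term F (gl_gen n)).

Definition gl_cong (t u : term F (gl_gen n)) : bool := `[< alg_cong gl_rel t u >].

Lemma gl_cong_equiv : equiv_class_of gl_cong.
Proof.
split=> [t|t u|u t v]; first exact/asboolP/ac_refl.
  by apply/asboolP/asboolP; apply: ac_sym.
by move=> /asboolP tu /asboolP uv; apply/asboolP/(ac_trans tu uv).
Qed.

Canonical gl_cong_equiv_rel := EquivRelPack gl_cong_equiv.

Definition Uqgl := {eq_quot gl_cong}.

HB.instance Definition _ := Choice.on Uqgl.
HB.instance Definition _ := EqQuotient.on Uqgl.

Definition gl_class (t : term F (gl_gen n)) : Uqgl := \pi_Uqgl t.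

Lemma gl_classP t u : gl_class t = gl_class u <-> alg_cong gl_rel t u.
Proof.
split=> [/eqP|tu]; first by rewrite /gl_class eqmodE => /asboolP.
by apply/eqP; rewrite /gl_class eqmodE; apply/asboolP.
Qed.

Lemma gl_repr_class t : alg_cong gl_rel (repr (gl_class t)) t.
Proof. by apply/gl_classP; rewrite /gl_class reprK. Qed.

Definition gl_add (x y : Uqgl) := gl_class (repr x + repr y).
Definition gl_opp (x : Uqgl) := gl_class (- repr x).
Definition gl_mul (x y : Uqgl) := gl_class (repr x * repr y).
Definition gl_scale (c : F) (x : Uqgl) := gl_class (c *: repr x).

Lemma gl_addE t u : gl_add (gl_class t) (gl_class u) = gl_class (t + u).
Proof. by apply/gl_classP/ac_add; apply: gl_repr_class. Qed.

Lemma gl_oppE t : gl_opp (gl_class t) = gl_class (- t).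
Proof. by apply/gl_classP/ac_opp; apply: gl_repr_class. Qed.

Lemma gl_mulE t u : gl_mul (gl_class t) (gl_class u) = gl_class (t * u).
Proof. by apply/gl_classP/ac_mul; apply: gl_repr_class. Qed.

Lemma gl_scaleE c t : gl_scale c (gl_class t) = gl_class (c *: t).
Proof. by apply/gl_classP/ac_scale; apply: gl_repr_class. Qed.

Lemma gl_classW (P : Uqgl -> Prop) : (forall t, P (gl_class t)) -> forall x, P x.
Proof. by move=> Pt x; rewrite -[x]reprK; apply: Pt. Qed.

Local Definition gl_opE := (gl_addE, gl_oppE, gl_mulE, gl_scaleE).

Lemma gl_addA : associative gl_add.
Proof.
elim/gl_classW=> t; elim/gl_classW=> u; elim/gl_classW=> v; rewrite !gl_opE.
exact/gl_classP/ac_addA.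
Qed.

Lemma gl_addC : commutative gl_add.
Proof.
elim/gl_classW=> t; elim/gl_classW=> u; rewrite !gl_opE; exact/gl_classP/ac_addC.
Qed.

Lemma gl_add0 : left_id (gl_class 0) gl_add.
Proof. elim/gl_classW=> t; rewrite !gl_opE; exact/gl_classP/ac_add0. Qed.

Lemma gl_addN : left_inverse (gl_class 0) gl_opp gl_add.
Proof. elim/gl_classW=> t; rewrite !gl_opE; exact/gl_classP/ac_addN. Qed.

HB.instance Definition _ :=
  GRing.isZmodule.Build Uqgl gl_addA gl_addC gl_add0 gl_addN.

Lemma gl_mulA : associative gl_mul.
Proof.
elim/gl_classW=> t; elim/gl_classW=> u; elim/gl_classW=> v; rewrite !gl_opE.
exact/gl_classP/ac_mulA.
Qed.

Lemma gl_mul1l : left_id (gl_class 1) gl_mul.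
Proof. elim/gl_classW=> t; rewrite !gl_opE; exact/gl_classP/ac_mul1l. Qed.

Lemma gl_mul1r : right_id (gl_class 1) gl_mul.
Proof. elim/gl_classW=> t; rewrite !gl_opE; exact/gl_classP/ac_mul1r. Qed.

Lemma gl_mulDl : left_distributive gl_mul gl_add.
Proof.
elim/gl_classW=> t; elim/gl_classW=> u; elim/gl_classW=> v; rewrite !gl_opE.
exact/gl_classP/ac_mulDl.
Qed.

Lemma gl_mulDr : right_distributive gl_mul gl_add.
Proof.
elim/gl_classW=> t; elim/gl_classW=> u; elim/gl_classW=> v; rewrite !gl_opE.
exact/gl_classP/ac_mulDr.
Qed.

(* The trivial representation, used to see that 1 != 0 in Uqgl. *)
Fixpoint gl_counit (t : term F (gl_gen n)) : F :=
  match t with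
  | Gen (GE _) | Gen (GF _) | TZero => 0
  | Gen (GK _) | Gen (GKinv _) | TOne => 1
  | TOpp u => - gl_counit u
  | TAdd u v => gl_counit u + gl_counit v
  | TMul u v => gl_counit u * gl_counit v
  | TScale c u => c * gl_counit u
  end.

Lemma gl_counit_cong t u : alg_cong gl_rel t u -> gl_counit t = gl_counit u.
Proof.
elim=> {t u} //=.
- by move=> t u [] /= *; rewrite ?(mulr1, mulr0, mul0r, subrr, addr0, oppr0).
- by move=> u t v _ -> _ ->.
- by move=> t t' _ ->.
- by move=> t t' u u' _ -> _ ->.
- by move=> t t' u u' _ -> _ ->.
- by move=> c t t' _ ->.
- by move=> *; rewrite addrA.
- by move=> *; rewrite addrC.
- by move=> *; rewrite add0r.
- by move=> *; rewrite addNr.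
- by move=> *; rewrite mulrA.
- by move=> *; rewrite mul1r.
- by move=> *; rewrite mulr1.
- by move=> *; rewrite mulrDl.
- by move=> *; rewrite mulrDr.
- by move=> *; rewrite mulrA.
- by move=> *; rewrite mul1r.
- by move=> *; rewrite mulrDr.
- by move=> *; rewrite mulrDl.
- by move=> *; rewrite mulrA.
- by move=> *; rewrite mulrCA.
Qed.

Lemma gl_oner_neq0 : gl_class 1 != 0 :> Uqgl.
Proof.
by apply/eqP=> /gl_classP/gl_counit_cong/eqP; rewrite /= oner_eq0.
Qed.

HB.instance Definition _ := GRing.Zmodule_isNzRing.Build Uqgl
  gl_mulA gl_mul1l gl_mul1r gl_mulDl gl_mulDr gl_oner_neq0.

Lemma gl_scaleA a b x : gl_scale a (gl_scale b x) = gl_scale (a * b) x.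
Proof. elim/gl_classW: x => t; rewrite !gl_opE; exact/gl_classP/ac_scaleA. Qed.

Lemma gl_scale1 : left_id 1 gl_scale.
Proof. elim/gl_classW=> t; rewrite !gl_opE; exact/gl_classP/ac_scale1. Qed.

Lemma gl_scaleDr : right_distributive gl_scale +%R.
Proof.
move=> a; elim/gl_classW=> t; elim/gl_classW=> u; rewrite /+%R /= !gl_opE.
exact/gl_classP/ac_scaleDr.
Qed.

Lemma gl_scaleDl x : {morph gl_scale^~ x : a b / a + b}.
Proof.
move=> a b; elim/gl_classW: x => t; rewrite [RHS]/+%R /= !gl_opE.
exact/gl_classP/ac_scaleDl.
Qed.

HB.instance Definition _ := GRing.Zmodule_isLmodule.Build F Uqgl
  gl_scaleA gl_scale1 gl_scaleDr gl_scaleDl.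

Lemma gl_scaleAl (a : F) (x y : Uqgl) : a *: (x * y) = (a *: x) * y.
Proof.
elim/gl_classW: x => t; elim/gl_classW: y => u.
by rewrite /*%R /*:%R /= !gl_opE; apply/gl_classP/ac_scaleAl.
Qed.

Lemma gl_scaleAr (a : F) (x y : Uqgl) : a *: (x * y) = x * (a *: y).
Proof.
elim/gl_classW: x => t; elim/gl_classW: y => u.
by rewrite /*%R /*:%R /= !gl_opE; apply/gl_classP/ac_scaleAr.
Qed.

HB.instance Definition _ := GRing.Lmodule_isLalgebra.Build F Uqgl gl_scaleAl.
HB.instance Definition _ := GRing.Lalgebra_isAlgebra.Build F Uqgl gl_scaleAr.

Definition glE (i : 'I_n) : Uqgl := gl_class (E i).
Definition glF (i : 'I_n) : Uqgl := gl_class (F_ i).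
Definition glKbar (j : 'I_n.+1) : Uqgl := gl_class (K j).
Definition glKbarV (j : 'I_n.+1) : Uqgl := gl_class (Kinv j).

End QuantumGl.

Section QuantumSl.
Variables (F : fieldType) (q : F) (n : nat).
Local Notation Uqgl := (Uqgl q n).

Inductive sl_gen : Type :=
| SE of 'I_n | SF of 'I_n | SK of 'I_n | SKinv of 'I_n.

(* K_i = \bar K_i \bar K_(i+1)^-1 and its inverse \bar K_(i+1) \bar K_i^-1. *)
Definition sl_gen_gl (x : sl_gen) : Uqgl :=
  match x with
  | SE i => glE q i
  | SF i => glF q i
  | SK i => glKbar q (lo i) * glKbarV q (hi i)
  | SKinv i => glKbar q (hi i) * glKbarV q (lo i)
  end.

Inductive in_sl : Uqgl -> Prop :=
| in_sl_gen x : in_sl (sl_gen_gl x)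
| in_sl_1 : in_sl 1
| in_sl_lin a x y of in_sl x & in_sl y : in_sl (a *: x + y)
| in_sl_mul x y of in_sl x & in_sl y : in_sl (x * y).

Definition sl_pred : {pred Uqgl} := fun x => `[< in_sl x >].

Lemma sl_pred_subalg : subalg_closed sl_pred.
Proof.
split=> [|a x y|x y]; rewrite !unfold_in; first exact/asboolP/in_sl_1.
  by move=> /asboolP xS /asboolP yS; apply/asboolP/in_sl_lin.
by move=> /asboolP xS /asboolP yS; apply/asboolP/in_sl_mul.
Qed.

HB.instance Definition _ := GRing.isSubalgClosed.Build F Uqgl sl_pred
  (GRing.subalg_closed_semi sl_pred_subalg).

Record Uqsl : Type := MkUqsl { sl_val : Uqgl; _ : sl_pred sl_val }.

HB.instance Definition _ := [isSub for sl_val].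
HB.instance Definition _ := [Choice of Uqsl by <:].
HB.instance Definition _ := [SubChoice_isSubAlgebra of Uqsl by <:].

Lemma sl_gen_gl_in x : sl_pred (sl_gen_gl x).
Proof. exact/asboolP/in_sl_gen. Qed.

Definition sl_gen_val (x : sl_gen) : Uqsl := MkUqsl (sl_gen_gl_in x).

Definition slE (i : 'I_n) : Uqsl := sl_gen_val (SE i).
Definition slF (i : 'I_n) : Uqsl := sl_gen_val (SF i).
Definition slK (i : 'I_n) : Uqsl := sl_gen_val (SK i).

Local Notation E i := (Gen (SE i)).
Local Notation F_ i := (Gen (SF i)).
Local Notation K i := (Gen (SK i)).
Local Notation Kinv i := (Gen (SKinv i)).

(* Lusztig's automorphism T_i is given by its values on the generators; it is
   applied here to noncommutative polynomials in the generators, by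
   substitution.  Since T_i preserves the relations of Uqsl, evaluating
   lusztigT i t in Uqsl yields T_i applied to the value of t. *)
Definition lusztigT_gen (i : 'I_n) (x : sl_gen) : term F sl_gen :=
  match x with
  | SE j => if j == i then (- (F_ i * K i))%ncT
            else if adjacent i j then (q^-1 *: (E j * E i) - E i * E j)%ncT
            else E j
  | SF j => if j == i then (- (Kinv i * E i))%ncT
            else if adjacent i j then (- (F_ j * F_ i) + q *: (F_ i * F_ j))%ncT
            else F_ j
  | SK j => if j == i then Kinv i
            else if adjacent i j then (K i * K j)%ncT
            else K j
  | SKinv j => if j == i then K i
               else if adjacent i j then (Kinv j * Kinv i)%ncT
               else Kinv j
  end.

Definition lusztigT (i : 'I_n) : term F sl_gen -> term F sl_gen :=
  tsubst (lusztigT_gen i).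

(* For i < j in {0, .., n}, with k = j - 1: T_i T_(i+1) .. T_(k-1) applied to
   the generator g k.  (In one-based indices the last factor is T_(j-2) and the
   generator has index j - 1.) *)
Definition braid_term (g : 'I_n -> sl_gen) (i j : 'I_n.+1) : term F sl_gen :=
  if unlift ord0 j is Some k then
    foldr lusztigT (Gen (g k)) [seq l : 'I_n <- enum 'I_n | (i <= l < k)%N]
  else TZero.

(* The pair b = (i, j) with i != j stands for the root eps_i - eps_j. *)
Definition root_idx : Type := ('I_n.+1 * 'I_n.+1)%type.
Definition is_root (b : root_idx) : bool := b.1 != b.2.
Definition is_pos_root (b : root_idx) : bool := (b.1 < b.2)%N.
Definition opp_root (b : root_idx) : root_idx := (b.2, b.1).

Definition root_vector (b : root_idx) : Uqsl :=
  teval sl_gen_val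
    (if is_pos_root b then braid_term SE b.1 b.2 else braid_term SF b.2 b.1).

Section Modules.
Variable V : lmodType Uqsl.

(* V is an F-vector space through the scalars c%:A of Uqsl. *)
Definition infinite_dimensional : Prop :=
  ~ exists s : seq V, forall v : V,
      exists c : 'I_(size s) -> F, v = \sum_(i < size s) (c i)%:A *: s`_i.

Definition irreducible_module : Prop :=
  (exists v : V, v != 0) /\
  forall S : {pred V}, submod_closed S -> S =i pred1 0 \/ S =i predT.

Definition weight : Type := {ffun 'I_n -> F}.

Definition weight_space (l : weight) (v : V) : Prop :=
  (forall i, l i != 0) /\ (forall i, slK i *: v = (l i)%:A *: v).

Definition weight_vector (v : V) : Prop :=
  v != 0 /\ exists l, weight_space l v.

Definition weight_module : Prop :=
  (forall v : V, exists (s : seq weight) (f : weight -> V),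
     [/\ uniq s, (forall l, l \in s -> weight_space l (f l))
       & v = \sum_(l <- s) f l]) /\
  (forall (s : seq weight) (f : weight -> V),
     uniq s -> (forall l, l \in s -> weight_space l (f l)) ->
     \sum_(l <- s) f l = 0 -> forall l, l \in s -> f l = 0).

Definition completely_pointed : Prop :=
  weight_module /\
  forall l, (exists2 v, weight_space l v & v != 0) ->
    exists2 v, weight_space l v & v != 0 /\
      (forall w, weight_space l w -> exists c : F, w = c%:A *: v).

Definition rootsN (b : root_idx) : Prop :=
  is_root b /\ forall v : V, exists2 k, (0 < k)%N & root_vector b ^+ k *: v = 0.
Definition rootsNs (b : root_idx) : Prop := rootsN b /\ rootsN (opp_root b).
Definition rootsNa (b : root_idx) : Prop := rootsN b /\ ~ rootsNs b.
Definition rootsNs_pos (b : root_idx) : Prop := is_pos_root b /\ rootsNs b.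

Definition Vplus (v : V) : Prop :=
  forall b, rootsNa b \/ rootsNs_pos b -> root_vector b *: v = 0.

End Modules.

Definition qbracket (K Kinv : Uqgl) (j : int) : Uqgl :=
  (q - q^-1)^-1 *: (q ^ j *: K - q ^ (- j) *: Kinv).

Definition Kbar_bracket (i : 'I_n.+1) (j : int) : Uqgl :=
  qbracket (glKbar q i) (glKbarV q i) j.

End QuantumSl.

Record is_module_action (A : pzRingType) (V : zmodType) (act : A -> V -> V) :
    Prop := IsModuleAction {
  act_1 : forall v, act 1 v = v;
  act_M : forall a b v, act (a * b) v = act a (act b v);
  act_Dl : forall a b v, act (a + b) v = act a v + act b v;
  act_Dr : forall a v w, act a (v + w) = act a v + act a w
}.

Definition extends_sl_action (F : fieldType) (q : F) (n : nat)
    (V : lmodType (Uqsl q n)) (act : Uqgl q n -> V -> V) : Prop :=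
  is_module_action act /\ forall (u : Uqsl q n) v, act (sl_val u) v = u *: v.

Definition quadratically_closed (F : fieldType) : Prop :=
  forall p : {poly F}, size p = 3%N -> exists x, root p x.

(* Main.v *)
From HB Require Import structures.
From mathcomp Require Import all_boot all_order all_algebra.
From mathcomp Require Import boolp ring zify.
Require Import Defs.

Set Implicit Arguments.
Unset Strict Implicit.
Unset Printing Implicit Defensive.

Import Order.TTheory GRing.Theory Num.Theory.
Local Open Scope ring_scope.

(** Put [kappa = (q - q^-1)^2] and [cs w = w + w^-1], and let
    [c_i = kappa F_i E_i + q K_i + (q K_i)^-1] be the Casimir element of the
    [i]-th copy of [U_q(sl_2)].  On a weight vector on which [Kbar_j] acts by
    [mu_j], expanding the brackets shows that
    [F_i E_i = [Kbar_i; 1][Kbar_(i+1); 0]] says exactly that [c_i] acts by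
    [cs (q mu_i mu_(i+1)) = cs (q mu_(i+1)^2 lam_i)], where
    [lam_i = mu_i / mu_(i+1)] is the eigenvalue of [K_i].  In a completely
    pointed module every [c_i] does act by a scalar on each weight space, and
    the weights form one coset of the root lattice.  The squares [mu_j^2] have
    to satisfy [mu_i^2 = mu_(i+1)^2 lam_i^2] and are multiplied by prescribed
    powers of [q] from one weight to the next, so a single scalar is left to
    choose.  The heart of the proof is that one choice serves all nodes [i] and
    all weights.

    The defining relations of the algebra constrain the scalars [c_i] at
    neighbouring weights ([thin_graded_system]): [c_i] is constant along
    [alpha_i] and along the roots not adjacent to it; along an adjacent root
    the Serre relations force it to pass from [cs u] to [cs (u q^+-1)], with
    [u] and [u^-1] undistinguished by one such edge; and the commutation of
    [E_i] and [F_j], together with the one-dimensionality of the weight spaces,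
    gives product identities between the gaps [c_i - cs (q^+-1 lam_i)], whose
    vanishing decides where the set of weights ends.  Moreover, two weights
    that differ by roots from a set [J] of nodes are joined by nonzero steps
    along [J] ([reach_levi]), which allows induction along such pieces of the
    weight diagram.

    Neighbouring nodes are tied to each other: once the values of [c_(b+1)] at
    the ends of an edge along [b] are written as [cs w] and [cs (w / q)], the
    value of [c_b] is determined ([casimir_neighbour]).  Three weights
    in a row along some node exist, for otherwise the [K_i] would have finitely
    many eigenvalues and [V] would have finite dimension ([triple_exists]).
    Such a triple removes the ambiguity between [u] and [u^-1]; it fixes the
    scalar for two nodes and produces a triple along the next node, so that the
    choice propagates to the right end of the diagram ([extend_right]) and, by
    reversing the diagram, to the left end ([good_everywhere]).  For a diagram
    with one node, a single quadratic equation has to be solved.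

    One square root then yields all eigenvalues [mu_j] ([Kbar_eigenvalues]).
    The diagonal operators with these eigenvalues satisfy, together with the
    given [E_i] and [F_i], the relations of [U_q(gl_(n+1))], which defines the
    extended action ([gl_act_extends]).  The product of two opposite root
    vectors is computed on weight vectors by induction on the length of the
    root: Lusztig's braid operators give the recursion
    [E_(i,k) = q^-1 E_(i+1,k) E_i - E_i E_(i+1,k)] and its analogue for the
    negative roots ([braid_value_rec]), and the factors that belong to the
    middle node combine to [1] because
    [[x; 0]^2 + [x; 1]^2 - (q + q^-1) [x; 0][x; 1] = 1] ([qnum_circle]).  Both
    sides being linear, the formula holds on the whole of [V]. *)

(** * Points of the root lattice *)

(** Coordinates of a weight on the simple roots, relative to a base weight.
    The nodes of the diagram are arbitrary integers, so that every node has
    neighbours and no boundary cases arise in the formulas. *)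
Definition point := int -> int.
Definition sgn (d : bool) : int := if d then 1 else -1.
Definition shift (k : point) (i : int) (d : bool) : point :=
  fun j => k j + (if j == i then sgn d else 0).

Lemma shift_at k i d : shift k i d i = k i + sgn d.
Proof. by rewrite /shift eqxx. Qed.

Lemma shift_off k i d j : j != i -> shift k i d j = k j.
Proof. by move=> /negPf ji; rewrite /shift ji addr0. Qed.

Lemma shiftK k i d : shift (shift k i d) i (~~ d) = k.
Proof. by apply/funext=> j; rewrite /shift; case: eqP; case: d => _ /=; lia. Qed.

Lemma shiftNK k i d : shift (shift k i (~~ d)) i d = k.
Proof. by rewrite -{2}[d]negbK shiftK. Qed.

Lemma shiftC k i j d e : shift (shift k i d) j e = shift (shift k j e) i d.
Proof. by apply/funext=> x; rewrite /shift addrAC. Qed.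

Definition adj (i j : int) : bool := (j == i + 1) || (i == j + 1).

Lemma adjC i j : adj i j = adj j i.
Proof. by rewrite /adj orbC. Qed.

Lemma adj_irr i : ~~ adj i i.
Proof. by apply/negP; rewrite /adj; lia. Qed.

Lemma int_itv1 (i j : int) : i <= j < i + 1 -> j = i.
Proof. by lia. Qed.

Lemma int_itv2 (i j : int) : i <= j <= i + 1 -> j = i + 1 \/ j = i.
Proof. by lia. Qed.

Lemma le_succ (i : int) : i <= i + 1.
Proof. by lia. Qed.

(** The points of one piece: they differ by the roots [alpha_j] with
    [a <= j < b]. *)
Definition same_off (a b : int) (p p' : point) :=
  forall j, ~~ (a <= j < b) -> p j = p' j.

Lemma same_off_sym a b p p' : same_off a b p p' -> same_off a b p' p.
Proof. by move=> h j /h. Qed.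

Lemma same_off_trans a b p1 p2 p3 :
  same_off a b p1 p2 -> same_off a b p2 p3 -> same_off a b p1 p3.
Proof. by move=> h h' j nj; rewrite h // h'. Qed.

Lemma same_off_shift a b p i d : a <= i < b -> same_off a b p (shift p i d).
Proof.
move=> ib j nj; rewrite shift_off //; apply: contra nj => /eqP ->.
by rewrite ib.
Qed.

Lemma same_off_widen a b b' p p' : b <= b' ->
  same_off a b p p' -> same_off a b' p p'.
Proof. by move=> bb h j nj; apply: h; apply: contra nj; lia. Qed.

Lemma same_off_narrow a b p p' : p b = p' b ->
  same_off a (b + 1) p p' -> same_off a b p p'.
Proof.
move=> e h j nj; have [->//|jb] := eqVneq j b.
by apply: h; apply: contra nj; lia.
Qed.

(** The eigenvalue of [K_i] at the point [k], if it is [l i] at the origin. *)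
HB.lock Definition lam (F : fieldType) (q : F) (l : int -> F) (i : int)
    (k : point) : F := l i * q ^ (2 * k i - k (i - 1) - k (i + 1)).
(** The square of the eigenvalue of [Kbar_j] at the point [k], if it is [m j] at
    the origin; [alpha_j] and [alpha_(j-1)] are the roots that involve [eps_j]. *)
HB.lock Definition msq (F : fieldType) (q : F) (m : int -> F) (j : int)
    (k : point) : F := m j * q ^ (2 * (k j - k (j - 1))).

Section Weights.
Variables (F : fieldType) (q : F).

Definition qs (d : bool) : F := if d then q else q^-1.
Definition cs (w : F) : F := w + w^-1.

Hypothesis q0 : q != 0.

Notation lam := (lam q).
Notation msq := (msq q).

Lemma qs_neq0 d : qs d != 0.
Proof. by case: d => //=; rewrite invr_eq0. Qed.

Lemma qs_sgn d : q ^ sgn d = qs d.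
Proof. by case: d. Qed.

Lemma qsN d : qs (~~ d) = (qs d)^-1.
Proof. by case: d => //=; rewrite invrK. Qed.

Lemma lam_neq0 l i k : l i != 0 -> lam l i k != 0.
Proof. by move=> li; rewrite unlock mulf_neq0 ?expfz_neq0. Qed.

Lemma msq_neq0 m j k : m j != 0 -> msq m j k != 0.
Proof. by move=> li; rewrite unlock mulf_neq0 ?expfz_neq0. Qed.

Lemma lam_shift l i k d : lam l i (shift k i d) = lam l i k * qs d ^+ 2.
Proof.
rewrite !lam.unlock -mulrA -qs_sgn exprnP exprz_exp -expfzDr // /shift.
by congr (_ * q ^ _); rewrite eqxx; do ?[case: eqP => ? /=]; lia.
Qed.

Lemma lam_shift_adj l i j k d : adj i j ->
  lam l i (shift k j d) = lam l i k / qs d.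
Proof.
move=> ij; rewrite !lam.unlock -mulrA -qs_sgn invr_expz -expfzDr // /shift.
congr (_ * q ^ _); move: ij; rewrite /adj.
by do ?[case: eqP => ? /=]; lia.
Qed.

Lemma lam_shift_far l i j k d : i != j -> ~~ adj i j ->
  lam l i (shift k j d) = lam l i k.
Proof.
move=> ij nij; rewrite !lam.unlock /shift; congr (_ * q ^ _); move: ij nij; rewrite /adj.
by do ?[case: eqP => ? /=]; lia.
Qed.

Lemma msq_shift m j k d : msq m j (shift k j d) = msq m j k * qs d ^+ 2.
Proof.
rewrite !msq.unlock -mulrA -qs_sgn exprnP exprz_exp -expfzDr // /shift.
by congr (_ * q ^ _); rewrite eqxx; do ?[case: eqP => ? /=]; lia.
Qed.

Lemma msq_shiftS m j k d : msq m (j + 1) (shift k j d) = msq m (j + 1) k / qs d ^+ 2.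
Proof.
rewrite !msq.unlock -mulrA -qs_sgn exprnP exprz_exp invr_expz -expfzDr // /shift.
by congr (_ * q ^ _); do ?[case: eqP => ? /=]; lia.
Qed.

Lemma msq_shift_far m j i k d : j != i -> j != i + 1 ->
  msq m j (shift k i d) = msq m j k.
Proof.
move=> ji jSi; rewrite !msq.unlock /shift; congr (_ * q ^ _).
by move: ji jSi; do ?[case: eqP => ? /=]; lia.
Qed.

Lemma msq_lam m l i k : m i = m (i + 1) * l i ^+ 2 ->
  msq m i k = msq m (i + 1) k * lam l i k ^+ 2.
Proof.
move=> mE; rewrite !msq.unlock !lam.unlock mE exprMn !exprnP exprz_exp mulrACA -expfzDr //.
by congr (_ * q ^ _); rewrite addrK; ring.
Qed.

End Weights.

(** * Sums of a scalar and its inverse *)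

Section CasimirAlgebra.
Variables (F : fieldType) (q : F).
Hypotheses (q0 : q != 0) (q2 : q ^+ 2 != 1).

Lemma q_subV_neq0 : q - q^-1 != 0.
Proof.
apply: contra q2; rewrite subr_eq0 => /eqP qV.
by rewrite expr2 {1}qV mulVf.
Qed.

Lemma qs2_neq1 d : qs q d ^+ 2 != 1.
Proof. by case: d => //=; rewrite exprVn invr_eq1. Qed.

Lemma csV w : cs w^-1 = cs w :> F.
Proof. by rewrite /cs invrK addrC. Qed.

Lemma cs_inv (u a : F) : u * a = 1 -> cs u = cs a.
Proof.
move=> ua; have a0 : a != 0 by apply/eqP=> a0; move/eqP: ua; rewrite a0 mulr0 eq_sym oner_eq0.
by rewrite (_ : u = a^-1) ?csV //; apply: (mulIf a0); rewrite mulVf.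
Qed.

Lemma cs_sub (u a : F) : u != 0 -> a != 0 ->
  cs u - cs a = (u - a) * (1 - (u * a)^-1).
Proof. by move=> u0 a0; rewrite /cs; field; rewrite u0 a0. Qed.

Lemma cs_eq (u a : F) : u != 0 -> a != 0 -> cs u = cs a -> u = a \/ u * a = 1.
Proof.
move=> u0 a0 /eqP; rewrite -subr_eq0 cs_sub // mulf_eq0 !subr_eq0.
case/orP=> [/eqP|/eqP e]; first by left.
by right; rewrite -[LHS]invrK -e invr1.
Qed.

(** The function [cs] only forgets the difference between a scalar and its
    inverse; since [q ^+ 2 != 1], a second value taken one step further tells
    them apart. *)
Lemma cs_inj2 (u w : F) d : u != 0 -> w != 0 ->
  cs u = cs w -> cs (u * qs q d) = cs (w * qs q d) -> u = w.
Proof.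
move=> u0 w0 e1 e2; have [//|uw] := cs_eq u0 w0 e1.
have qd := qs_neq0 q0 d.
have [|e3] := cs_eq (mulf_neq0 u0 qd) (mulf_neq0 w0 qd) e2.
  exact: mulIf.
case/eqP: (qs2_neq1 d); rewrite -e3 mulrACA uw; ring.
Qed.

(** The quadratic relation factors as
    [(c' - q^-1 c) (q c - c') = (q - q^-1)^2], and the two factors, divided by
    [q - q^-1], are [u] and its inverse. *)
Lemma cs_steps (c c' : F) d :
  c ^+ 2 + c' ^+ 2 - (q + q^-1) * c * c' + (q - q^-1) ^+ 2 = 0 ->
  exists2 u, u != 0 & c = cs u /\ c' = cs (u * qs q d).
Proof.
wlog -> : d / d = true.
  move=> H e; case: d; first exact: H.
  have [u u0 [-> ->]] := H true erefl e.
  exists u^-1; rewrite ?invr_eq0 // csV; split=> //.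
  by rewrite /= -(csV (u * q)) invfM.
move=> e; have k0 := q_subV_neq0.
have e' : (c' - q^-1 * c) * (q * c - c') = (q - q^-1) ^+ 2.
  apply/eqP; rewrite eq_sym -subr_eq0 -e; apply/eqP; field.
  by rewrite q0.
have u0 : (c' - q^-1 * c) != 0.
  by apply/eqP=> u0; move/eqP: e'; rewrite u0 mul0r eq_sym sqrf_eq0 (negPf k0).
have v0 : (q * c - c') != 0.
  by apply/eqP=> v0; move/eqP: e'; rewrite v0 mulr0 eq_sym sqrf_eq0 (negPf k0).
exists ((c' - q^-1 * c) / (q - q^-1)); first by rewrite mulf_neq0 ?invr_eq0.
have vE : ((c' - q^-1 * c) / (q - q^-1))^-1 = (q * c - c') / (q - q^-1).
  rewrite invfM invrK; apply: (mulfI u0); rewrite mulrA divff // mul1r mulrA e'.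
  by rewrite expr2 mulfK.
rewrite /cs /= [(_ * q)^-1]invfM vE.
by split; field; rewrite ?q0 /= subr_eq0 -?expr2.
Qed.

(** The two ways in which consecutive nodes constrain each other: both
    equations are linear in [u] once the factors that survive on both sides
    are cancelled. *)
Lemma hex_solve (u v a b : F) : u != 0 -> v != 0 -> a != 0 -> b != 0 ->
  cs u != cs a -> cs v != cs b ->
  (cs (q * u) - cs (a / q)) * (cs (v / q) - cs (b / q)) =
  (cs u - cs a) * (cs v - cs b) -> q ^+ 2 * u = a * b * v.
Proof.
move=> u0 v0 a0 b0 ua vb e.
have ua1 : u * a - 1 != 0.
  by apply: contra ua; rewrite subr_eq0 => /eqP/cs_inv ->.
have vb1 : v - b != 0 by apply: contra vb; rewrite subr_eq0 => /eqP ->.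
have q21 : 1 - q ^+ 2 != 0 by rewrite subr_eq0 eq_sym.
apply: (mulfI (mulf_neq0 (mulf_neq0 ua1 vb1) q21)).
have := congr1 (fun x => x * (u * v * a * b * q ^+ 2)) e; rewrite /cs => {}e.
apply/eqP; rewrite -subr_eq0; apply/eqP.
move/eqP: e; rewrite -subr_eq0 => /eqP e; rewrite -[RHS]e; field.
by rewrite q0 u0 v0 a0 b0.
Qed.

Lemma square_solve (u v a b : F) : u != 0 -> v != 0 -> a != 0 -> b != 0 ->
  cs u != cs a -> cs v != cs b ->
  (cs u - cs a) * (cs (v / q) - cs (b / q)) =
  (cs v - cs b) * (cs (u / q) - cs (a * q)) -> u = a * b * v.
Proof.
move=> u0 v0 a0 b0 ua vb e.
have ua1 : u * a - 1 != 0.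
  by apply: contra ua; rewrite subr_eq0 => /eqP/cs_inv ->.
have vb1 : v - b != 0 by apply: contra vb; rewrite subr_eq0 => /eqP ->.
have q21 : 1 - q ^+ 2 != 0 by rewrite subr_eq0 eq_sym.
apply: (mulfI (mulf_neq0 (mulf_neq0 ua1 vb1) q21)).
have := congr1 (fun x => x * (u * v * a * b * q)) e; rewrite /cs => {}e.
apply/eqP; rewrite -subr_eq0; apply/eqP.
move/eqP: e; rewrite -subr_eq0 => /eqP e; rewrite -[RHS]e; field.
by rewrite q0 u0 v0 a0 b0.
Qed.

End CasimirAlgebra.

(** * Thin systems and good values *)

Section ThinSystem.
Variables (F : fieldType) (q : F).

(** The eigenvalue of [F_i E_i] for [d = true], and of [E_i F_i] for
    [d = false], up to the factor [(q - q^-1)^2], in terms of the Casimir value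
    [c i k]. *)
Definition cas_gap (l : int -> F) (c : int -> point -> F) (d : bool) i k : F :=
  c i k - cs (if d then q * lam q l i k else lam q l i k / q).

(** What the relations of the algebra say about the set [S] of weights and the
    Casimir values [c].  A step is possible exactly when its gap is nonzero
    ([ts_edge]); the values are constant along the same and along distant nodes
    ([ts_const]) and obey the consequences of the Serre relations along adjacent
    ones ([ts_quad], [ts_lin]); [ts_square] and [ts_hex] come from the
    commutation of steps along two nodes; [ts_conn] is the induction principle
    for weights that differ only at the nodes of [J]. *)
Record thin_system (nd : pred int) (S : point -> Prop)
    (l : int -> F) (c : int -> point -> F) : Prop := ThinSystem {
  ts_l : forall i, l i != 0;
  ts_edge : forall i k d, nd i -> S k ->
    S (shift k i d) <-> cas_gap l c d i k != 0;
  ts_const : forall i j k d, nd i -> nd j -> ~~ adj i j ->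
    S k -> S (shift k j d) -> c i (shift k j d) = c i k;
  ts_quad : forall i j k d, nd i -> nd j -> adj i j ->
    S k -> S (shift k j d) ->
    c i k ^+ 2 + c i (shift k j d) ^+ 2
    - (q + q^-1) * c i k * c i (shift k j d) + (q - q^-1) ^+ 2 = 0;
  ts_lin : forall i j k d, nd i -> nd j -> adj i j ->
    S k -> S (shift k j d) -> S (shift (shift k j d) j d) ->
    c i k - (q + q^-1) * c i (shift k j d) + c i (shift (shift k j d) j d) = 0;
  ts_square : forall i j k d, nd i -> nd j -> i != j -> S k ->
    cas_gap l c d i k * cas_gap l c (~~ d) j (shift k i d) =
    cas_gap l c (~~ d) j k * cas_gap l c d i (shift k j (~~ d));
  ts_hex : forall i j k d, nd i -> nd j -> adj i j ->
    S k -> S (shift k i d) -> S (shift k j d) ->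
    cas_gap l c d i (shift k j d) * cas_gap l c d j (shift k i d) =
    cas_gap l c d i k * cas_gap l c d j k;
  ts_conn : forall (J : pred int) k k' (P : point -> Prop),
    S k -> S k' -> (forall j, ~~ J j -> k j = k' j) -> P k ->
    (forall p j d, J j -> nd j -> S p -> P p -> S (shift p j d) ->
       P (shift p j d)) -> P k'
}.

Hypotheses (q0 : q != 0) (q2 : q ^+ 2 != 1).
Variables (nd : pred int) (S : point -> Prop) (l : int -> F).
Variables (c : int -> point -> F).
Hypothesis ts : thin_system nd S l c.

Notation lam := (lam q l).
Notation gap_ := (cas_gap l c).

Section Good.
Variable m : int -> F.
Hypotheses (m0 : forall j, m j != 0) (mE : forall i, m i = m (i + 1) * l i ^+ 2).

Notation M := (msq q m).
(** The product [q mu_i mu_(i+1)], written with the square of [mu_(i+1)] and the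
    eigenvalue of [K_i] so that no square root has to be taken. *)
Definition target_arg i k := q * M (i + 1) k * lam i k.
Definition target i k := cs (target_arg i k).
Definition good_at i k := c i k = target i k.
Notation gaps := (cas_gap l target).
(** For good values the gap splits into a factor that depends on [M i] and one
    that depends on [M (i + 1)] ([gap_starE]); these are the factors. *)
Definition edge_factor (d : bool) (x : F) := if d then q ^+ 2 * x - 1 else x - 1.

Let l0 := ts_l ts.
Let lamN0 i k : lam i k != 0. Proof. exact: lam_neq0. Qed.
Let MN0 i k : M i k != 0. Proof. exact: msq_neq0. Qed.

Lemma target_arg_neq0 i k : target_arg i k != 0.
Proof. apply: mulf_neq0 (lamN0 _ _); exact: mulf_neq0 q0 (MN0 _ _). Qed.

Lemma msqE i k : M i k = M (i + 1) k * lam i k ^+ 2.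
Proof. exact: (msq_lam q0 _ (mE i)). Qed.

Lemma gap_starE d i k :
  gaps d i k = lam i k / (q * M i k) * edge_factor d (M i k) * edge_factor (~~ d) (M (i + 1) k).
Proof.
rewrite /cas_gap /target /cs /target_arg /edge_factor [msq q m i k]msqE.
by case: d => /=; field; rewrite ?q0 ?lamN0 ?MN0.
Qed.

Lemma gap_star_eq0 d i k :
  (gaps d i k == 0) = (edge_factor d (M i k) == 0) || (edge_factor (~~ d) (M (i + 1) k) == 0).
Proof.
rewrite gap_starE !mulf_eq0 invr_eq0 (negPf (lamN0 _ _)) mulf_eq0.
by rewrite (negPf q0) (negPf (MN0 _ _)).
Qed.

Lemma good_gap d i k : good_at i k -> gap_ d i k = gaps d i k.
Proof. by rewrite /cas_gap => ->. Qed.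

Lemma gap_good d i k : gap_ d i k = gaps d i k -> good_at i k.
Proof. by move=> /addIr. Qed.

Lemma edge_factor_div d x : edge_factor d (x / qs q d ^+ 2) = edge_factor (~~ d) x.
Proof. by rewrite /edge_factor; case: d => /=; field; rewrite ?q0 ?oner_neq0. Qed.

Lemma target_arg_shift_same i k d : target_arg i (shift k i d) = target_arg i k.
Proof.
rewrite /target_arg msq_shiftS // lam_shift // -!mulrA; congr (_ * (_ * _)).
by rewrite mulrC mulfK // expf_neq0 // qs_neq0.
Qed.

Lemma target_arg_shift_far i j k d : i != j -> ~~ adj i j ->
  target_arg i (shift k j d) = target_arg i k.
Proof.
move=> ij nij; rewrite /target_arg lam_shift_far // msq_shift_far //.
  by move: nij; rewrite /adj negb_or eq_sym => /andP[].
by apply: contra ij => /eqP; lia.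
Qed.

Lemma target_arg_const i j k d : ~~ adj i j -> target_arg i (shift k j d) = target_arg i k.
Proof.
by case: (eqVneq i j) => [-> _|*]; [exact: target_arg_shift_same|exact: target_arg_shift_far].
Qed.

Lemma target_arg_shiftP i k d : target_arg (i + 1) (shift k i d) = target_arg (i + 1) k / qs q d.
Proof.
rewrite /target_arg (lam_shift_adj q0) /adj ?eqxx ?orbT //.
by rewrite msq_shift_far ?mulrA //; apply/eqP; lia.
Qed.

Lemma good_const i j k d : nd i -> nd j -> ~~ adj i j -> S k -> S (shift k j d) ->
  good_at i k -> good_at i (shift k j d).
Proof.
by move=> ni nj nij Sk Sk' g; rewrite /good_at (ts_const ts) // g /target target_arg_const.
Qed.

Lemma gap_const d i j k e : nd i -> nd j -> i != j -> ~~ adj i j ->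
  S k -> S (shift k j e) -> gap_ d i (shift k j e) = gap_ d i k.
Proof. by move=> *; rewrite /cas_gap (ts_const ts) // lam_shift_far. Qed.

Lemma star_square s j p d : adj s j ->
  gaps d s p * gaps (~~ d) j (shift p s d) =
  gaps (~~ d) j p * gaps d s (shift p j (~~ d)).
Proof.
move=> a; have qd := qs_neq0 q0 d.
rewrite !gap_starE !negbK; rewrite !(lam_shift_adj q0 l) // 1?adjC //.
move: a; rewrite /adj => /orP[/eqP->|/eqP->].
  rewrite !msq_shiftS // !msq_shift // !msq_shift_far //; try by apply/eqP; lia.
  by rewrite !qsN /edge_factor; case: d qd => /= qd; field; rewrite ?q0 ?MN0 ?oner_neq0.
rewrite !msq_shiftS // !msq_shift // !msq_shift_far //; try by apply/eqP; lia.
by rewrite !qsN /edge_factor; case: d qd => /= qd; field; rewrite ?q0 ?MN0 ?oner_neq0.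
Qed.

(** A step along [s] can only disturb the value at an adjacent node [j]; the
    square spanned by the step and a step along [j] in the opposite direction
    pins it down again. *)
Lemma good_step s j p d : nd s -> nd j -> adj s j -> S p -> S (shift p s d) ->
  good_at s p -> good_at j p ->
  (S (shift p j (~~ d)) -> good_at s (shift p j (~~ d))) -> good_at j (shift p s d).
Proof.
move=> ns nj sj Sp Sps gs gj gsj; apply: (@gap_good (~~ d)).
have sNj : s != j by apply/eqP; move: sj; rewrite /adj; lia.
have e0 : gap_ d s p != 0 by apply/(ts_edge ts).
apply: (mulfI e0); rewrite (ts_square ts) // (good_gap _ gs) star_square //.
rewrite -(good_gap _ gj).
have [->|n0] := eqVneq (gap_ (~~ d) j p) 0; first by rewrite !mul0r.
by rewrite (good_gap _ (gsj _)) //; apply/(ts_edge ts).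
Qed.

Definition good_on (a b : int) (p : point) :=
  forall p', S p' -> same_off a b p p' ->
  forall i, a <= i <= b -> good_at i p'.

(** The nodes moved inside the piece are not adjacent to [i], so no step changes
    the gap. *)
Lemma gap_piece a b i d p p' : nd i -> b < i -> S p -> S p' ->
  same_off a b p p' -> gap_ d i p = gap_ d i p'.
Proof.
move=> ni bi Sp Sp' pp'.
apply: (ts_conn ts (J := fun j => a <= j < b) (P := fun x => gap_ d i p = gap_ d i x)
  Sp Sp') => // x j e jb nj Sx -> Sx'.
rewrite gap_const //; first by apply/eqP; lia.
by rewrite /adj; apply/norP; split; apply/eqP; lia.
Qed.

Lemma good_piece a b i p p' : nd i -> b < i -> S p -> S p' ->
  same_off a b p p' -> good_at i p -> good_at i p'.
Proof.
move=> ni bi Sp Sp' pp' gi.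
apply: (ts_conn ts (J := fun j => a <= j < b) (P := good_at i) Sp Sp')
  => // x j e jb nj Sx gx Sx'.
by apply: good_const => //; rewrite /adj; apply/norP; split; apply/eqP; lia.
Qed.

(** Induction on the length of the piece, walking through the new piece from its
    starting point.  Where a weight of the new piece has an old weight next to
    it, [good_step] carries the values over.  A step along [b] leads to such a
    weight, or else it goes in the direction [d] from one; then the square
    spanned by that step and the step back into the old piece gives the value
    at [z], and the induction hypothesis for the piece that ends in [b] gives the
    values at the other nodes. *)
Lemma good_on_step n a p0 d (z := a + n%:Z) :
  (forall i, a <= i <= z -> nd i) -> S p0 -> S (shift p0 z d) ->
  good_on a z p0 -> good_on a z (shift p0 z d).
Proof.
elim: n => [|n IHn] in a p0 d z *.
  move=> nds Sp0 Sp1 g0 p' Sp' pp' i il.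
  have ia : i = z by lia.
  have nl : nd z by apply: nds; lia.
  have <- : shift p0 z d = p' by apply/funext=> j; apply: pp'; lia.
  rewrite ia; apply: good_const => //; first by rewrite /adj; apply/norP; split; apply/eqP; lia.
  by apply: g0 => //; lia.
move=> nds Sp0 Sp1 g0; set p1 := shift p0 z d in Sp1 *.
pose b := a + n%:Z; have lE : z = b + 1 by rewrite /z /b; lia.
have nb : nd b by apply: nds; rewrite lE; lia.
have nl : nd z by apply: nds; rewrite lE; lia.
have bl : adj b z by rewrite /adj lE eqxx.
have lb : adj z b by rewrite adjC.
have bNl : b != z by apply/eqP; lia.
have off1 p : same_off a z p1 p -> same_off a z p0 (shift p z (~~ d)).
  move=> h j nj; rewrite /shift -h // /p1 /shift.
  by case: eqP; case: (d) => /= _; lia.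
have widen p p' : same_off a b p p' -> same_off a z p p'.
  by apply: same_off_widen; lia.
(* the weights of the new piece that lie next to a weight of the old one *)
have touch p : S p -> same_off a z p1 p -> S (shift p z (~~ d)) ->
    forall i, a <= i <= z -> good_at i p.
  move=> Sp h Sq i il; have gq j : a <= j <= z -> good_at j (shift p z (~~ d)).
    by apply: g0 => //; apply: off1.
  have ni := nds i il; rewrite -[p](shiftNK _ z d).
  have [ib|ib] := boolP (adj i z); last first.
    by apply: good_const; rewrite ?shiftNK //; apply: gq.
  have -> : i = b by move: ib; rewrite /adj; lia.
  apply: good_step; rewrite ?shiftNK //; try by apply: gq; lia.
  move=> Sr; apply: g0 => //; last by lia.
  apply: same_off_trans (off1 _ h) _; apply: same_off_shift; lia.
have level p p' : S p -> S p' -> same_off a z p1 p -> same_off a z p1 p' ->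
    p b = p' b -> S (shift p z (~~ d)) -> S (shift p' z (~~ d)).
  move=> Sp Sp' h h' e /(ts_edge ts (~~ d) nl Sp) n0.
  apply/(ts_edge ts) => //; rewrite -(@gap_piece a b z _ p p') //; first by lia.
  by apply: same_off_narrow; rewrite -?lE //; apply: same_off_trans (same_off_sym h) h'.
pose Inv p := [/\ same_off a z p1 p,
  forall p', S p' -> same_off a b p p' -> forall i, a <= i <= z -> good_at i p' &
  S (shift p z (~~ d)) \/ exists p2, [/\ S p2, same_off a z p1 p2,
    S (shift p2 z (~~ d)) & p2 b = p b - sgn d]].
have fibre p : S p -> same_off a z p1 p -> S (shift p z (~~ d)) ->
    forall p', S p' -> same_off a b p p' -> forall i, a <= i <= z -> good_at i p'.
  move=> Sp h Sq p' Sp' pp'.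
  have h' : same_off a z p1 p' := same_off_trans h (widen _ _ pp').
  apply: touch => //; apply: (level p) => //; apply: pp'; lia.
move=> p' Sp' h'.
suff: Inv p' by case=> _ + _; apply.
apply: (ts_conn ts (J := fun j => a <= j < z) (P := Inv) Sp1 Sp') => //.
  have S1 : S (shift p1 z (~~ d)) by rewrite shiftK.
  by split=> //; [exact: fibre|left].
move=> {p' Sp' h'} p j e jl nj Sp [h gp tp] Sp'.
have h' : same_off a z p1 (shift p j e) := same_off_trans h (same_off_shift _ _ jl).
have [jb|] := eqVneq j b; last first.
  move=> jb; have jab : a <= j < b by lia.
  split=> // [p' Sq pq|]; first by apply: gp => //; exact: same_off_trans (same_off_shift _ _ jab) pq.
  have eb : shift p j e b = p b by rewrite shift_off // eq_sym.
  case: tp => [tp|[p2 [S2 h2 t2 e2]]]; first by left; apply: (level p).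
  by right; exists p2; rewrite eb.
rewrite {j jl nj}jb in Sp' h' *.
have gpb i : a <= i <= z -> good_at i p by apply: gp.
suff [gl tp'] : good_at z (shift p b e) /\ (S (shift (shift p b e) z (~~ d)) \/
    exists p2, [/\ S p2, same_off a z p1 p2, S (shift p2 z (~~ d)) &
      p2 b = shift p b e b - sgn d]).
  split=> // p' Sq pq i il.
  have [il'|nil] := eqVneq i z; first by rewrite il'; apply: (good_piece _ _ Sp' Sq pq) => //; lia.
  suff: good_on a b (shift p b e) by apply=> //; lia.
  apply: IHn => // [k kb|p2 S2 pp2 k kb]; first by apply: nds; lia.
  by apply: gp => //; lia.
have up : S (shift (shift p b e) z (~~ d)) -> good_at z (shift p b e) /\
    (S (shift (shift p b e) z (~~ d)) \/ exists p2, [/\ S p2, same_off a z p1 p2,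
       S (shift p2 z (~~ d)) & p2 b = shift p b e b - sgn d]).
  by move=> t; split; [apply: touch => //; lia|left].
have [ed|ed] := eqVneq e d; last first.
  have {}ed : e = ~~ d by case: (e) (d) ed => -[].
  apply: up; rewrite {e}ed in Sp' h' *.
  case: tp => [tp|[p2 [S2 h2 t2 e2]]]; last first.
    apply: (level p2) => //; rewrite e2 shift_at; case: (d) => /=; lia.
  apply/(ts_edge ts) => //.
  have := ts_square ts d nb nl bNl Sp'; rewrite shiftNK => e2.
  have: gap_ d b (shift p b (~~ d)) * gap_ (~~ d) z p != 0.
    by apply: mulf_neq0; apply/(ts_edge ts); rewrite ?shiftNK.
  by rewrite e2 mulf_eq0 negb_or => /andP[].
rewrite {e}ed in Sp' h' up *.
have [tp'|ntp] := pselect (S (shift p z (~~ d))).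
  split; last by right; exists p; rewrite shift_at; split=> //; lia.
  apply: good_step => //; try by apply: gpb; lia.
  by move=> Sq; apply: g0 (off1 _ h) _ _ => //; lia.
(* without an old weight next to [p] a factor of the gap at [z] vanishes; it is
   also a factor of the gap at [b], so the step along [b] could not exist *)
exfalso; have: gap_ d b p != 0 by apply/(ts_edge ts).
have : gap_ d z p0 != 0 by apply/(ts_edge ts).
have gl0 : good_at z p0 by apply: g0 => //; lia.
rewrite (good_gap _ gl0) gap_star_eq0 negb_or => /andP[_ M1].
have : gap_ (~~ d) z p == 0 by apply/negPn/negP=> /(ts_edge ts (~~ d) nl Sp).
have gl : good_at z p by apply: gpb; lia.
have gb : good_at b p by apply: gpb; lia.
rewrite (good_gap _ gl) (good_gap _ gb) !gap_star_eq0 negbK -lE.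
have -> : M (z + 1) p = M (z + 1) p0 / qs q d ^+ 2.
  rewrite -msq_shiftS // -/p1 !msq.unlock !h //; apply/negP; lia.
by rewrite edge_factor_div (negPf M1) orbF => /eqP ->; rewrite eqxx orbT.
Qed.

(** Moving along [a .. b - 1] stays in a piece of good values by definition, and
    a step along [b] is [good_on_step]. *)
Lemma good_piece_extend a b p p' : a <= b -> (forall i, a <= i <= b -> nd i) ->
  S p -> S p' -> same_off a (b + 1) p p' -> good_on a b p ->
  forall i, a <= i <= b -> good_at i p'.
Proof.
move=> ab nds Sp Sp' pp' gp i ib.
suff : good_on a b p' by apply.
apply: (ts_conn ts (J := fun j => a <= j < b + 1) (P := good_on a b) Sp Sp') => //.
move=> x j e jb nj Sx gx Sx'; have [jb'|jNb] := eqVneq j b.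
  have bE : b = a + `|b - a|%N%:Z by lia.
  by rewrite {j jb nj}jb' bE in nds gx Sx' *; apply: good_on_step.
move=> y Sy xy; apply: gx => //.
by apply: same_off_trans xy; apply: same_off_shift; lia.
Qed.

End Good.
End ThinSystem.

(** * Casimir values at two neighbouring nodes *)

Section EdgePairs.
Variables (F : fieldType) (q : F).
Hypotheses (q0 : q != 0) (q2 : q ^+ 2 != 1).
Variables (nd : pred int) (S : point -> Prop) (l : int -> F).
Variables (c : int -> point -> F).
Hypothesis ts : thin_system q nd S l c.

Notation lam := (lam q l).
Notation gap := (cas_gap q l c).

Let lamN0 i k : lam i k != 0. Proof. exact: lam_neq0 (ts_l ts i). Qed.

(** Write [c_b] at the two ends of the edge along [b + 1] as [cs u] and
    [cs (u q^+-1)].  When both steps go the same way, [ts_hex] applies, otherwise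
    [ts_square]; either equation determines [u].  The four sign cases reduce to
    two by replacing scalars with their inverses. *)
Lemma casimir_neighbour_step b p w d s :
  nd b -> nd (b + 1) -> S p -> S (shift p b d) -> S (shift p (b + 1) s) ->
  w != 0 -> c (b + 1) p = cs w -> c (b + 1) (shift p b d) = cs (w / qs q d) ->
  c b p = cs (w * lam b p * lam (b + 1) p).
Proof.
move=> nb nl Sp Sb Sl w0 cl cl'.
have adjb : adj b (b + 1) by rewrite /adj eqxx.
have adjl : adj (b + 1) b by rewrite adjC.
have bl : b != b + 1 by apply/eqP; lia.
have [u u0 [cb cb']] := cs_steps q0 q2 s (ts_quad ts nb nl adjb Sp Sl).
have x0 := lamN0 b p; have y0 := lamN0 (b + 1) p.
set x := lam b p in x0 *; set y := lam (b + 1) p in y0 *.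
have gb : gap d b p != 0 by apply/(ts_edge ts).
have gl : gap s (b + 1) p != 0 by apply/(ts_edge ts).
have hex := ts_hex ts nb nl adjb Sp (d := d).
have sq := ts_square ts d nb nl bl Sp.
rewrite cb; congr cs.
move: gb gl hex sq; rewrite /cas_gap !lam_shift_adj // -/x -/y cb cl.
case: d s Sb Sl cl' cb' => -[] Sb Sl cl' cb'; rewrite /= ?subr_eq0 in cl' cb' * => gb gl hex sq.
- have {hex}e := hex Sb Sl; rewrite cl' cb' in e.
  have := hex_solve q0 q2 u0 w0 (mulf_neq0 q0 x0) (mulf_neq0 q0 y0) gb gl.
  rewrite -[q * x / q]mulrA -[q * y / q]mulrA [q * u]mulrC => /(_ e) h.
  apply: (mulfI (expf_neq0 2 q0)); rewrite h; ring.
- rewrite cl' cb' invrK in sq.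
  have := square_solve q0 q2 u0 w0 (mulf_neq0 q0 x0) (mulf_neq0 y0 (invr_neq0 q0)) gb gl.
  rewrite -[q * x * q]mulrA => /(_ sq) ->; field; exact: q0.
- rewrite cl' cb' in sq.
  have := @square_solve _ _ q0 q2 u^-1 w^-1 (q / x) (q * y)^-1.
  have -> : cs (w^-1 / q) = cs (w / q^-1) by apply: cs_inv; field; rewrite ?q0 ?x0 ?y0 ?w0 ?u0 ?oner_neq0.
  have -> : cs ((q * y)^-1 / q) = cs (q * (y / q^-1)) by apply: cs_inv; field; rewrite ?q0 ?x0 ?y0 ?w0 ?u0 ?oner_neq0.
  have -> : cs (u^-1 / q) = cs (u * q) by apply: cs_inv; field; rewrite ?q0 ?x0 ?y0 ?w0 ?u0 ?oner_neq0.
  have -> : cs (q / x * q) = cs (x / q / q) by apply: cs_inv; field; rewrite ?q0 ?x0 ?y0 ?w0 ?u0 ?oner_neq0.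
  have -> : cs (q / x) = cs (x / q) by apply: cs_inv; field; rewrite ?q0 ?x0 ?y0 ?w0 ?u0 ?oner_neq0.
  rewrite !csV !invr_eq0 => /(_ u0 w0 (mulf_neq0 q0 (invr_neq0 x0)) (mulf_neq0 q0 y0) gb gl sq) h.
  by rewrite -[u]invrK h; field; rewrite ?q0 ?x0 ?y0 ?w0 ?u0 ?oner_neq0.
- have {hex}e := hex Sb Sl; rewrite cl' cb' in e.
  have := @hex_solve _ _ q0 q2 u^-1 w^-1 (q / x) (q / y).
  have -> : cs (w^-1 / q) = cs (w / q^-1) by apply: cs_inv; field; rewrite ?q0 ?x0 ?y0 ?w0 ?u0 ?oner_neq0.
  have -> : cs (q / y / q) = cs (y / q^-1 / q) by apply: cs_inv; field; rewrite ?q0 ?x0 ?y0 ?w0 ?u0 ?oner_neq0.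
  have -> : cs (q * u^-1) = cs (u / q) by apply: cs_inv; field; rewrite ?q0 ?x0 ?y0 ?w0 ?u0 ?oner_neq0.
  have -> : cs (q / x / q) = cs (x / q^-1 / q) by apply: cs_inv; field; rewrite ?q0 ?x0 ?y0 ?w0 ?u0 ?oner_neq0.
  have -> : cs (q / x) = cs (x / q) by apply: cs_inv; field; rewrite ?q0 ?x0 ?y0 ?w0 ?u0 ?oner_neq0.
  have -> : cs (q / y) = cs (y / q) by apply: cs_inv; field; rewrite ?q0 ?x0 ?y0 ?w0 ?u0 ?oner_neq0.
  rewrite !csV !invr_eq0 => /(_ u0 w0 (mulf_neq0 q0 (invr_neq0 x0)) (mulf_neq0 q0 (invr_neq0 y0)) gb gl e) h.
  have uE : u^-1 = (w * x * y)^-1.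
    by apply: (mulfI (expf_neq0 2 q0)); rewrite h; field; rewrite ?q0 ?x0 ?y0 ?w0 ?u0 ?oner_neq0.
  by rewrite -[u]invrK uE invrK.
Qed.

(** The two ends of an edge along [b] have eigenvalues of [K_(b+1)] that differ
    by a factor [q], so at least one of them also has an edge along [b + 1]. *)
Lemma casimir_neighbour b p w : nd b -> nd (b + 1) -> S p -> S (shift p b true) ->
  w != 0 -> c (b + 1) p = cs w -> c (b + 1) (shift p b true) = cs (w / q) ->
  c b p = cs (w * lam b p * lam (b + 1) p).
Proof.
move=> nb nl Sp Sp' w0 cl cl'.
have adjl : adj (b + 1) b by rewrite /adj eqxx orbT.
have edgeless k : S k -> (forall s, ~ S (shift k (b + 1) s)) -> lam (b + 1) k ^+ 2 = 1.
  move=> Sk ns; have k0 := lamN0 (b + 1) k.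
  have /eqP e1 : gap true (b + 1) k == 0.
    by apply/negPn/negP=> /(ts_edge ts _ nl Sk)/ns.
  have /eqP e2 : gap false (b + 1) k == 0.
    by apply/negPn/negP=> /(ts_edge ts _ nl Sk)/ns.
  have : (q - q^-1) * (lam (b + 1) k)^-1 * (lam (b + 1) k ^+ 2 - 1) = 0.
    transitivity (gap false (b + 1) k - gap true (b + 1) k); last by rewrite e1 e2 subrr.
    by rewrite /cas_gap /cs; field; rewrite ?q0 ?k0.
  move/eqP; rewrite !mulf_eq0 invr_eq0 (negPf k0) (negPf (q_subV_neq0 q0 q2)) /=.
  by rewrite subr_eq0 => /eqP.
have [[s Sl]|nl1] := pselect (exists s, S (shift p (b + 1) s)).
  exact: (casimir_neighbour_step (d := true) nb nl Sp Sp' Sl).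
have [[s Sl]|nl2] := pselect (exists s, S (shift (shift p b true) (b + 1) s)).
  have := casimir_neighbour_step (d := false) (w := w / q) nb nl Sp' _ Sl.
  rewrite (shiftK p b true) /= => /(_ Sp (mulf_neq0 w0 (invr_neq0 q0)) cl').
  rewrite invrK divfK // => /(_ cl).
  rewrite (ts_const ts) //; last by rewrite /adj; apply/norP; split; apply/eqP; lia.
  by rewrite lam_shift // lam_shift_adj // => ->; congr cs; rewrite /=; field.
have := edgeless _ Sp' (fun s Sl => nl2 (ex_intro _ s Sl)).
rewrite lam_shift_adj // exprMn edgeless ?mul1r => [|//|s Sl]; last by apply: nl1; exists s.
by move/eqP; rewrite exprVn invr_eq1 (negPf q2).
Qed.

End EdgePairs.

(** * Propagation to the next node *)

Section Propagation.
Variables (F : fieldType) (q : F).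
Hypotheses (q0 : q != 0) (q2 : q ^+ 2 != 1) (q4 : q ^+ 4 != 1).
Variables (nd : pred int) (S : point -> Prop) (l : int -> F).
Variables (c : int -> point -> F).
Hypothesis ts : thin_system q nd S l c.
Variable m : int -> F.
Hypotheses (m0 : forall j, m j != 0) (mE : forall i, m i = m (i + 1) * l i ^+ 2).

Notation lam := (lam q l).
Notation M := (msq q m).
Notation gap := (cas_gap q l c).
Notation good := (good_at q l c m).
Notation gaps := (cas_gap q l (target q l m)).
Notation hfac := (edge_factor q).
Notation warg := (target_arg q l m).

Let lamN0 i k : lam i k != 0. Proof. exact: lam_neq0 (ts_l ts i). Qed.
Let warg0 i k : warg i k != 0. Proof. exact (target_arg_neq0 q0 ts m0 i k). Qed.

Lemma good_edge d i k : nd i -> S k -> good i k ->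
  S (shift k i d) <-> hfac d (M i k) != 0 /\ hfac (~~ d) (M (i + 1) k) != 0.
Proof.
move=> ni Sk gk; rewrite (ts_edge ts d ni Sk) (good_gap _ gk).
by rewrite (gap_star_eq0 q0 ts m0 mE) negb_or; split=> [/andP|/andP].
Qed.

Lemma edge_factor_twice d x : hfac d x = 0 -> hfac (~~ d) (x / qs q d ^+ 2) != 0.
Proof.
move=> h0; apply: contra q4; rewrite /edge_factor in h0 *.
case: d h0 => /= /eqP; rewrite subr_eq0 => /eqP h0; rewrite subr_eq0 => /eqP h1.
  have xE : x = q ^+ 2 by rewrite -[x](divfK (expf_neq0 2 q0)) h1 mul1r.
  by rewrite (exprD q 2 2) -{2}xE h0.
by move: h1; rewrite h0 exprVn invrK mul1r (exprD q 2 2) => ->.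
Qed.

Lemma edge_factor_dich d x : hfac d x = 0 -> hfac (~~ d) x != 0.
Proof.
move=> h0; apply: contra q2; rewrite /edge_factor in h0 *.
case: d h0 => /= /eqP; rewrite subr_eq0 => /eqP h0; rewrite subr_eq0 => /eqP h1.
  by move: h0; rewrite h1 mulr1 => ->.
by move: h1; rewrite h0 mulr1 => ->.
Qed.

(** A level of the piece consists of its weights with a given coordinate at [b].
    On a level the value at [z] does not change ([good_piece]).  From two
    consecutive good levels the next one is obtained by the linear relation of
    three weights in a row; a walk through the piece crosses every level in
    between, and the factors of the gaps show that three weights in a row occur
    among these crossings. *)
Lemma good_levels a b g (z := b + 1) : a <= b ->
  (forall i, a <= i <= z -> nd i) -> S g -> S (shift g b true) ->
  (forall p, S p -> same_off a z g p -> forall i, a <= i <= b -> good i p) ->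
  good z g -> good z (shift g b true) ->
  forall p, S p -> same_off a z g p -> good z p.
Proof.
move=> ab nds Sg Sg1 gb gz0 gz1.
have nb : nd b by apply: nds; lia.
have nz : nd z by apply: nds; lia.
have adjz : adj z b by rewrite /adj eqxx orbT.
have nbz : ~~ (a <= b + 1 < z) by rewrite ltxx andbF.
pose pc p := S p /\ same_off a z g p.
have pc_shift p j d : pc p -> a <= j < z -> S (shift p j d) -> pc (shift p j d).
  by move=> [Sp h] jz Sp'; split=> //; apply: same_off_trans h (same_off_shift _ _ jz).
pose Lv r := forall p, pc p -> p b = r -> good z p.
have lv p : pc p -> good z p -> Lv (p b).
  move=> [Sp h] gp p' [Sp' h'] e; apply: (@good_piece _ _ q0 q2 _ _ _ _ ts m a b _ p) => //; first by lia.
  by apply: same_off_narrow => //; exact: (same_off_trans (same_off_sym h) h').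
have cross d s p0 p : pc p0 -> pc p -> sgn d * p0 b <= sgn d * s -> sgn d * s + 1 <= sgn d * p b ->
    exists u, [/\ pc u, u b = s & S (shift u b d)].
  move=> [S0 h0] [Sp h] l0 l1; apply: contrapT => no.
  suff : pc p /\ sgn d * p b <= sgn d * s by case=> _; lia.
  apply: (ts_conn ts (J := fun j => a <= j < z) (P := fun x => pc x /\ sgn d * x b <= sgn d * s) S0 Sp) => //.
    exact (same_off_trans (same_off_sym h0) h).
  move=> x j e jz nj Sx [pcx lx] Sx'; split; first exact: pc_shift.
  have [jb|jb] := eqVneq j b; last by rewrite shift_off // eq_sym.
  rewrite {j jz nj}jb in Sx' *; rewrite shift_at.
  have [ex|ne] := eqVneq (x b) s.
    have [ed|ed] := eqVneq e d; first by case: no; exists x; rewrite -ed.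
    by move: ed; rewrite ex; case: (d) (e) => -[] //= _; lia.
  by case: (d) (e) lx ne => -[] /=; lia.
have triple d r : Lv r -> (exists2 p, pc p & p b = r) -> Lv (r + sgn d) -> Lv (r + sgn d + sgn d).
  move=> Lr [pr pcr er] Lr1 p pcp ep.
  have [u2 [pc2 e2 S2]] := cross d (r + sgn d) _ _ pcr pcp ltac:(by rewrite er; case: (d) => /=; lia) ltac:(by rewrite ep; case: (d) => /=; lia).
  have [u [pcu eu Su]] := cross d r _ _ pcr pcp ltac:(by rewrite er; case: (d) => /=; lia) ltac:(by rewrite ep; case: (d) => /=; lia).
  pose u1 := shift u b d.
  have pc1 : pc u1 by apply: pc_shift => //; lia.
  have e1 : u1 b = r + sgn d by rewrite /u1 shift_at eu.
  have S1 : S (shift u1 b (~~ d)) by rewrite /u1 shiftK; case: pcu.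
  have [v [pcv ev Sv Sv']] : exists v, [/\ pc v, v b = r + sgn d, S (shift v b (~~ d)) & S (shift v b d)].
    apply: contrapT => no.
    suff [pcu2 eu2 Su2] : [/\ pc u2, u2 b = r + sgn d & S (shift u2 b (~~ d))] by apply: no; exists u2.
    apply: (ts_conn ts (J := fun j => a <= j < b) (P := fun x => [/\ pc x, x b = r + sgn d & S (shift x b (~~ d))]) (proj1 pc1) (proj1 pc2)) => //.
      apply: (same_off_narrow (a := a)); rewrite ?e1 ?e2 //.
      exact (same_off_trans (same_off_sym (proj2 pc1)) (proj2 pc2)).
    move=> x j e jb nj Sx [pcx ex Sxd] Sx'.
    have pcx' : pc (shift x j e) by apply: pc_shift => //; lia.
    have ex' : shift x j e b = r + sgn d by rewrite shift_off //; apply/eqP; lia.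
    split=> //; have [adjb|nadj] := boolP (adj b j); last first.
      apply/(ts_edge ts) => //; rewrite (gap_const q0 ts) //; first exact/(ts_edge ts).
      by apply/eqP; lia.
    have bE : b = j + 1 by move: adjb; rewrite /adj; lia.
    have gx : good b x by apply: gb; [case: pcx|case: pcx|lia].
    have gx' : good b (shift x j e) by apply: gb; [case: pcx'|case: pcx'|lia].
    have gj : good j x by apply: gb; [case: pcx|case: pcx|lia].
    have g2 : good b u2 by apply: gb; [case: pc2|case: pc2|lia].
    have [h1 h2] := (good_edge (~~ d) nb Sx gx).1 Sxd.
    have [h3 h4] := (good_edge d nb (proj1 pc2) g2).1 S2.
    have [h5 h6] := (good_edge e nj Sx gj).1 Sx'.
    rewrite negbK in h2.
    have Mz y : pc y -> y b = r + sgn d -> M (b + 1) y = M (b + 1) u2.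
      move=> [Sy hy] ey; rewrite !msq.unlock addrK ey e2.
      by rewrite -(hy _ nbz) -(proj2 pc2 _ nbz).
    have h0 : hfac d (M b x) = 0.
      apply/eqP/negPn/negP=> hN; apply: no; exists x; split=> //.
      by apply/(good_edge d nb Sx gx); rewrite (Mz x).
    have ed : e = d.
      apply/eqP; apply: contraNT h6 => ed; rewrite -bE.
      by rewrite (_ : ~~ e = d) ?h0 //; case: (e) (d) ed => -[].
    apply/(good_edge (~~ d) nb Sx' gx'); rewrite negbK (Mz _ pcx' ex') -(Mz _ pcx ex); split=> //.
    by rewrite ed {1}bE msq_shiftS // -bE edge_factor_twice.
  have good_v : good z v := Lr1 _ pcv ev.
  have pck : pc (shift v b (~~ d)) by apply: pc_shift => //; lia.
  have good_k : good z (shift v b (~~ d)).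
    by apply: Lr pck _; rewrite shift_at ev; case: (d) => /=; lia.
  have pcv' : pc (shift v b d) by apply: pc_shift => //; lia.
  suff gv' : good z (shift v b d) by apply: (lv _ pcv' gv') => //; rewrite ep shift_at ev.
  have := ts_lin ts nz nb adjz (k := shift v b (~~ d)) (d := d); rewrite shiftNK.
  move=> /(_ Sv (proj1 pcv) Sv'); rewrite good_k good_v /target.
  rewrite !(target_arg_shiftP q0 q2) qsN invrK => e.
  apply/eqP; rewrite -subr_eq0 -e /target target_arg_shiftP //; apply/eqP; rewrite /cs.
  have w0 := warg0 (b + 1) v; have qd := qs_neq0 q0 d.
  by case: (d) => /=; field; rewrite ?q0 ?w0 ?oner_neq0.
suff H p : S p -> same_off a z g p -> [/\ Lv (p b - 1), Lv (p b) & Lv (p b + 1)].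
  by move=> p Sp h; case: (H p Sp h) => _ + _; apply.
move=> Sp h.
have pcg : pc g by [].
have pcg1 : pc (shift g b true) by apply: pc_shift => //; lia.
have L0 := lv _ pcg gz0; have := lv _ pcg1 gz1; rewrite shift_at /= => L1.
suff : [/\ Lv (p b - 1), Lv (p b) & Lv (p b + 1)] /\ pc p by case.
apply: (ts_conn ts (J := fun j => a <= j < z) (P := fun x => [/\ Lv (x b - 1), Lv (x b) & Lv (x b + 1)] /\ pc x) Sg Sp) => //.
  split=> //; split=> //.
  have := triple false (g b + 1) L1; rewrite /= addrK; apply=> //.
  by exists (shift g b true); rewrite ?shift_at.
move=> x j e jz nj Sx [[La Lb Lc] pcx] Sx'; split; last exact: pc_shift.
have [jb|jb] := eqVneq j b; last by rewrite shift_off // eq_sym.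
rewrite {j jz nj}jb in Sx' *; rewrite shift_at.
have t e' : Lv (x b + sgn e') -> Lv (x b + sgn e' + sgn e') by apply: triple => //; exists x.
by case: e Sx' => /= _; rewrite ?subrK ?addrK; split=> //; [apply: (t true)|apply: (t false)].
Qed.

Lemma lin_third (u : F) x : u != 0 ->
  cs u - (q + q^-1) * cs (u / q) + x = 0 -> x = cs (u / q / q).
Proof.
move=> u0 e; apply/eqP; rewrite -subr_eq0 -e /cs; apply/eqP.
by field; rewrite ?q0 ?u0 ?oner_neq0.
Qed.

(** With [lam_i = mu_i / mu_(i+1)], both sides are [q mu_b mu_(b+1)]. *)
Lemma target_arg_next b k : warg b k = warg (b + 1) k * lam b k * lam (b + 1) k.
Proof.
rewrite /target_arg (msq_lam q0 _ (mE (b + 1))).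
by rewrite expr2; ring.
Qed.

(** Three weights in a row along [b] leave room for a square with the node
    [b - 1]; comparing the two values of the neighbouring Casimir element at
    its opposite sides removes the ambiguity between [u] and its inverse. *)
Lemma good_next a b g : a < b -> (forall i, a <= i <= b + 1 -> nd i) ->
  S g -> S (shift g b true) -> S (shift (shift g b true) b true) ->
  (forall p, S p -> same_off a (b + 1) g p -> forall i, a <= i <= b -> good i p) ->
  good (b + 1) g /\ good (b + 1) (shift g b true).
Proof.
move=> ab nds S0 S1 S2 gp; set g1 := shift g b true in S1 S2 *.
pose g2 := shift g1 b true; pose z := b + 1; pose j := b - 1.
have jz : a <= j < z by rewrite /z /j; lia.
have jb : a <= j <= b by rewrite /j; lia.
have bz : a <= b < z by rewrite /z; lia.
have bb : a <= b <= b by lia.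
have offj p d : same_off a z g p -> same_off a z g (shift p j d).
  by move=> h; apply: same_off_trans h _; apply: same_off_shift.
have offb p d : same_off a z g p -> same_off a z g (shift p b d).
  by move=> h; apply: same_off_trans h _; apply: same_off_shift.
have off1 : same_off a z g g1 by apply: offb.
have gb p : S p -> same_off a z g p -> good b p by move=> Sp op; apply: gp bb.
have bE : b = j + 1 by rewrite /j subrK.
have nb : nd b by apply: nds; lia.
have nz : nd z by apply: nds; rewrite /z; lia.
have nj : nd j by apply: nds; rewrite /j; lia.
have adjz : adj z b by rewrite /adj eqxx orbT.
have adjbj : adj b j by rewrite /adj bE eqxx orbT.
have nadj : ~~ adj z j by apply/negP; rewrite /adj /z /j; lia.
have zNj : z != j by apply/eqP; rewrite /z /j; lia.
have zNjS : z != j + 1 by rewrite -bE; apply/eqP; rewrite /z; lia.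
have Mb p d : M b (shift p j d) = M b p / qs q d ^+ 2.
  by rewrite [in LHS]bE [in RHS]bE msq_shiftS.
have Mz p d : M z (shift p j d) = M z p by apply: msq_shift_far.
have wbj p d : warg b (shift p j d) = warg b p / qs q d.
  by rewrite [in LHS]bE [in RHS]bE (target_arg_shiftP q0 q2).
have [u u0 [cz0 cz1]] := cs_steps q0 q2 false (ts_quad ts nz nb adjz S0 S1).
have := ts_lin ts nz nb adjz S0 S1 S2; rewrite cz0 cz1 => /(lin_third u0) cz2.
have g1b : good b g1 by apply: gb.
have g0b : good b g by apply: gb.
have g1j : good j g1 by apply: gp => //; rewrite jb.
have [h1 h2] := (good_edge true nb S1 g1b).1 S2.
have /(good_edge false nb S1 g1b) [h3 h4] : S (shift g1 b false) by rewrite shiftK.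
rewrite /= in h2 h4; pose v := u * lam b g * lam z g.
have v0 : v != 0 by rewrite !mulf_neq0.
have cb0 : cs v = cs (warg b g).
  rewrite -[RHS]/(target q l m b g) -g0b.
  exact/esym/(casimir_neighbour q0 q2 ts nb nz S0 S1 u0 cz0 cz1).
suff vE : v = warg b g.
  have uE : u = warg z g.
    by move: vE; rewrite /v target_arg_next => /(mulIf (lamN0 _ _))/(mulIf (lamN0 _ _)).
  by rewrite /good_at /target cz0 cz1 uE /z (target_arg_shiftP q0 q2).
have [hj|hj] := boolP (hfac true (M j g1) == 0).
  have {}hj : hfac false (M j g1) != 0 by apply: (edge_factor_dich (d := true)); apply/eqP.
  have Sd1 : S (shift g1 j false) by apply/(good_edge _ nj S1 g1j); rewrite -bE.
  pose d1 := shift g1 j false; have Sd0 : S (shift d1 b false).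
    apply/good_edge => //; first by apply: gb => //; apply: offj.
    by rewrite Mb Mz edge_factor_div.
  pose d0 := shift d1 b false; have {}Sd0 : S d0 := Sd0.
  have d0E : d0 = shift g j false by rewrite /d0 /d1 shiftC /g1 (shiftK g b true).
  have od0 : same_off a z g d0 by apply/offb/offj.
  have cd0 : c z d0 = cs u by rewrite d0E (ts_const ts) // -d0E.
  have cd1 : c z (shift d0 b true) = cs (u / q).
    by rewrite /d0 (shiftNK d1 b true) (ts_const ts).
  have := casimir_neighbour q0 q2 ts nb nz Sd0 _ u0 cd0 cd1.
  rewrite (gb d0) // /target d0E.
  rewrite wbj (lam_shift_adj q0 l g _ adjbj) (lam_shift_far q0 l g _ zNj nadj).
  rewrite -d0E /d0 (shiftNK d1 b true) => /(_ Sd1) e.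
  apply: (cs_inj2 q0 q2 (d := true) v0 (warg0 _ _) cb0).
  by rewrite /= !invrK in e *; rewrite e; congr cs; rewrite /v; ring.
have Sd1 : S (shift g1 j true) by apply/(good_edge _ nj S1 g1j); rewrite -bE.
pose d1 := shift g1 j true; have Sd2 : S (shift d1 b true).
  apply/good_edge => //; first by apply: gb => //; apply: offj.
  by rewrite Mb Mz edge_factor_div.
have d2E : shift d1 b true = shift g2 j true by rewrite /d1 shiftC.
have cd1 : c z d1 = cs (u / q) by rewrite (ts_const ts).
have cd2 : c z (shift d1 b true) = cs (u / q / q).
  by rewrite d2E (ts_const ts) // -d2E.
have := casimir_neighbour q0 q2 ts nb nz Sd1 Sd2 (mulf_neq0 u0 (invr_neq0 q0)) cd1 cd2.
rewrite (gb d1) // /target; last exact: offj.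
rewrite /d1 wbj (lam_shift_adj q0 l g1 _ adjbj).
rewrite (lam_shift_far q0 l g1 _ zNj nadj).
rewrite /g1 target_arg_shift_same // lam_shift // (lam_shift_adj q0 l g _ adjz) => e.
apply: (cs_inj2 q0 q2 (d := false) v0 (warg0 _ _) cb0); rewrite /= in e *; rewrite e.
by congr cs; rewrite /v; field; rewrite q0.
Qed.

(** The three points of a triple take three different values of [M], so one of
    them avoids the two values at which an edge factor vanishes. *)
Lemma avoid_two (x y z s t : F) : x != y -> y != z -> x != z ->
  [\/ x != s /\ x != t, y != s /\ y != t | z != s /\ z != t].
Proof.
move=> xy yz xz; rewrite (eq_sym x) in xy; rewrite (eq_sym x) in xz; rewrite (eq_sym y) in yz.
have [xs|xs] := eqVneq x s; last first.
  have [xt|xt] := eqVneq x t; last by constructor 1.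
  have [ys|ys] := eqVneq y s; last by constructor 2; rewrite -xt.
  by constructor 3; rewrite -ys -xt.
have [yt|yt] := eqVneq y t; last by constructor 2; rewrite -xs.
by constructor 3; rewrite -xs -yt.
Qed.

Definition triple_along (i : int) (p : point) :=
  [/\ S p, S (shift p i true) & S (shift (shift p i true) i true)].

(** Starting from a point where the relevant factors do not vanish, two steps
    along [b + 1] are possible; whether they go up, down or one each way depends
    on which of the two factors at [b + 2] vanishes. *)
Lemma triple_next a b g : a <= b -> nd b -> nd (b + 1) -> triple_along b g ->
  (forall p, S p -> same_off a (b + 1) g p -> good (b + 1) p) ->
  exists2 p, same_off a (b + 1 + 1) g p & triple_along (b + 1) p.
Proof.
move=> ab nb nz [S0 S1 S2] gz; pose z := b + 1.
have offb p d : same_off a z g p -> same_off a z g (shift p b d).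
  by move=> h; apply: same_off_trans h _; apply: same_off_shift; rewrite /z; lia.
pose pick p := [/\ S p, same_off a z g p & M (z + 1) p = M (z + 1) g].
have pick_b p d : pick p -> S (shift p b d) -> pick (shift p b d).
  case=> Sp h e Sp'; split=> //; first exact: offb.
  by rewrite msq_shift_far // /z; apply/eqP; lia.
have P0 : pick g by [].
have P1 := pick_b _ _ P0 S1; have P2 := pick_b _ _ P1 S2.
have choose s t : exists p, [/\ pick p, M z p != s & M z p != t].
  have Mz k : M z (shift k b true) = M z k / q ^+ 2 by rewrite msq_shiftS.
  have g0 : M z g != 0 by apply: msq_neq0.
  have qq n : q ^+ n != 0 by rewrite expf_neq0.
  have d1 : M z g != M z g / q ^+ 2.
    by apply: contra q2 => /eqP e; apply/eqP/(mulfI g0); rewrite mulr1 {1}e divfK.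
  have d2 : M z g / q ^+ 2 != M z g / q ^+ 2 / q ^+ 2.
    by apply: contra d1 => /eqP/(mulIf (invr_neq0 (qq 2%N)))/eqP.
  have d3 : M z g != M z g / q ^+ 2 / q ^+ 2.
    apply: contra q4 => /eqP e; apply/eqP/(mulfI g0).
    by rewrite mulr1 {1}e (exprD q 2 2) mulrA !divfK.
  have [[]|[]|[]] := avoid_two s t d1 d2 d3; [exists g|exists (shift g b true)|exists (shift (shift g b true) b true)] => //.
    by rewrite Mz.
  by rewrite !Mz.
have widen p : same_off a z g p -> same_off a (b + 1 + 1) g p.
  by apply: same_off_widen; rewrite /z; lia.
have offz p d : same_off a (b + 1 + 1) g p -> same_off a (b + 1 + 1) g (shift p z d).
  by move=> h; apply: same_off_trans h _; apply: same_off_shift; rewrite /z; lia.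
have gdz p d : good z p -> S p -> S (shift p z d) -> good z (shift p z d).
  move=> gzp Sp Sp'; apply: (good_const q0 q2 ts) => //.
  by apply/negP; rewrite /adj; lia.
have MN : M (z + 1) g != 0 by apply: msq_neq0.
have [y1|y1] := eqVneq (hfac false (M (z + 1) g)) 0.
  (* the lowering factor vanishes at [1], and one step lower at [q ^+ 2] *)
  have [p [[Sp h e] n1 n2]] := choose 1 (q ^+ 2).
  have gzp := gz p Sp h.
  have S' : S (shift p z false).
    apply/(good_edge _ nz Sp gzp); rewrite e; split; first by rewrite /edge_factor /= subr_eq0.
    exact: edge_factor_dich.
  have S'' : S (shift (shift p z false) z false).
    apply/(good_edge _ nz S' (gdz _ _ gzp Sp S')); split.
      rewrite msq_shift // /edge_factor /= subr_eq0 exprVn; apply: contra n2 => /eqP e1.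
      by rewrite -[M z p](divfK (expf_neq0 2 q0)) e1 mul1r.
    by rewrite msq_shiftS // e; apply: edge_factor_twice.
  exists (shift (shift p z false) z false); first by apply/offz/offz/widen.
  by split=> //; rewrite (shiftNK _ z true) ?(shiftNK _ z true).
have [y2|y2] := eqVneq (hfac true (M (z + 1) g)) 0.
  have [p [[Sp h e] n1 n2]] := choose (q ^+ 2)^-1 (q ^+ 2 * q ^+ 2)^-1.
  have gzp := gz p Sp h.
  have inv x y : x != 0 -> y * x - 1 = 0 -> y = x^-1 :> F.
    by move=> x0 /eqP; rewrite subr_eq0 => /eqP e1; apply: (mulIf x0); rewrite mulVf.
  have S' : S (shift p z true).
    apply/(good_edge _ nz Sp gzp); rewrite e; split=> //.
    by apply: contra n1 => /eqP h0; apply/eqP/inv; rewrite ?expf_neq0 // mulrC.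
  have S'' : S (shift (shift p z true) z true).
    apply/(good_edge _ nz S' (gdz _ _ gzp Sp S')); split.
      rewrite msq_shift // /edge_factor /=; apply: contra n2 => /eqP h0; apply/eqP/inv.
        by rewrite mulf_neq0 ?expf_neq0.
      by rewrite -h0; ring.
    by rewrite msq_shiftS // e; apply: edge_factor_twice.
  by exists p; [apply: widen|split].
have [p [[Sp h e] n1 n2]] := choose 1 (q ^+ 2)^-1.
have gzp := gz p Sp h.
have S' : S (shift p z true).
  apply/(good_edge _ nz Sp gzp); rewrite e; split=> //.
  rewrite /edge_factor /=; apply: contra n2; rewrite subr_eq0 => /eqP h0.
  by apply/eqP/(mulfI (expf_neq0 2 q0)); rewrite h0 divff // expf_neq0.
have S'' : S (shift p z false).
  by apply/(good_edge _ nz Sp gzp); rewrite e; split=> //; rewrite /edge_factor /= subr_eq0.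
exists (shift p z false); first by apply/offz/widen.
by split=> //; rewrite ?(shiftNK _ z true).
Qed.

Lemma extend_step a b g : a < b -> (forall i, a <= i <= b + 1 -> nd i) ->
  triple_along b g ->
  (forall p, S p -> same_off a (b + 1) g p -> forall i, a <= i <= b -> good i p) ->
  exists g', [/\ same_off a (b + 1 + 1) g g', triple_along (b + 1) g' &
    forall p, S p -> same_off a (b + 1 + 1) g p ->
      forall i, a <= i <= b + 1 -> good i p].
Proof.
move=> ab nds tg gp; have [S0 S1 S2] := tg.
have [gz0 gz1] := good_next ab nds S0 S1 S2 gp.
have lab : a <= b := ltW ab.
have lab1 : a <= b + 1 by lia.
have gz := good_levels lab nds S0 S1 gp gz0 gz1.
have nb : nd b by apply: nds; lia.
have nz : nd (b + 1) by apply: nds; lia.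
have [g' og tg'] := triple_next lab nb nz tg gz.
exists g'; split=> // p Sp op; apply: (good_piece_extend q0 q2 ts m0 mE lab1 nds S0 Sp op).
move=> p' Sp' op' i il; have [->|nil] := eqVneq i (b + 1); first exact: gz.
by apply: gp => //; lia.
Qed.

Lemma extend_right n a b g : a < b -> (forall i, a <= i <= b + n%:Z -> nd i) ->
  triple_along b g ->
  (forall p, S p -> same_off a (b + 1) g p -> forall i, a <= i <= b -> good i p) ->
  forall p, S p -> same_off a (b + n%:Z + 1) g p ->
    forall i, a <= i <= b + n%:Z -> good i p.
Proof.
elim: n b g => [|n IHn] b g ab nds tg gp p Sp op i il.
  by rewrite addr0 in op il; apply: gp.
have nds' j : a <= j <= b + 1 -> nd j by move=> jl; apply: nds; lia.
have [g' [og tg' gp']] := extend_step ab nds' tg gp.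
have bn : b + n.+1%:Z = b + 1 + n%:Z by lia.
rewrite bn in op il nds.
have lt' : a < b + 1 by lia.
have ow : same_off a (b + 1 + n%:Z + 1) g g' by apply: same_off_widen og; lia.
apply: (IHn (b + 1) g') => // [p' Sp' op' j jl|].
  by apply: gp' jl => //; apply: same_off_trans og op'.
exact: same_off_trans (same_off_sym ow) op.
Qed.

End Propagation.

(** * Reversal of the diagram and global parameters *)

(** Reversing the diagram and exchanging raising and lowering steps turns [K_i]
    into [K_(-i)^-1] and [Kbar_j] into [Kbar_(1-j)], so that the product
    [q Kbar_i Kbar_(i+1)] keeps its form. *)
Definition flip (k : point) : point := fun j => - k (- j).

Lemma flipK k : flip (flip k) = k.
Proof. by apply/funext=> j; rewrite /flip !opprK. Qed.

Lemma flip_shift k i d : flip (shift k i d) = shift (flip k) (- i) (~~ d).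
Proof.
apply/funext=> j; rewrite /flip /shift eqr_oppLR.
by case: eqP => _; case: d => /=; rewrite ?addr0 // opprD.
Qed.

Lemma adj_opp i j : adj (- i) (- j) = adj i j.
Proof. by rewrite /adj; apply/orP/orP=> -[] /eqP e; [right|left|right|left]; apply/eqP; lia. Qed.

Section Flip.
Variables (F : fieldType) (q : F).
Hypothesis q0 : q != 0.
Variables (nd : pred int) (S : point -> Prop) (l : int -> F).
Variables (c : int -> point -> F).

Definition flip_nd : pred int := fun i => nd (- i).
Definition flip_supp (k : point) := S (flip k).
Definition flip_l (i : int) := (l (- i))^-1.
Definition flip_c (i : int) (k : point) := c (- i) (flip k).

Lemma lam_flip i k : lam q flip_l i k = (lam q l (- i) (flip k))^-1.
Proof.
rewrite !lam.unlock invfM invr_expz /flip_l /flip; congr (_ * q ^ _).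
by rewrite opprK (_ : - (- i - 1) = i + 1) 1?(_ : - (- i + 1) = i - 1); lia.
Qed.

Lemma msq_flip m j k : msq q (fun j => m (1 - j)) j k = msq q m (1 - j) (flip k).
Proof.
rewrite !msq.unlock /flip; congr (_ * q ^ _).
by rewrite (_ : - (1 - j - 1) = j) 1?(_ : - (1 - j) = j - 1); lia.
Qed.

Lemma gap_flip d i k : cas_gap q flip_l flip_c d i k = cas_gap q l c (~~ d) (- i) (flip k).
Proof.
rewrite /cas_gap lam_flip; congr (_ - _); case: d => /=; rewrite -csV invfM invrK //.
  by rewrite mulrC.
by rewrite invrK mulrC.
Qed.

Lemma flip_thin : thin_system q nd S l c ->
  thin_system q flip_nd flip_supp flip_l flip_c.
Proof.
case=> tl te tc tq tL ts th tC; split; rewrite /flip_nd /flip_supp /flip_c.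
- by move=> i; rewrite invr_eq0.
- by move=> i k d ni Sk; rewrite flip_shift gap_flip; apply: te.
- by move=> i j k d ni nj ij Sk; rewrite flip_shift; apply: tc; rewrite ?adj_opp.
- by move=> i j k d ni nj ij Sk; rewrite flip_shift; apply: tq; rewrite ?adj_opp.
- by move=> i j k d ni nj ij Sk; rewrite !flip_shift; apply: tL; rewrite ?adj_opp.
- move=> i j k d ni nj ij Sk; rewrite !gap_flip !flip_shift negbK.
  have := ts _ _ (flip k) (~~ d) ni nj; rewrite eqr_opp negbK; exact.
- move=> i j k d ni nj ij Sk; rewrite !gap_flip !flip_shift.
  by apply: th; rewrite ?adj_opp.
move=> J k k' P Sk Sk' kk Pk st; rewrite -[k']flipK.
apply: (tC (fun j => J (- j)) (flip k) (flip k') (fun x => P (flip x))) => //.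
- by move=> j nJ; rewrite /flip kk.
- by rewrite flipK.
move=> p j d Jj nj Sp Pp Sp'; rewrite flip_shift.
by apply: st; rewrite ?flipK ?opprK // flip_shift ?flipK opprK negbK.
Qed.

Lemma flip_triple i p : triple_along S i p ->
  triple_along flip_supp (- i) (flip (shift (shift p i true) i true)).
Proof.
by case=> S0 S1 S2; rewrite /triple_along /flip_supp !flip_shift !flipK !opprK /=
  (shiftK _ i true) (shiftK _ i true).
Qed.

Lemma target_flip m : (forall j, m j != 0) -> (forall i, l i != 0) ->
  (forall i, m i = m (i + 1) * l i ^+ 2) -> forall i k,
  target q flip_l (fun j => m (1 - j)) i k = target q l m (- i) (flip k).
Proof.
move=> m0 l0 mE i k; rewrite /target /target_arg msq_flip lam_flip; congr cs.
have y0 := lam_neq0 q0 (flip k) (l0 (- i)).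
have -> : 1 - (i + 1) = - i by lia.
by rewrite (msq_lam q0 (flip k) (mE (- i))) expr2; field.
Qed.

End Flip.

(** The recursion for [m] can be solved in both directions from a prescribed
    value. *)
Lemma msq_param_exists (F : fieldType) (l : int -> F) j0 (x0 : F) : (forall i, l i != 0) -> x0 != 0 ->
  exists m : int -> F, [/\ forall j, m j != 0,
    forall i, m i = m (i + 1) * l i ^+ 2 & m j0 = x0].
Proof.
move=> l0 x00.
pose h i := match i with
  | Posz n => \prod_(k < n) (l k%:Z ^+ 2)^-1
  | Negz n => \prod_(k < n.+1) l (Negz k) ^+ 2 end.
have h0 i : h i != 0.
  by case: i => n; apply/prodf_neq0=> k _; rewrite ?invr_eq0 expf_neq0.
have hE i : h i = h (i + 1) * l i ^+ 2.
  case: i => [n|[|n]].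
  - have -> : Posz n + 1 = Posz n.+1 by lia.
    by rewrite /h big_ord_recr /= divfK ?expf_neq0.
  - have -> : Negz 0 + 1 = Posz 0 by lia.
    by rewrite /h big_ord_recr !big_ord0.
  have -> : Negz n.+1 + 1 = Negz n by lia.
  by rewrite /h big_ord_recr.
exists (fun j => x0 * h j / h j0); split=> [j|i|].
- by rewrite !mulf_neq0 ?invr_eq0.
- by rewrite hE; ring.
by rewrite mulfK.
Qed.

Section GoodEverywhere.
Variables (F : fieldType) (q : F).
Hypotheses (q0 : q != 0) (q2 : q ^+ 2 != 1) (q4 : q ^+ 4 != 1).

Definition good_param (nd : pred int) (S : point -> Prop) (l : int -> F)
    (c : int -> point -> F) (m : int -> F) :=
  [/\ forall j, m j != 0, forall i, m i = m (i + 1) * l i ^+ 2 &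
     forall i k, nd i -> S k -> good_at q l c m i k].

Lemma flip_good_param nd S l c m : (forall i, l i != 0) ->
  good_param (flip_nd nd) (flip_supp S) (flip_l l) (flip_c c) m ->
  good_param nd S l c (fun j => m (1 - j)).
Proof.
move=> l0 [m0 mE gm]; split=> [j|i|i k ni Sk]; first exact: m0.
  have := mE (- i); rewrite /flip_l opprK exprVn.
  rewrite (_ : 1 - (i + 1) = - i); last by lia.
  rewrite (_ : 1 - i = - i + 1); last by lia.
  by move=> ->; rewrite divfK // expf_neq0.
have := gm (- i) (flip k); rewrite /flip_nd /flip_supp opprK flipK => /(_ ni Sk).
rewrite /good_at /flip_c opprK flipK => ->.
rewrite -(target_flip q0 m0 _ mE) => [|j]; last by rewrite invr_eq0.
rewrite /target /target_arg; congr (cs (_ * _)).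
by rewrite !lam.unlock /flip_l opprK invrK.
Qed.

Section RightStart.
Variables (nd : pred int) (S : point -> Prop) (l : int -> F).
Variables (c : int -> point -> F).
Hypothesis ts : thin_system q nd S l c.

(** The scalar is chosen so that the value at [i + 1] is right at one end of
    the triple along [i]; [casimir_neighbour] then makes the value at [i] right as
    well. *)
Lemma good_start i g : nd i -> nd (i + 1) -> triple_along S i g ->
  exists m, [/\ forall j, m j != 0, forall j, m j = m (j + 1) * l j ^+ 2,
    forall p, S p -> same_off i (i + 1 + 1) g p ->
      forall j, i <= j <= i + 1 -> good_at q l c m j p &
    exists2 g', same_off i (i + 1 + 1) g g' & triple_along S (i + 1) g'].
Proof.
move=> ni nz tg; have [S0 S1 S2] := tg; pose z := i + 1.
have adjz : adj z i by rewrite /adj eqxx orbT.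
have l0 := ts_l ts.
have [u u0 [cz0 cz1]] := cs_steps q0 q2 false (ts_quad ts nz ni adjz S0 S1).
(* the power of [q] in [M (z + 1)] at [g], for which the choice of [m] has to
   make up *)
pose e := msq q (fun=> 1) (z + 1) g.
have e0 : e != 0 by apply: msq_neq0; rewrite ?oner_neq0.
have y0 := lam_neq0 q0 g (l0 z).
have x0 : u / (q * lam q l z g * e) != 0.
  by apply: mulf_neq0 u0 _; rewrite invr_eq0 mulf_neq0 // mulf_neq0.
have [m [m0 mE mz]] := msq_param_exists (z + 1) l0 x0.
have wz : target_arg q l m z g = u.
  have -> : target_arg q l m z g = q * (m (z + 1) * e) * lam q l z g.
    by rewrite /target_arg /e !msq.unlock mul1r.
  by rewrite mz; field; rewrite q0 e0 y0.
have gz0 : good_at q l c m z g by rewrite /good_at cz0 /target wz.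
have gz1 : good_at q l c m z (shift g i true).
  by rewrite /good_at cz1 /target (target_arg_shiftP q0 q2) wz.
have gi0 : good_at q l c m i g.
  rewrite /good_at (casimir_neighbour q0 q2 ts ni nz S0 S1 u0 cz0 cz1) /target -wz.
  by rewrite -(target_arg_next q0 mE).
have gi p : S p -> same_off i (i + 1) g p -> forall j, i <= j <= i -> good_at q l c m j p.
  move=> Sp op j /le_anti ij; rewrite -ij.
  apply: (ts_conn ts (J := fun j => i <= j < i + 1) (P := good_at q l c m i) S0 Sp) => //.
  move=> x k d ik nk Sx gx Sx'; have ki := int_itv1 ik.
  by rewrite {k ik nk}ki in Sx' *; apply: (good_const q0 q2 ts) => //; apply: adj_irr.
have nds j : i <= j <= z -> nd j.
  by move=> /int_itv2[] ->.
have gz := good_levels q0 q2 q4 ts m0 mE (lexx i) nds S0 S1 gi gz0 gz1.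
have iz : i <= z := le_succ i.
exists m; split=> //.
  move=> p Sp op; apply: (good_piece_extend q0 q2 ts m0 mE iz nds S0 Sp op).
  move=> p' Sp' op' j /int_itv2[] ->; first exact: gz.
  by apply: gi => //; rewrite lexx.
exact: (triple_next q0 q2 q4 ts m0 mE (lexx i) ni nz tg gz).
Qed.

Lemma good_right lo hi i g : (forall j, nd j = (lo <= j <= hi)) ->
  lo <= i < hi -> triple_along S i g ->
  exists m, [/\ forall j, m j != 0, forall j, m j = m (j + 1) * l j ^+ 2,
    forall p, S p -> same_off i (hi + 1) g p ->
      forall j, i <= j <= hi -> good_at q l c m j p &
    exists2 g', same_off i (i + 1 + 1) g g' & triple_along S (i + 1) g'].
Proof.
move=> ndE ihi tg.
have ni : nd i by rewrite ndE; lia.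
have nz : nd (i + 1) by rewrite ndE; lia.
have [m [m0 mE gm [g' og tg']]] := good_start ni nz tg.
exists m; split=> //; last by exists g'.
have hiE : hi = i + 1 + (absz (hi - i - 1)%R)%:Z by lia.
have ii : i < i + 1 by lia.
move=> p Sp op j jl; rewrite hiE in op jl *.
apply: (extend_right q0 q2 q4 ts m0 mE ii _ tg') jl => //.
- by move=> k kl; rewrite ndE; lia.
- by move=> p' Sp' op'; apply: gm => //; apply: same_off_trans og op'.
apply: same_off_trans op; apply: same_off_sym; apply: same_off_widen og; lia.
Qed.

End RightStart.

(** The values are propagated from the three weights to the right end first;
    the flip then turns the remaining propagation to the left into one to the
    right. *)
Theorem good_everywhere lo hi nd S l c i g :
  thin_system q nd S l c -> (forall j, nd j = (lo <= j <= hi)) ->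
  (forall k j, S k -> ~~ nd j -> k j = 0) -> lo < hi -> nd i ->
  triple_along S i g -> exists m, good_param nd S l c m.
Proof.
wlog : lo hi nd S l c i g / i < hi.
  move=> H ts ndE supp lohi ni tg; have [ih|ih] := boolP (i < hi); first exact: (H lo hi nd S l c i g).
  have [m gm] : exists m, good_param (flip_nd nd) (flip_supp S) (flip_l l) (flip_c c) m.
    apply: (H (- hi) (- lo) _ _ _ _ (- i) (flip (shift (shift g i true) i true))).
    - by move: ni; rewrite ndE; lia.
    - exact: flip_thin.
    - by move=> j; rewrite /flip_nd ndE; lia.
    - by move=> k j Sk nj; have := supp _ (- j) Sk nj; rewrite /flip opprK; lia.
    - lia.
    - by rewrite /flip_nd opprK.
    - exact: flip_triple.
  by exists (fun j => m (1 - j)); apply: flip_good_param => //; apply: ts_l ts.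
move=> ihi ts ndE supp lohi ni tg; have [S0 _ _] := tg.
have lihi : lo <= i < hi by move: ni; rewrite ndE; lia.
have [m [m0 mE gm [g' og tg']]] := good_right ts ndE lihi tg.
exists m; split=> // j k nj Sk.
have l0 := ts_l ts.
have ts' := flip_thin q0 ts.
pose m' j := m (1 - j).
have m0' j' : m' j' != 0 by apply: m0.
have mE' j' : m' j' = m' (j' + 1) * flip_l l j' ^+ 2.
  rewrite /m' /flip_l exprVn (_ : 1 - j' = - j' + 1); last by lia.
  rewrite (_ : 1 - (j' + 1) = - j'); last by lia.
  by rewrite [m (- j')]mE mulfK ?expf_neq0.
pose t := flip (shift (shift g i true) i true).
have tt : triple_along (flip_supp S) (- i) t by apply: flip_triple.
have hi_i : - hi < - i by lia.
have iE : - lo = - i + (absz (i - lo)%R)%:Z by move: lihi; lia.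
suff : good_at q (flip_l l) (flip_c c) m' (- j) (flip k).
  rewrite /good_at /flip_c (target_flip q0 m0 l0 mE) flipK opprK //.
apply: (extend_right q0 q2 q4 ts' m0' mE' hi_i (n := absz (i - lo)%R) _ tt).
- by move=> j' jl; rewrite /flip_nd ndE; move: lihi jl; lia.
- move=> p Sp op j' jl; rewrite /good_at /flip_c (target_flip q0 m0 l0 mE).
  apply: (gm _ Sp) => [x nx|]; last by lia.
  rewrite /flip -op /t /flip ?opprK; last by apply: contra nx; lia.
  rewrite !shift_off //; apply: contra nx => /eqP ->; lia.
- by rewrite /flip_supp flipK.
- move=> x nx; rewrite /t /flip; congr (- _).
  rewrite !shift_off; try by apply: contra nx => /eqP e; lia.
  by rewrite !(supp _ (- x)) // ndE; apply: contra nx; lia.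
by move: nj; rewrite ndE; lia.
Qed.

End GoodEverywhere.

(** * Paths between weights *)

Section WeightGraph.
Variables (nd : pred int) (edge : bool -> int -> point -> Prop).
Hypothesis edge_square : forall i j d k, nd i -> nd j -> i != j ->
  edge d i k -> edge (~~ d) j (shift k i d) ->
  edge (~~ d) j k /\ edge d i (shift k j (~~ d)).

Inductive reach (J : pred int) (k : point) : point -> Prop :=
| reach_refl : reach J k k
| reach_step p i d of reach J k p & J i & nd i & edge d i p :
    reach J k (shift p i d).

Inductive mono_reach (d : bool) (J : pred int) (k : point) : point -> Prop :=
| mono_refl : mono_reach d J k k
| mono_step p i of mono_reach d J k p & J i & nd i & edge d i p :
    mono_reach d J k (shift p i d).

Lemma reach_sub (J J' : pred int) k k' : (forall j, J j -> J' j) ->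
  reach J k k' -> reach J' k k'.
Proof.
move=> sub; elim=> [|p i d _ IH Ji ni e]; first exact: reach_refl.
by apply: reach_step => //; apply: sub.
Qed.

Lemma reach_coord (J : pred int) k k' z : ~~ J z -> reach J k k' -> k' z = k z.
Proof.
move=> nJ; elim=> [//|p i d _ <- Ji ni e]; apply: shift_off.
by apply: contra nJ => /eqP ->.
Qed.

Lemma mono_coord d (J : pred int) k k' z : mono_reach d J k k' ->
  sgn d * k z <= sgn d * k' z.
Proof.
elim=> [//|p i _ le_kp Ji ni e]; apply: le_trans le_kp _.
by rewrite /shift; case: eqP => _; case: (d) => /=; lia.
Qed.

(** The graph analogue of the triangular decomposition: a descending step
    followed by an ascending one along another node can be exchanged. *)
Lemma reach_triangular (J : pred int) k k' : reach J k k' ->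
  exists2 p, mono_reach true J k p & mono_reach false J p k'.
Proof.
elim=> [|p i d _ [p0 up dn] Ji ni e]; first by exists k; apply: mono_refl.
case: d e => e; last by exists p0 => //; apply: mono_step.
elim: dn e => [|p' j dn IH Jj nj e'] e.
  by exists (shift p0 i true); [apply: mono_step|apply: mono_refl].
have [ij|ij] := eqVneq i j.
  by rewrite ij (shiftNK _ j true); exists p0.
rewrite eq_sym in ij; have [e1 e2] := edge_square nj ni ij e' e.
have [p1 up1 dn1] := IH e1; exists p1 => //.
by rewrite shiftC; apply: mono_step.
Qed.

(** Weights that agree at [z] need no step along [z]: in an ascending and then
    descending path the steps along [z] can be cancelled. *)
Lemma reach_remove (J : pred int) z k k' : ~~ J z ->
  reach (fun j => J j || (j == z)) k k' -> k' z = k z -> reach J k k'.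
Proof.
move=> nJz /reach_triangular[p1 up1 dn1] kz; set J' := fun j => _ in up1 dn1.
pose D p := exists2 p0, reach J k p0 & mono_reach true J' p0 p.
have down p j : D p -> J' j -> nd j -> (j = z -> k z < p z) -> edge false j p ->
    D (shift p j false).
  case=> p0 r0; elim=> [|p' i up IH Ji ni e'] Jj nj jz e.
    exists (shift p0 j false); last exact: mono_refl.
    apply: reach_step => //; have /orP[//|/eqP jz'] := Jj.
    by have := jz jz'; rewrite (reach_coord nJz r0) ltxx.
  have [ij|ij] := eqVneq i j.
    by rewrite ij (shiftK _ j true); exists p0.
  have [e1 e2] := edge_square ni nj ij e' e.
  have [|p2 r2 up2] := IH Jj nj _ e1.
    by move=> jz'; have := jz jz'; rewrite shift_off // -jz' eq_sym.
  by exists p2 => //; rewrite shiftC; apply: mono_step.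
have D1 : D p1 by exists k => //; apply: reach_refl.
have Dk' : D k'.
  have : k z <= k' z by rewrite kz.
  elim: dn1 {kz} => [//|p j dn IH Jj nj e] kz.
  have {}IH : D p.
    by apply: IH; move: kz; rewrite /shift; case: eqP => _ /=; lia.
  by apply: down => // jz; move: kz; rewrite jz shift_at /=; lia.
case: Dk' => p0 r0 up.
have : k' z <= k z by rewrite kz.
elim: up => [//|p i up IH Ji ni e] le_pk.
have kp : k z <= p z.
  by have := mono_coord z up; rewrite /= !mul1r (reach_coord nJz r0).
have iz : i != z by apply: contraTneq le_pk => ->; rewrite shift_at /=; lia.
apply: reach_step => //; last by move: Ji; rewrite /J' (negPf iz) orbF.
by apply: IH; move: le_pk; rewrite shift_off // eq_sym.
Qed.

(** Two weights that agree outside [J] are joined by steps along [J] only: the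
    other nodes are removed one at a time by [reach_remove]. *)
Lemma reach_levi (s : seq int) (J : pred int) k k' :
  (forall i, nd i -> i \in s) -> reach predT k k' ->
  (forall j, ~~ J j -> k j = k' j) -> reach J k k'.
Proof.
move=> nds r kk'.
have {nds r} : reach (fun j => J j || (j \in s)) k k'.
  elim: r {kk'} => [|p i d r IH _ ni e]; first exact: reach_refl.
  by apply: reach_step => //; rewrite nds ?orbT.
elim: s => [|z s IH] r; first by apply: reach_sub r => j; rewrite orbF.
apply: IH; have [zs|zs] := boolP (J z || (z \in s)).
  apply: reach_sub r => j; rewrite inE orbCA => /orP[/eqP ->|] //.
apply: (reach_remove zs); first by apply: reach_sub r => j; rewrite inE orbCA orbC.
by rewrite kk' //; apply: contra zs => ->.
Qed.

(** A path along a single node that passes a level must use the edge there. *)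
Lemma reach_cross i k d : reach (pred1 i) k (shift k i d) -> edge d i k.
Proof.
move=> r; apply: contrapT => ne.
suff : forall p, reach (pred1 i) k p -> sgn d * p i <= sgn d * k i.
  by move=> /(_ _ r); rewrite shift_at; case: (d) => /=; lia.
move=> p rp; suff [] : sgn d * p i <= sgn d * k i /\ (forall j, j != i -> p j = k j) by [].
elim: rp => [//|{}p j e _ [lep off] /eqP -> ni ed]; split; last first.
  by move=> x xi; rewrite shift_off // off.
have [pk|pk] := eqVneq (p i) (k i); last by rewrite shift_at; case: (d) (e) lep pk => -[] /=; lia.
have pE : p = k by apply/funext=> x; have [->//|/off] := eqVneq x i.
have [ee|ee] := eqVneq e d; first by case: ne; rewrite -pE -ee.
by rewrite shift_at pk; case: (d) (e) ee => -[] //= _; lia.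
Qed.

End WeightGraph.

(** * Casimir values of a graded module *)

Section GradedModule.
Variables (F : fieldType) (q : F) (V : lmodType F).
Hypotheses (q0 : q != 0) (q2 : q ^+ 2 != 1).
Variables (nd : pred int) (l : int -> F).
(** [X true i] and [X false i] are the actions of [E_i] and [F_i]; [W k] is the
    weight space at the lattice point [k]. *)
Variables (X : bool -> int -> V -> V) (W : point -> V -> Prop).

Record thin_graded : Prop := ThinGraded {
  tg_l : forall i, l i != 0;
  tg_nodes : exists s : seq int, forall i, nd i -> i \in s;
  tg_lin : forall d i, nd i -> linear (X d i);
  tg_X : forall d i k v, nd i -> W k v -> W (shift k i d) (X d i v);
  tg_thin : forall k v w, W k v -> v != 0 -> W k w -> exists a, w = a *: v;
  tg_EF : forall i k v, nd i -> W k v ->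
    X true i (X false i v) - X false i (X true i v) =
    ((lam q l i k - (lam q l i k)^-1) / (q - q^-1)) *: v;
  tg_comm : forall d i j v, nd i -> nd j -> i != j ->
    X d i (X (~~ d) j v) = X (~~ d) j (X d i v);
  tg_far : forall d i j v, nd i -> nd j -> ~~ adj i j ->
    X d i (X d j v) = X d j (X d i v);
  tg_serre : forall d i j v, nd i -> nd j -> adj i j ->
    X d i (X d i (X d j v)) - (q + q^-1) *: X d i (X d j (X d i v))
    + X d j (X d i (X d i v)) = 0;
  tg_irr : forall k k' v v', W k v -> v != 0 -> W k' v' -> v' != 0 ->
    reach nd (fun d i p => exists2 u, W p u & X d i u != 0) predT k k'
}.
Hypothesis tg : thin_graded.

Definition supp (k : point) : Prop := exists2 v, W k v & v != 0.
Definition edge (d : bool) (i : int) (k : point) : Prop :=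
  exists2 v, W k v & X d i v != 0.
Let kap := (q - q^-1) ^+ 2.

Let e0 : q - q^-1 != 0. Proof. exact: q_subV_neq0. Qed.
Let kap0 : kap != 0. Proof. by rewrite expf_neq0. Qed.
Let lamN0 i k : lam q l i k != 0. Proof. exact: lam_neq0 (tg_l tg i). Qed.

Section Lin.
Variables (d : bool) (i : int).
Hypothesis ni : nd i.
Let lin := tg_lin tg d ni.
Lemma tgX0 : X d i 0 = 0.
Proof. by have := lin (-1) 0 0; rewrite scaler0 addr0 scaleN1r addNr. Qed.
Lemma tgXZ a v : X d i (a *: v) = a *: X d i v.
Proof. by rewrite -[a *: v]addr0 lin tgX0 addr0. Qed.
Lemma tgXD u v : X d i (u + v) = X d i u + X d i v.
Proof. by rewrite -{1}[u]scale1r lin scale1r. Qed.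
Lemma tgXB u v : X d i (u - v) = X d i u - X d i v.
Proof. by rewrite -!scaleN1r tgXD tgXZ. Qed.
End Lin.

(** The weight spaces are lines, so one vector decides for all of them. *)
Lemma edge_at d i k v : nd i -> edge d i k -> W k v -> v != 0 -> X d i v != 0.
Proof.
move=> ni [u Wu Xu] Wv v0; have [a uE] := tg_thin tg Wv v0 Wu.
by apply: contraNneq Xu => Xv; rewrite uE tgXZ // Xv scaler0.
Qed.

Lemma edge_supp d i k : nd i -> edge d i k -> supp k.
Proof.
move=> ni [v Wv Xv]; exists v => //; apply: contraNneq Xv => ->.
by rewrite tgX0.
Qed.

Lemma edge_supp_shift d i k : nd i -> edge d i k -> supp (shift k i d).
Proof. by move=> ni [v Wv Xv]; exists (X d i v) => //; apply: (tg_X tg). Qed.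

Lemma tg_edge_square i j d k : nd i -> nd j -> i != j ->
  edge d i k -> edge (~~ d) j (shift k i d) ->
  edge (~~ d) j k /\ edge d i (shift k j (~~ d)).
Proof.
move=> ni nj ij [v Wv Xv] e2.
have := edge_at nj e2 (tg_X tg d ni Wv) Xv; rewrite -(tg_comm tg) // => XX.
have Yv : X (~~ d) j v != 0 by apply: contraNneq XX => ->; rewrite tgX0.
by split; [exists v|exists (X (~~ d) j v) => //; apply: (tg_X tg)].
Qed.

Lemma supp_reach (J : pred int) k k' : supp k -> supp k' ->
  (forall j, ~~ J j -> k j = k' j) -> reach nd edge J k k'.
Proof.
move=> [v Wv v0] [v' Wv' v0'] kk'; have [s nds] := tg_nodes tg.
apply: (reach_levi _ nds) => //; last exact: (tg_irr tg Wv v0 Wv' v0').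
exact: tg_edge_square.
Qed.

(** Two neighbouring weights are joined by a path along their node, and such a
    path has to cross the edge between them. *)
Lemma supp_edge d i k : nd i -> supp k -> supp (shift k i d) -> edge d i k.
Proof.
move=> ni Sk Sk'; apply: (@reach_cross nd); apply: supp_reach => // j ji.
by rewrite shift_off.
Qed.

Lemma casimir_exists i k : nd i ->
  exists a, forall v, W k v -> X false i (X true i v) = a *: v.
Proof.
move=> ni; have [[v Wv v0]|no] := pselect (supp k); last first.
  exists 0 => v Wv; have [->|v0] := eqVneq v 0; last by case: no; exists v.
  by rewrite !tgX0 // scaler0.
have WX u : W k u -> W k (X false i (X true i u)).
  by move=> Wu; have := tg_X tg false ni (tg_X tg true ni Wu); rewrite (shiftK k i true).
have [a aE] := tg_thin tg Wv v0 (WX _ Wv).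
exists a => w Ww; have [b ->] := tg_thin tg Wv v0 Ww.
by rewrite !tgXZ // aE !scalerA mulrC.
Qed.

(** The scalar of [kappa F_i E_i + q K_i + (q K_i)^-1]; by [casimir_exists] the
    default value [0] is never taken at a node. *)
Definition cas (i : int) (k : point) : F :=
  if pselect (exists a, forall v, W k v -> X false i (X true i v) = a *: v)
  is left H then kap * projT1 (cid H) + cs (q * lam q l i k) else 0.

Notation gap := (cas_gap q l cas).

(** The Casimir value turns both products of [E_i] and [F_i] into gaps. *)
Lemma XX d i k v : nd i -> W k v -> X (~~ d) i (X d i v) = (gap d i k / kap) *: v.
Proof.
move=> ni Wv; have FE : X false i (X true i v) = (gap true i k / kap) *: v.
  rewrite /cas_gap /cas; case: pselect => [H|]; last by case; apply: casimir_exists.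
  by case: cid => a /= -> //; rewrite addrK mulrC mulKf.
case: d => //=; have := tg_EF tg ni Wv; rewrite FE => /eqP.
rewrite subr_eq -scalerDl => /eqP ->; congr (_ *: v).
have y0 := lamN0 i k; rewrite /cas_gap /kap /cs; field.
by rewrite y0 q0 -expr2 subr_eq0 q2.
Qed.

Lemma tg_edge i k d : nd i -> supp k -> supp (shift k i d) <-> gap d i k != 0.
Proof.
move=> ni Sk; split=> [Sk'|g0].
  have [v Wv v0] := Sk; have Xv := edge_at ni (supp_edge ni Sk Sk') Wv v0.
  have := supp_edge (d := ~~ d) ni Sk'; rewrite shiftK => /(_ Sk) e.
  have := edge_at ni e (tg_X tg d ni Wv) Xv.
  by rewrite (XX _ ni Wv); apply: contraNneq => ->; rewrite mul0r scale0r.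
have [v Wv v0] := Sk; apply: (edge_supp_shift ni (d := d)); exists v => //.
apply: contraNneq g0 => Xv; have := XX d ni Wv; rewrite Xv tgX0 // => /esym/eqP.
by rewrite scaler_eq0 (negPf v0) orbF mulf_eq0 invr_eq0 (negPf kap0) orbF.
Qed.

Lemma gap_cancel (v : V) (x y : F) : v != 0 -> (x / kap) *: v = (y / kap) *: v -> x = y.
Proof.
move=> v0 /eqP; rewrite -subr_eq0 -scalerBl scaler_eq0 (negPf v0) orbF subr_eq0.
by move=> /eqP/(mulIf (invr_neq0 kap0)).
Qed.

Lemma gap_back d i k : nd i -> supp k -> supp (shift k i d) ->
  gap (~~ d) i (shift k i d) = gap d i k.
Proof.
move=> ni Sk Sk'; have [v Wv v0] := Sk.
have Xv := edge_at ni (supp_edge ni Sk Sk') Wv v0.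
apply: (gap_cancel Xv); rewrite -(XX _ ni (tg_X tg d ni Wv)) negbK (XX d ni Wv).
by rewrite tgXZ.
Qed.

Lemma tg_const i j k d : nd i -> nd j -> ~~ adj i j ->
  supp k -> supp (shift k j d) -> cas i (shift k j d) = cas i k.
Proof.
move=> ni nj nij Sk Sk'; have [ij|ij] := eqVneq i j.
  rewrite -ij in Sk' *; have := gap_back ni Sk Sk'.
  rewrite /cas_gap lam_shift // => /eqP; rewrite subr_eq => /eqP ->.
  have y0 := lamN0 i k; case: (d) => /=.
    rewrite (_ : _ / q = q * lam q l i k); last by field.
    by rewrite subrK.
  rewrite (_ : q * _ = lam q l i k / q); last by field.
  by rewrite subrK.
have [v Wv v0] := Sk.
have Xv := edge_at nj (supp_edge nj Sk Sk') Wv v0.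
have com e u : X e i (X d j u) = X d j (X e i u).
  have [->|ed] := eqVneq e d; first exact: (tg_far tg).
  have -> : e = ~~ d by case: (e) (d) ed => -[].
  by rewrite -(tg_comm tg) // eq_sym.
have : gap true i (shift k j d) = gap true i k.
  apply: (gap_cancel Xv).
  by rewrite -(XX true ni (tg_X tg d nj Wv)) !com (XX true ni Wv) tgXZ.
by rewrite /cas_gap lam_shift_far // => /addIr.
Qed.

(** The Serre relation with [X_j] twice, followed by the opposite of [X_i]. *)
Lemma tg_linear i j k d : nd i -> nd j -> adj i j ->
  supp k -> supp (shift k j d) -> supp (shift (shift k j d) j d) ->
  cas i k - (q + q^-1) * cas i (shift k j d) + cas i (shift (shift k j d) j d) = 0.
Proof.
move=> ni nj ij Sk S1 S2; have [v Wv v0] := Sk.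
have iNj : i != j by apply: contraTneq ij => ->; apply: adj_irr.
have X1 := edge_at nj (supp_edge nj Sk S1) Wv v0.
have W1 := tg_X tg d nj Wv; have W2 := tg_X tg d nj W1.
have X2 := edge_at nj (supp_edge nj S1 S2) W1 X1.
have com u : X (~~ d) i (X d j u) = X d j (X (~~ d) i u).
  by rewrite -(tg_comm tg) // eq_sym.
rewrite adjC in ij; have := congr1 (X (~~ d) i) (tg_serre tg d v nj ni ij).
rewrite adjC in ij; rewrite tgX0 // tgXD // tgXB // tgXZ //.
rewrite !com (XX d ni W2) (XX d ni W1) (XX d ni Wv) !tgXZ // !scalerA.
rewrite -scalerBl -scalerDl => /eqP; rewrite scaler_eq0 (negPf X2) orbF => /eqP e.
have y0 := lamN0 i k.
have := congr1 ( *%R^~ kap) e; rewrite mul0r => <-.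
rewrite /cas_gap !lam_shift_adj // /cs.
by case: (d) => /=; field; rewrite ?q0 ?y0 ?kap0 ?oner_neq0.
Qed.

(** Two evaluations of the walk around the square, which returns to [v]. *)
Lemma tg_square i j k d : nd i -> nd j -> i != j -> supp k ->
  gap d i k * gap (~~ d) j (shift k i d) =
  gap (~~ d) j k * gap d i (shift k j (~~ d)).
Proof.
move=> ni nj ij [v Wv v0].
pose Z := X (~~ d) i (X d j (X (~~ d) j (X d i v))).
have Z1 : Z = (gap d i k * gap (~~ d) j (shift k i d) / kap / kap) *: v.
  have := XX (~~ d) nj (tg_X tg d ni Wv); rewrite negbK /Z => ->.
  by rewrite tgXZ // (XX d ni Wv) scalerA; congr (_ *: v); ring.
have Z2 : Z = (gap (~~ d) j k * gap d i (shift k j (~~ d)) / kap / kap) *: v.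
  have ji : j != i by rewrite eq_sym.
  rewrite /Z -(tg_comm tg d _ ni nj ij) -(tg_comm tg d _ nj ni ji).
  rewrite (XX d ni (tg_X tg (~~ d) nj Wv)) tgXZ //.
  have := XX (~~ d) nj Wv; rewrite negbK => ->.
  by rewrite scalerA; congr (_ *: v); ring.
by apply/(mulIf (invr_neq0 kap0))/(gap_cancel v0); rewrite -Z1 -Z2.
Qed.

(** The vectors [X_i X_j v] and [X_j X_i v] lie on one line; lowering them in both
    orders determines the factor of proportionality in two ways. *)
Lemma tg_hex i j k d : nd i -> nd j -> adj i j ->
  supp k -> supp (shift k i d) -> supp (shift k j d) ->
  gap d i (shift k j d) * gap d j (shift k i d) = gap d i k * gap d j k.
Proof.
move=> ni nj ij Sk Si Sj; have [v Wv v0] := Sk.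
have iNj : i != j by apply: contraTneq ij => ->; apply: adj_irr.
have jNi : j != i by rewrite eq_sym.
have Wi := tg_X tg d ni Wv; have Wj := tg_X tg d nj Wv.
have gi : gap d i k != 0 by apply/tg_edge.
have gj : gap d j k != 0 by apply/tg_edge.
pose A := X d i (X d j v); pose B := X d j (X d i v).
have WA : W (shift (shift k j d) i d) A by apply: (tg_X tg).
have WB : W (shift (shift k j d) i d) B by rewrite shiftC; apply: (tg_X tg).
have comi u : X (~~ d) i (X d j u) = X d j (X (~~ d) i u) by rewrite -(tg_comm tg).
have comj u : X (~~ d) j (X d i u) = X d i (X (~~ d) j u) by rewrite -(tg_comm tg).
have jiA : X (~~ d) j (X (~~ d) i A) = (gap d i (shift k j d) * gap d j k / kap / kap) *: v.
  by rewrite /A (XX d ni Wj) tgXZ // (XX d nj Wv) scalerA; congr (_ *: v); ring.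
have ijB : X (~~ d) i (X (~~ d) j B) = (gap d j (shift k i d) * gap d i k / kap / kap) *: v.
  by rewrite /B (XX d nj Wi) tgXZ // (XX d ni Wv) scalerA; congr (_ *: v); ring.
have jiB : X (~~ d) j (X (~~ d) i B) = (gap d i k * gap d j k / kap / kap) *: v.
  by rewrite /B comi (XX d ni Wv) !tgXZ // (XX d nj Wv) scalerA; congr (_ *: v); ring.
have ijA : X (~~ d) i (X (~~ d) j A) = (gap d i k * gap d j k / kap / kap) *: v.
  by rewrite /A comj (XX d nj Wv) !tgXZ // (XX d ni Wv) scalerA; congr (_ *: v); ring.
have A0 : A != 0.
  apply: contra_neq (mulf_neq0 gi gj) => A0; move: ijA; rewrite A0 !tgX0 // => /esym/eqP.
  rewrite scaler_eq0 (negPf v0) orbF => /eqP e; apply/(mulIf (invr_neq0 kap0))/(mulIf (invr_neq0 kap0)).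
  by rewrite e !mul0r.
have [x BE] := tg_thin tg WA A0 WB.
have e1 : gap d i k = x * gap d i (shift k j d).
  apply: (mulIf gj); apply/(mulIf (invr_neq0 kap0))/(gap_cancel v0).
  by rewrite -jiB BE !tgXZ // jiA scalerA; congr (_ *: v); ring.
have e2 : gap d j (shift k i d) = x * gap d j k.
  apply: (mulIf gi); apply/(mulIf (invr_neq0 kap0))/(gap_cancel v0).
  by rewrite -ijB BE !tgXZ // ijA scalerA; congr (_ *: v); ring.
by rewrite e2 e1; ring.
Qed.

(** The Serre relation with [X_i] twice, followed by the opposite of [X_i] twice.
    At the boundary of the set of weights [tg_const] is not available, but there
    the gaps in front of the affected terms vanish. *)
Lemma tg_quad i j k d : nd i -> nd j -> adj i j ->
  supp k -> supp (shift k j d) ->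
  cas i k ^+ 2 + cas i (shift k j d) ^+ 2
  - (q + q^-1) * cas i k * cas i (shift k j d) + (q - q^-1) ^+ 2 = 0.
Proof.
move=> ni nj ij Sk Sj; have [v Wv v0] := Sk.
have iNj : i != j by apply: contraTneq ij => ->; apply: adj_irr.
have jNi : j != i by rewrite eq_sym.
have Wj := tg_X tg d nj Wv; have Xj := edge_at nj (supp_edge nj Sk Sj) Wv v0.
set u := X d j v in Wj Xj; pose k1 := shift k j d; pose k2 := shift k1 i d.
have com w : X (~~ d) i (X d j w) = X d j (X (~~ d) i w) by rewrite -(tg_comm tg).
have Wi := tg_X tg d ni Wv.
have W2 : W k2 (X d j (X d i v)) by rewrite /k2 /k1 shiftC; apply: (tg_X tg).
have := congr1 (X (~~ d) i \o X (~~ d) i) (tg_serre tg d v ni nj ij); rewrite /= -/u.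
rewrite -scaleNr !tgX0 // !(tgXD _ ni) !tgXZ //.
rewrite !com !(XX d ni (tg_X tg d ni Wj)) !(XX d ni W2) !(XX d ni Wi).
rewrite !tgXZ // !com !(XX d ni Wj) !(XX d ni Wv) !tgXZ // -/u !scalerA.
rewrite -!scalerDl => /eqP; rewrite scaler_eq0 (negPf Xj) orbF => /eqP e.
have S2 x : (~ supp k2 -> x = 0) -> gap d i k2 * x =
    (cas i k1 - cs (if d then q * lam q l i k2 else lam q l i k2 / q)) * x.
  have [Sk2 _|nS /(_ nS) ->] := pselect (supp k2); last by rewrite !mulr0.
  by rewrite /cas_gap (tg_const ni ni (adj_irr i) Sj Sk2).
have S3 : gap d i (shift k i d) * gap d i k =
    (cas i k - cs (if d then q * lam q l i (shift k i d) else lam q l i (shift k i d) / q)) * gap d i k.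
  have [->|/(tg_edge d ni Sk) Si] := eqVneq (gap d i k) 0; first by rewrite !mulr0.
  by rewrite /cas_gap (tg_const ni ni (adj_irr i) Sk Si).
have z1 : ~ supp k2 -> gap d i k1 = 0.
  by move=> nS; apply/eqP/negPn/negP => /(tg_edge d ni Sj).
have z0 : ~ supp k2 -> gap d i k = 0.
  move=> nS; apply: (gap_cancel Xj); rewrite mul0r scale0r /u -tgXZ // -(XX d ni Wv) -com.
  have -> : X d j (X d i v) = 0 by apply/eqP/negPn/negP => n0; apply: nS; exists (X d j (X d i v)).
  by rewrite tgX0.
have {}e : gap d i k2 * gap d i k1 - (q + q^-1) * (gap d i k2 * gap d i k)
    + gap d i (shift k i d) * gap d i k = 0.
  have := congr1 ( *%R^~ (kap * kap)) e; rewrite mul0r => <-.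
  by rewrite -/k1 -/k2; field; rewrite kap0 q0.
move: e; rewrite (S2 _ z1) (S2 _ z0) S3 => <-.
have y0 := lamN0 i k; rewrite /cas_gap /k2 /k1 !lam_shift // !lam_shift_adj // /cs.
by case: (d) => /=; field; rewrite ?q0 ?y0 ?oner_neq0.
Qed.

Theorem thin_graded_system : thin_system q nd supp l cas.
Proof.
split.
- exact: tg_l tg.
- by move=> i k d ni Sk; apply: tg_edge.
- by move=> i j k d ni nj; apply: tg_const.
- by move=> i j k d ni nj; apply: tg_quad.
- by move=> i j k d ni nj; apply: tg_linear.
- by move=> i j k d ni nj; apply: tg_square.
- by move=> i j k d ni nj; apply: tg_hex.
move=> J k k' P Sk Sk' kk' Pk st.
elim: (supp_reach Sk Sk' kk') => [//|p i d r Pp Ji ni e].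
by apply: st => //; [apply: edge_supp e|apply: edge_supp_shift].
Qed.

End GradedModule.

(** * Relations in the quantum groups *)

Section GlRelations.
Variables (F : fieldType) (q : F) (n : nat).
Hypothesis q0 : q != 0.
Notation Ugl := (Uqgl q n).

Lemma gl_classD t u : gl_class q (t + u)%ncT = gl_class q t + gl_class q u :> Ugl.
Proof. by rewrite -gl_addE. Qed.
Lemma gl_classN t : gl_class q (- t)%ncT = - gl_class q t :> Ugl.
Proof. by rewrite -gl_oppE. Qed.
Lemma gl_classM t u : gl_class q (t * u)%ncT = gl_class q t * gl_class q u :> Ugl.
Proof. by rewrite -gl_mulE. Qed.
Lemma gl_classZ c t : gl_class q (c *: t)%ncT = c *: gl_class q t :> Ugl.
Proof. by rewrite -gl_scaleE. Qed.
Lemma gl_class0 : gl_class q 0%ncT = 0 :> Ugl. Proof. by []. Qed.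
Lemma gl_class1 : gl_class q 1%ncT = 1 :> Ugl. Proof. by []. Qed.

Definition gl_classE := (gl_classD, gl_classN, gl_classM, gl_classZ, gl_class0, gl_class1).

Lemma gl_class_rel t u : gl_rel q t u -> gl_class q t = gl_class q u :> Ugl.
Proof. by move=> r; apply/gl_classP/ac_rel. Qed.

Lemma gl_relKV j : glKbar q j * glKbarV q j = 1 :> Ugl.
Proof. by have := gl_class_rel (rel_KKinv q j); rewrite !gl_classE. Qed.
Lemma gl_relVK j : glKbarV q j * glKbar q j = 1 :> Ugl.
Proof. by have := gl_class_rel (rel_KinvK q j); rewrite !gl_classE. Qed.
Lemma gl_relKK i j : glKbar q i * glKbar q j = glKbar q j * glKbar q i :> Ugl.
Proof. by have := gl_class_rel (rel_KK q i j); rewrite !gl_classE. Qed.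

Lemma gl_relKE j i : glKbar q j * glE q i = q ^ eps_pairing j i *: (glE q i * glKbar q j) :> Ugl.
Proof.
have e : glKbar q j * glE q i * glKbarV q j = q ^ eps_pairing j i *: glE q i.
  by have := gl_class_rel (rel_KE q j i); rewrite !gl_classE.
by rewrite scalerAl -e -[RHS]mulrA gl_relVK mulr1.
Qed.
Lemma gl_relKF j i : glKbar q j * glF q i = q ^ (- eps_pairing j i) *: (glF q i * glKbar q j) :> Ugl.
Proof.
have e : glKbar q j * glF q i * glKbarV q j = q ^ (- eps_pairing j i) *: glF q i.
  by have := gl_class_rel (rel_KF q j i); rewrite !gl_classE.
by rewrite scalerAl -e -[RHS]mulrA gl_relVK mulr1.
Qed.

Lemma gl_relVcomm j c (x : Ugl) : c != 0 -> glKbar q j * x = c *: (x * glKbar q j) ->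
  glKbarV q j * x = c^-1 *: (x * glKbarV q j).
Proof.
move=> c0 e; apply: (canRL (scalerK c0)).
have : glKbarV q j * (glKbar q j * x) * glKbarV q j = c *: (glKbarV q j * x).
  by rewrite e -scalerAr -scalerAl -!mulrA gl_relKV mulr1.
by rewrite mulrA gl_relVK mul1r => ->.
Qed.

Lemma gl_relKV_comm i j : glKbar q i * glKbarV q j = glKbarV q j * glKbar q i :> Ugl.
Proof.
rewrite -[LHS]mul1r -(gl_relVK j) -!mulrA; congr (_ * _).
by rewrite mulrA -gl_relKK -mulrA gl_relKV mulr1.
Qed.

End GlRelations.

Definition cartan (n : nat) (i j : 'I_n) : int := eps_pairing (lo i) j - eps_pairing (hi i) j.

Lemma cartanE (n : nat) (i j : 'I_n) : cartan i j =
  if i == j then 2 else if adjacent i j then -1 else 0.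
Proof.
rewrite /cartan /eps_pairing /adjacent.
rewrite -!(inj_eq val_inj) /= /bump /=.
by do ?[case: eqP => /= ?]; lia.
Qed.

Section SlRelations.
Variables (F : fieldType) (q : F) (n : nat).
Hypothesis q0 : q != 0.
Notation Usl := (Uqsl q n).

Definition slKV (i : 'I_n) : Usl := sl_gen_val q (SKinv i).

Lemma sl_relVK i : slKV i * slK q i = 1 :> Usl.
Proof.
apply: val_inj => /=; rewrite -[LHS]/((glKbar q (hi i) * glKbarV q (lo i)) *
  (glKbar q (lo i) * glKbarV q (hi i))).
by rewrite -mulrA (mulrA (glKbarV q _)) gl_relVK mul1r gl_relKV.
Qed.

Lemma sl_relKE i j : slK q i * slE q j = q ^ cartan i j *: (slE q j * slK q i) :> Usl.
Proof.
apply: val_inj; rewrite -[LHS]/((glKbar q (lo i) * glKbarV q (hi i)) * glE q j).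
rewrite -[RHS]/(q ^ cartan i j *: (glE q j * (glKbar q (lo i) * glKbarV q (hi i)))).
rewrite -mulrA (gl_relVcomm _ (gl_relKE q _ _)) ?expfz_neq0 // -scalerAr (mulrA (glKbar q (lo i))).
rewrite gl_relKE -scalerAl scalerA -[_ * _ * glKbarV q _]mulrA; congr (_ *: _).
by rewrite invr_expz -expfzDr // /cartan addrC.
Qed.

Lemma sl_relKF i j : slK q i * slF q j = q ^ (- cartan i j) *: (slF q j * slK q i) :> Usl.
Proof.
apply: val_inj; rewrite -[LHS]/((glKbar q (lo i) * glKbarV q (hi i)) * glF q j).
rewrite -[RHS]/(q ^ (- cartan i j) *: (glF q j * (glKbar q (lo i) * glKbarV q (hi i)))).
rewrite -mulrA (gl_relVcomm _ (gl_relKF q _ _)) ?expfz_neq0 // -scalerAr (mulrA (glKbar q (lo i))).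
rewrite gl_relKF -scalerAl scalerA -[_ * _ * glKbarV q _]mulrA; congr (_ *: _).
rewrite invr_expz -expfzDr //; congr (q ^ _); rewrite /cartan; lia.
Qed.

Lemma sl_relEF i : slE q i * slF q i - slF q i * slE q i =
  (q - q^-1)^-1 *: (slK q i - slKV i) :> Usl.
Proof.
apply: val_inj; rewrite -[LHS]/(glE q i * glF q i - glF q i * glE q i).
rewrite -[RHS]/((q - q^-1)^-1 *: (glKbar q (lo i) * glKbarV q (hi i) -
   glKbar q (hi i) * glKbarV q (lo i))).
rewrite [glKbar q (hi i) * _]gl_relKV_comm.
by have := gl_class_rel (rel_EF q i); rewrite !gl_classE.
Qed.

Lemma sl_relEF_comm i j : i != j -> slE q i * slF q j = slF q j * slE q i :> Usl.
Proof.
move=> ij; apply: val_inj; rewrite -[LHS]/(glE q i * glF q j) -[RHS]/(glF q j * glE q i).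
by have := gl_class_rel (rel_EF_neq q ij); rewrite !gl_classE => /subr0_eq.
Qed.

Definition slX (d : bool) (i : 'I_n) : Usl := if d then slE q i else slF q i.

Lemma sl_relXX d (i j : 'I_n) : distant i j -> slX d i * slX d j = slX d j * slX d i.
Proof.
move=> ij; apply: val_inj; case: d.
  rewrite -[LHS]/(glE q i * glE q j) -[RHS]/(glE q j * glE q i).
  by have := gl_class_rel (rel_EE q ij); rewrite !gl_classE => /subr0_eq.
rewrite -[LHS]/(glF q i * glF q j) -[RHS]/(glF q j * glF q i).
by have := gl_class_rel (rel_FF q ij); rewrite !gl_classE => /subr0_eq.
Qed.

Lemma sl_serre d (i j : 'I_n) : adjacent i j ->
  slX d i * slX d i * slX d j - (q + q^-1) *: (slX d i * slX d j * slX d i)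
  + slX d j * slX d i * slX d i = 0.
Proof.
move=> ij; apply: val_inj; case: d.
  by have := gl_class_rel (rel_serreE q ij); rewrite !gl_classE.
by have := gl_class_rel (rel_serreF q ij); rewrite !gl_classE.
Qed.

End SlRelations.

(** * Modules as vector spaces *)

Section RestrictedScalars.
Variables (F : fieldType) (q : F) (n : nat) (V : lmodType (Uqsl q n)).

(** The scalars [c%:A] of the algebra make [V] a vector space over the field; an
    alias keeps this structure apart from the module structure. *)
Definition restr : Type := V.
HB.instance Definition _ := GRing.Zmodule.copy restr V.

Definition restr_scale (c : F) (v : restr) : restr := (c%:A : Uqsl q n) *: (v : V).

Lemma restr_scaleA a b v : restr_scale a (restr_scale b v) = restr_scale (a * b) v.
Proof. by rewrite /restr_scale scalerA mulr_algl scalerA. Qed.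
Lemma restr_scale1 : left_id 1 restr_scale.
Proof. by move=> v; rewrite /restr_scale scale1r scale1r. Qed.
Lemma restr_scaleDr : right_distributive restr_scale +%R.
Proof. by move=> a u v; rewrite /restr_scale scalerDr. Qed.
Lemma restr_scaleDl v : {morph restr_scale^~ v : a b / a + b}.
Proof. by move=> a b; rewrite /restr_scale !scalerDl. Qed.
HB.instance Definition _ := GRing.Zmodule_isLmodule.Build F restr
  restr_scaleA restr_scale1 restr_scaleDr restr_scaleDl.

Definition sl_act (x : Uqsl q n) (v : restr) : restr := x *: (v : V).

Lemma sl_actE (x : Uqsl q n) (v : V) : x *: v = sl_act x v.
Proof. by []. Qed.

Lemma sl_act_linear x : linear (sl_act x).
Proof.
move=> a u v; rewrite /sl_act scalerDr; congr (_ + _).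
change (x *: (a%:A *: (u : V)) = a%:A *: (x *: (u : V)) :> V).
by rewrite !scalerA mulr_algl mulr_algr.
Qed.

Lemma sl_act0 x : sl_act x 0 = 0.
Proof. by rewrite /sl_act scaler0. Qed.
Lemma sl_actZr x c v : sl_act x (c *: v) = c *: sl_act x v.
Proof. by rewrite -[c *: v]addr0 sl_act_linear sl_act0 addr0. Qed.
Lemma sl_actDr x u v : sl_act x (u + v) = sl_act x u + sl_act x v.
Proof. by rewrite /sl_act scalerDr. Qed.

Lemma sl_actM x y v : sl_act (x * y) v = sl_act x (sl_act y v).
Proof. by rewrite /sl_act scalerA. Qed.
Lemma sl_actD x y v : sl_act (x + y) v = sl_act x v + sl_act y v.
Proof. by rewrite /sl_act scalerDl. Qed.
Lemma sl_actB x y v : sl_act (x - y) v = sl_act x v - sl_act y v.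
Proof. by rewrite /sl_act scalerBl. Qed.
Lemma sl_actZ c x v : sl_act (c *: x) v = c *: sl_act x v.
Proof.
change ((c *: x) *: (v : V) = c%:A *: (x *: (v : V)) :> V).
by rewrite scalerA mulr_algl.
Qed.
Lemma sl_act1 v : sl_act 1 v = v.
Proof. by rewrite /sl_act scale1r. Qed.
Lemma sl_act0l v : sl_act 0 v = 0.
Proof. by rewrite /sl_act scale0r. Qed.

(** The algebra is generated by the [sl_gen_val q g], so stability under them
    suffices. *)
Lemma sl_act_closed (P : restr -> Prop) :
  (forall c u v, P u -> P v -> P (c *: u + v)) ->
  (forall g v, P v -> P (sl_act (sl_gen_val q g) v)) ->
  forall x v, P v -> P (sl_act x v).
Proof.
move=> Plin Pgen x v Pv.
have : in_sl (sl_val x) by case: x => x /= /asboolP.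
have [y e] : exists y, sl_val x = y by exists (sl_val x).
rewrite e => iy.
elim: iy x v e Pv => {y} [g|| a y z iy IHy iz IHz|y z iy IHy iz IHz] x v e Pv.
- by have -> : x = sl_gen_val q g by [apply: val_inj]; apply: Pgen.
- by have -> : x = 1 by [apply: val_inj]; rewrite sl_act1.
- pose y' := MkUqsl (introT (asboolP _) iy : sl_pred y).
  pose z' := MkUqsl (introT (asboolP _) iz : sl_pred z).
  have -> : x = a *: y' + z' by apply: val_inj.
  by rewrite sl_actD sl_actZ; apply: Plin; [apply: IHy|apply: IHz].
pose y' := MkUqsl (introT (asboolP _) iy : sl_pred y).
pose z' := MkUqsl (introT (asboolP _) iz : sl_pred z).
have -> : x = y' * z' by apply: val_inj.
by rewrite sl_actM; apply: IHy => //; apply: IHz.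
Qed.

Lemma irreducible_closed (P : restr -> Prop) : irreducible_module V ->
  (exists2 v, v != 0 & P v) ->
  (forall c u v, P u -> P v -> P (c *: u + v)) ->
  (forall g v, P v -> P (sl_act (sl_gen_val q g) v)) -> forall v, P v.
Proof.
move=> [_ irr] [v0 v00 Pv0] Plin Pgen v.
have P0 : P 0 by rewrite -[0](addNr v0) -scaleN1r; apply: Plin.
pose T : {pred V} := fun v => `[< P v >].
have subT : submod_closed T.
  split; first exact/asboolP.
  move=> a u w /asboolP Pu /asboolP Pw; apply/asboolP.
  rewrite -[_ + w]/((sl_act a u : restr) + w) -[sl_act a u]scale1r.
  by apply: (Plin) => //; apply: (sl_act_closed Plin Pgen).
have [T0|T1] := irr T subT.
  have : v0 \in pred1 (0 : V) by rewrite -T0; exact/asboolP.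
  by rewrite inE (negPf v00).
by have /asboolP : v \in T by rewrite T1.
Qed.

End RestrictedScalars.

(** * Diagonal operators *)

Section Diagonal.
Variables (F : fieldType) (q : F) (n : nat) (V : lmodType (Uqsl q n)).
Hypothesis V_wt : weight_module V.
Notation VF := (restr V).

Lemma weight_spaceE (l : weight F n) (v : VF) : weight_space l (v : V) <->
  (forall i, l i != 0) /\ (forall i, sl_act (slK q i) v = l i *: v).
Proof. by []. Qed.

(** The graph of the operator that acts by [g l] on the weight space of [l].  The
    weight components of a vector are only known to exist, so the operator is
    first described as a relation. *)
Definition diag_rel (g : weight F n -> F) (v w : VF) : Prop :=
  exists (s : seq (weight F n)) (f : weight F n -> VF),
  [/\ uniq s, forall l, l \in s -> weight_space l (f l : V),
      v = \sum_(l <- s) f l & w = \sum_(l <- s) g l *: f l].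

Lemma diag_rel_total g v : exists w, diag_rel g v w.
Proof.
have [s [f [us fs vE]]] := V_wt.1 v.
by exists (\sum_(l <- s) g l *: (f l : VF)), s, f; split.
Qed.

Lemma sum_extend (s t : seq (weight F n)) (f : weight F n -> VF) :
  uniq s -> uniq t -> {subset s <= t} ->
  \sum_(l <- s) f l = \sum_(l <- t) (if l \in s then f l else 0).
Proof.
move=> us ut st; rewrite -big_mkcond -big_filter; apply: perm_big.
apply: uniq_perm => //; first exact: filter_uniq.
by move=> l; rewrite mem_filter; case: (boolP (l \in s)) => //= /st ->.
Qed.

Lemma diag_rel_lin g a v w v' w' : diag_rel g v w -> diag_rel g v' w' ->
  diag_rel g (a *: v + v') (a *: w + w').
Proof.
move=> [s [f [us fs -> ->]]] [s' [f' [us' fs' -> ->]]].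
pose t := undup (s ++ s').
pose f0 l := if l \in s then f l else 0 : VF.
pose f0' l := if l \in s' then f' l else 0 : VF.
have ut : uniq t by apply: undup_uniq.
have st : {subset s <= t} by move=> l ls; rewrite mem_undup mem_cat ls.
have st' : {subset s' <= t} by move=> l ls; rewrite mem_undup mem_cat ls orbT.
exists t, (fun l => a *: f0 l + f0' l); split=> // [l| |].
- rewrite mem_undup mem_cat => lss; apply/weight_spaceE.
  have l0 : forall i, l i != 0.
    by case/orP: lss => [/fs|/fs'] /weight_spaceE[].
  have e0 : forall i, sl_act (slK q i) (f0 l) = l i *: f0 l.
    move=> i; rewrite /f0; case: ifP => [/fs/weight_spaceE[_ ->]|] //.
    by move=> _; rewrite scaler0 /sl_act scaler0.
  have e1 : forall i, sl_act (slK q i) (f0' l) = l i *: f0' l.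
    move=> i; rewrite /f0'; case: ifP => [/fs'/weight_spaceE[_ ->]|] //.
    by move=> _; rewrite scaler0 /sl_act scaler0.
  split=> // i; rewrite sl_act_linear e0 e1 scalerDr !scalerA.
  by rewrite mulrC.
- rewrite (sum_extend _ us ut st) (sum_extend _ us' ut st') scaler_sumr -big_split /=.
  by apply: eq_bigr => l _.
rewrite (sum_extend _ us ut st) (sum_extend _ us' ut st') scaler_sumr -big_split /=.
apply: eq_bigr => l _; rewrite scalerDr scalerA mulrC -scalerA /f0 /f0'.
by congr (_ *: _ + _); case: ifP; rewrite ?scaler0.
Qed.

Lemma diag_rel0 g w : diag_rel g 0 w -> w = 0.
Proof.
move=> [s [f [us fs e0 ->]]]; apply: big1_seq => l /andP[_ ls].
by rewrite (V_wt.2 s f us fs (esym e0) l ls) scaler0.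
Qed.

Lemma diag_rel_fun g v w w' : diag_rel g v w -> diag_rel g v w' -> w = w'.
Proof.
move=> h h'; have := diag_rel_lin (-1) h h'; rewrite !scaleN1r addNr.
by move=> /diag_rel0/eqP; rewrite addrC subr_eq0 => /eqP.
Qed.

Lemma diag_exists (g : weight F n -> F) : exists D : VF -> VF,
  linear D /\ forall l (v : VF), weight_space l (v : V) -> D v = g l *: v.
Proof.
have [D DP] := choice (diag_rel_total g); exists D; split=> [a u v|l v lv].
  exact: diag_rel_fun (DP _) (diag_rel_lin a (DP u) (DP v)).
apply: diag_rel_fun (DP v) _; exists [:: l], (fun=> v).
by split=> //; rewrite ?big_seq1 // => l'; rewrite inE => /eqP ->.
Qed.

End Diagonal.

Lemma exprz_inj (F : fieldType) (q : F) : q != 0 ->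
  (forall m : nat, (0 < m)%N -> q ^+ m != 1) -> injective (fun a : int => q ^ a).
Proof.
move=> q0 qf a b /= ab.
wlog : a b ab / a <= b.
  by move=> H; case: (lerP a b) => [|/ltW] h; [apply: H|apply/esym/H].
move=> le_ab; apply/eqP; rewrite eq_le le_ab /= leNgt; apply/negP=> lt_ab.
have : q ^ (b - a) = 1 by rewrite expfzDr // -ab -expfzDr // subrr.
have -> : b - a = (absz (b - a)%R)%:Z by lia.
by move/eqP; apply/negP/qf; lia.
Qed.

(** * The root-lattice grading of a completely pointed module *)

Section Nodes.
Variable n : nat.

Definition node_ord (i : int) : option 'I_n := if i is Posz m then insub m else None.
Definition sl_node (i : int) : bool := 0 <= i <= n%:Z - 1.

Lemma node_ordE (o : 'I_n) : node_ord o%:Z = Some o.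
Proof. exact: valK. Qed.

Lemma sl_nodeP i : reflect (exists o : 'I_n, i = o%:Z) (sl_node i).
Proof.
apply: (iffP idP) => [ni|[o ->]]; last by rewrite /sl_node; have := ltn_ord o; lia.
have lt : (absz i < n)%N by move: ni; rewrite /sl_node; lia.
by exists (Ordinal lt) => /=; move: ni; rewrite /sl_node; lia.
Qed.

Lemma adj_ord (i j : 'I_n) : adj i%:Z j%:Z = adjacent i j.
Proof.
by apply/idP/idP; rewrite /adj /adjacent; lia.
Qed.

End Nodes.

Section Grading.
Variables (F : fieldType) (q : F) (n : nat) (V : lmodType (Uqsl q n)).
Hypotheses (q0 : q != 0) (qf : forall m : nat, (0 < m)%N -> q ^+ m != 1).
Hypotheses (V_irr : irreducible_module V) (V_cp : completely_pointed V).
Notation VF := (restr V).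
Variables (l0 : weight F n) (v0 : VF).
Hypotheses (v0_neq0 : v0 != 0) (v0_wt : weight_space l0 (v0 : V)).

Definition base_l (i : int) : F := if node_ord n i is Some o then l0 o else 1.
Definition opX (d : bool) (i : int) (v : VF) : VF :=
  if node_ord n i is Some o then sl_act (slX q d o) v else 0.
(** The weight space at the point [k].  Asking [k] to vanish outside the diagram
    makes the point of a weight unique. *)
Definition wtW (k : point) (v : VF) : Prop :=
  (forall j, ~~ sl_node n j -> k j = 0) /\
  forall o : 'I_n, sl_act (slK q o) v = lam q base_l o%:Z k *: v.
Definition wt (k : point) : weight F n := [ffun o : 'I_n => lam q base_l o%:Z k].

Lemma opXE d (o : 'I_n) v : opX d o%:Z v = sl_act (slX q d o) v.
Proof. by rewrite /opX node_ordE. Qed.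

Lemma base_l_neq0 i : base_l i != 0.
Proof.
rewrite /base_l; case: node_ord => [o|]; last exact: oner_neq0.
by have [] := v0_wt.
Qed.

Lemma lam_shift_cartan (i j : 'I_n) k d :
  lam q base_l i%:Z (shift k j%:Z d) = lam q base_l i%:Z k * q ^ (sgn d * cartan i j).
Proof.
rewrite cartanE; case: (eqVneq i j) => [->|ij].
  by rewrite lam_shift // -qs_sgn exprnP exprz_exp.
have ij' : i%:Z != j%:Z by apply: contra ij => /eqP[] /val_inj ->.
case: ifP; rewrite -adj_ord => aij.
  by rewrite lam_shift_adj // mulrN1 -invr_expz qs_sgn.
by rewrite lam_shift_far ?aij // mulr0 expr0z mulr1.
Qed.

Lemma sl_relKX d (i j : 'I_n) :
  slK q i * slX q d j = q ^ (sgn d * cartan i j) *: (slX q d j * slK q i).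
Proof. by case: d; rewrite /slX /= ?mulN1r ?mul1r; [apply: sl_relKE|apply: sl_relKF]. Qed.

Lemma wtW_X d i k v : sl_node n i -> wtW k v -> wtW (shift k i d) (opX d i v).
Proof.
move=> /[dup] ni /sl_nodeP[o ->] [ks kv]; split=> [j nj|o'].
  rewrite shift_off ?ks //; apply: contra nj => /eqP ->.
  by apply/sl_nodeP; exists o.
rewrite opXE -sl_actM sl_relKX sl_actZ sl_actM kv.
by rewrite sl_actZr scalerA lam_shift_cartan mulrC.
Qed.

Lemma wtW_weight k v : wtW k v -> weight_space (wt k) (v : V).
Proof.
move=> [_ kv]; apply/weight_spaceE; split=> i; last by rewrite kv ffunE.
by rewrite ffunE lam_neq0 ?base_l_neq0.
Qed.

Lemma weight_wtW k v : (forall j, ~~ sl_node n j -> k j = 0) ->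
  weight_space (wt k) (v : V) -> wtW k v.
Proof. by move=> ks /weight_spaceE[_ kv]; split=> // o; rewrite kv ffunE. Qed.

Lemma wtW_base : wtW (fun=> 0) v0.
Proof.
split=> // o; have [_ ->] := (weight_spaceE _ _).1 v0_wt.
by rewrite lam.unlock mulr0 !subr0 expr0z mulr1 /base_l node_ordE.
Qed.

Lemma wtWZ k a v : wtW k v -> wtW k (a *: v).
Proof.
move=> [ks kv]; split=> // o.
by rewrite sl_actZr kv !scalerA mulrC.
Qed.

(** The Cartan matrix of type A is invertible, so a weight has one lattice
    point: a null vector grows linearly from one end of the diagram and has to
    vanish beyond the other. *)
Lemma wt_inj k k' : (forall j, ~~ sl_node n j -> k j = 0) ->
  (forall j, ~~ sl_node n j -> k' j = 0) -> wt k = wt k' -> k = k'.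
Proof.
move=> ks ks' /ffunP kk'; pose d j := k j - k' j.
have rec (m : nat) : (m < n)%N -> d m.+1%:Z = 2 * d m%:Z - d (m%:Z - 1).
  move=> mn; have := kk' (Ordinal mn); rewrite !ffunE !lam.unlock /=.
  move/(mulfI (base_l_neq0 _))/(exprz_inj q0 qf); rewrite /d.
  have -> : m%:Z + 1 = m.+1%:Z by lia.
  lia.
have dm1 : d (0 - 1) = 0 by rewrite /d ks ?ks' // /sl_node; lia.
have lin (m : nat) : (m <= n)%N -> d m%:Z = m.+1%:Z * d 0 /\
    d (m%:Z - 1) = m%:Z * d 0.
  elim: m => [_|m IH mn]; first by rewrite dm1 mul1r mul0r.
  have [e1 e2] := IH (ltnW mn); rewrite rec // e1 e2.
  have -> : m.+1%:Z - 1 = m%:Z by lia.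
  by rewrite e1; split; lia.
have d0 : d 0 = 0.
  have [e _] := lin n (leqnn n).
  have : d n%:Z = 0 by rewrite /d ks ?ks' // /sl_node; lia.
  by rewrite e => /eqP; rewrite mulf_eq0 => /orP[] /eqP; lia.
apply/funext => j; have [/sl_nodeP[o ->]|nj] := boolP (sl_node n j); last by rewrite ks ?ks'.
have [] := lin o (ltnW (ltn_ord o)); rewrite d0 mulr0 /d; lia.
Qed.

(** An inductive description of the span, so that a linear identity is proved by
    checking it on one summand at a time. *)
Inductive wspan (R : point -> Prop) : VF -> Prop :=
| wspan0 : wspan R 0
| wspan_add p u v of R p & wtW p u & wspan R v : wspan R (u + v).

Lemma wspan1 (R : point -> Prop) p u : R p -> wtW p u -> wspan R u.
Proof. by move=> Rp Wu; rewrite -[u]addr0; apply: wspan_add Rp Wu (wspan0 _). Qed.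

Lemma wspan_lin (R : point -> Prop) a u v : wspan R u -> wspan R v -> wspan R (a *: u + v).
Proof.
move=> + Rv; elim=> [|p x y Rp Wx _ IH]; first by rewrite scaler0 add0r.
rewrite scalerDr -addrA; apply: wspan_add Rp _ IH; exact: wtWZ.
Qed.

Lemma wspan_ind_lin (R : point -> Prop) (T T' : VF -> VF) v : linear T -> linear T' ->
  (forall p u, R p -> wtW p u -> T u = T' u) -> wspan R v -> T v = T' v.
Proof.
move=> lT lT' TT'; have z (f : VF -> VF) : linear f -> f 0 = 0.
  by move=> lf; have := lf (-1) 0 0; rewrite scaler0 addr0 scaleN1r addNr.
elim=> [|p x y Rp Wx _ IH]; first by rewrite !z.
by rewrite -[x]scale1r lT lT' IH (TT' p).
Qed.

Lemma slKV_act o k v : wtW k v ->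
  sl_act (slKV q o) v = (lam q base_l o%:Z k)^-1 *: v.
Proof.
move=> [_ kv]; have y0 : lam q base_l o%:Z k != 0 by rewrite lam_neq0 ?base_l_neq0.
have : sl_act (slKV q o * slK q o) v = v by rewrite sl_relVK sl_act1.
rewrite sl_actM kv sl_actZr => e.
by rewrite -{2}e scalerA mulVf // scale1r.
Qed.

(** The sums of weight vectors at points of [R] form a submodule if [R] is closed
    under nonzero steps. *)
Lemma wspan_all (R : point -> Prop) p0 u0 : R p0 -> wtW p0 u0 -> u0 != 0 ->
  (forall p i d u, R p -> sl_node n i -> wtW p u -> opX d i u != 0 -> R (shift p i d)) ->
  forall v, wspan R v.
Proof.
move=> R0 W0 u00 Rst; apply: irreducible_closed => //.
- by exists u0 => //; apply: wspan1 W0.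
- by move=> c u v; apply: wspan_lin.
move=> g v; elim=> [|p x y Rp Wx _ IH]; first by rewrite sl_act0; apply: wspan0.
have -> : sl_act (sl_gen_val q g) (x + y) =
    sl_act (sl_gen_val q g) x + sl_act (sl_gen_val q g) y.
  exact: sl_actDr.
rewrite -[sl_act _ x]scale1r; apply: wspan_lin IH.
have step d (o : 'I_n) : wspan R (sl_act (slX q d o) x).
  rewrite -opXE; have [->|n0] := eqVneq (opX d o%:Z x) 0; first exact: wspan0.
  have no : sl_node n o%:Z by apply/sl_nodeP; exists o.
  by apply: wspan1 (Rst _ _ _ _ Rp no Wx n0) _; apply: wtW_X.
case: g => o.
- exact: (step true).
- exact: (step false).
- by rewrite -[sl_gen_val q _]/(slK q o) (Wx.2 o); apply: wspan1 Rp (wtWZ _ Wx).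
by rewrite -[sl_gen_val q _]/(slKV q o) (slKV_act o Wx); apply: wspan1 Rp (wtWZ _ Wx).
Qed.

Lemma wspan_any v : wspan (fun=> True) v.
Proof. exact: wspan_all wtW_base v0_neq0 _ _. Qed.

(** A weight outside the coset of [l0] would give a diagonal operator that is [1]
    on it and [0] on the coset, whose weight vectors span [V]. *)
Lemma weight_lattice (l : weight F n) (v : VF) : weight_space l (v : V) -> v != 0 ->
  exists2 k, l = wt k & wtW k v.
Proof.
move=> lv v00; have [V_wt _] := V_cp.
have [D [Dlin Dwt]] := diag_exists V_wt (fun l' => (l' == l)%:R).
have [[k [ks lk]]|no] := pselect (exists k, (forall j, ~~ sl_node n j -> k j = 0) /\ l = wt k).
  by exists k => //; apply: weight_wtW; rewrite -?lk.
case/eqP: v00; have : D v = 0.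
  have lin0 : linear (fun _ : VF => 0 : VF) by move=> a u w; rewrite scaler0 addr0.
  apply: (wspan_ind_lin Dlin lin0 _ (wspan_any v)) => p u _ Wu.
  rewrite (Dwt _ _ (wtW_weight Wu)); case: eqP => [e|]; last by rewrite scale0r.
  by case: no; exists p; split=> //; case: Wu.
by rewrite (Dwt _ _ lv) eqxx scale1r.
Qed.

(** The weight vectors at the points that can be reached from [k] span a
    submodule, hence [V]. *)
Lemma sl_graded_irr k k' v v' : wtW k v -> v != 0 -> wtW k' v' -> v' != 0 ->
  reach (sl_node n) (fun d i p => exists2 u, wtW p u & opX d i u != 0) predT k k'.
Proof.
move=> Wv vn0 Wv' vn0'; set R := reach _ _ _ _.
have [V_wt _] := V_cp; apply: contrapT => nR.
pose g (l : weight F n) : F := `[< exists p u, [/\ R p, wtW p u & l = wt p] >]%:R.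
have [D [Dlin Dwt]] := diag_exists V_wt g.
have Rv' : wspan R v'.
  apply: (wspan_all (reach_refl _ _ _ k) Wv vn0) => p i d u Rp ni Wu Xu.
  by apply: reach_step => //; exists u.
have lid : linear (id : VF -> VF) by [].
have : D v' = v'.
  apply: (wspan_ind_lin Dlin lid _ Rv') => p u Rp Wu.
  rewrite (Dwt _ _ (wtW_weight Wu)) /g; case: asboolP => [_|]; first by rewrite scale1r.
  by case; exists p, u.
rewrite (Dwt _ _ (wtW_weight Wv')) /g; case: asboolP => [[p [u [Rp Wu e]]] _|_].
  by case: nR; rewrite (wt_inj Wv'.1 Wu.1 e).
by rewrite scale0r => e; rewrite -e eqxx in vn0'.
Qed.

Lemma sl_thin_graded : thin_graded q (sl_node n) base_l opX wtW.
Proof.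
have nodes i : sl_node n i -> i \in [seq m%:Z | m <- iota 0 n].
  by move=> /sl_nodeP[o ->]; apply: map_f; rewrite mem_iota /=.
split.
- exact: base_l_neq0.
- by exists [seq m%:Z | m <- iota 0 n].
- by move=> d i /sl_nodeP[o ->] a u v; rewrite !opXE sl_act_linear.
- by move=> d i k v; apply: wtW_X.
- move=> k v w Wv vn0 Ww; have [_ cp] := V_cp.
  have [|u uw [u0 uP]] := cp (wt k); first by exists v => //; apply: wtW_weight.
  have [a vE] := uP _ (wtW_weight Wv); have [b wE] := uP _ (wtW_weight Ww).
  have {}vE : v = a *: (u : VF) by [].
  have {}wE : w = b *: (u : VF) by [].
  have a0 : a != 0 by apply: contraNneq vn0 => a0; rewrite vE a0 scale0r.
  by exists (b / a); rewrite vE scalerA divfK.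
- move=> i k v /sl_nodeP[o ->] Wv; rewrite !opXE -!sl_actM -sl_actB.
  rewrite sl_relEF sl_actZ sl_actB (Wv.2 o) (slKV_act o Wv) -scalerBl scalerA.
  by rewrite mulrC.
- move=> d i j v /sl_nodeP[o ->] /sl_nodeP[o' ->] ij; rewrite !opXE -!sl_actM.
  have oo' : o != o' by apply: contra ij => /eqP ->.
  congr (sl_act _ v); case: d => /=; rewrite /slX; first exact: sl_relEF_comm.
  by rewrite sl_relEF_comm // eq_sym.
- move=> d i j v /sl_nodeP[o ->] /sl_nodeP[o' ->]; rewrite adj_ord => ij.
  rewrite !opXE -!sl_actM; have [->//|oo'] := eqVneq o o'.
  congr (sl_act _ v); apply: sl_relXX; move: ij oo'.
  by rewrite /adjacent /distant -val_eqE /=; lia.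
- move=> d i j v /sl_nodeP[o ->] /sl_nodeP[o' ->]; rewrite adj_ord => ij.
  rewrite !opXE -!sl_actM -sl_actZ -sl_actB -sl_actD sl_serre //.
  exact: sl_act0l.
exact: sl_graded_irr.
Qed.

End Grading.

(** * Existence of the parameters *)

Section CasimirParameters.
Variables (F : fieldType) (q : F) (n : nat) (V : lmodType (Uqsl q n)).
Hypotheses (q0 : q != 0) (qf : forall m : nat, (0 < m)%N -> q ^+ m != 1).
Hypotheses (quadF : quadratically_closed F) (n_gt0 : (0 < n)%N).
Hypotheses (V_irr : irreducible_module V) (V_cp : completely_pointed V).
Hypothesis V_inf : infinite_dimensional V.
Notation VF := (restr V).
Variables (l0 : weight F n) (v0 : VF).
Hypotheses (v0_neq0 : v0 != 0) (v0_wt : weight_space l0 (v0 : V)).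

Notation ell := (base_l l0).
Notation W := (@wtW F q n V l0).
Notation X := (@opX F q n V).
Notation nd := (sl_node n).
Notation S := (supp W).
Notation cas := (cas q ell X W).
Notation lam := (lam q ell).

Let q2 : q ^+ 2 != 1. Proof. exact: qf. Qed.
Let q4 : q ^+ 4 != 1. Proof. exact: qf. Qed.
Let tg := sl_thin_graded q0 qf V_irr V_cp v0_neq0 v0_wt.
Let ts := thin_graded_system q0 q2 tg.
Let lamN0 i k : lam i k != 0. Proof. exact: lam_neq0 (base_l_neq0 v0_wt i). Qed.

(** Without three weights in a row every [sl_2]-string has at most two
    elements, so the eigenvalues of the [K_i] are limited to six values. *)
Lemma short_strings i k : nd i -> S k -> ~ (exists g, triple_along S i g) ->
  [\/ lam i k ^+ 2 = 1, lam i k ^+ 2 = q ^+ 2 | lam i k ^+ 2 = (q^-1) ^+ 2].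
Proof.
move=> ni Sk no; set x := lam i k; have x0 : x != 0 := lamN0 i k.
have gap0 d p : S p -> ~ S (shift p i d) ->
    cas i p = cs (if d then q * lam i p else lam i p / q).
  move=> Sp nS; apply/eqP; rewrite -subr_eq0; apply/negPn/negP => /(ts_edge ts d ni Sp).
  exact: nS.
have qx : q * x != 0 by rewrite mulf_neq0.
have xq : x / q != 0 by rewrite mulf_neq0 ?invr_eq0.
have absurd (y : F) (e : nat) : (0 < e)%N -> y != 0 -> y = y * q ^+ e -> False.
  move=> e0 y0 ey; have /negP := qf e0; apply; apply/eqP/(mulfI y0).
  by rewrite mulr1 -ey.
have [Sp|nSp] := pselect (S (shift k i true)).
  have nSm : ~ S (shift k i false).
    by move=> Sm; apply: no; exists (shift k i false); split; rewrite ?(shiftNK _ i true).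
  have nSpp : ~ S (shift (shift k i true) i true).
    by move=> Spp; apply: no; exists k.
  have := ts_const ts ni ni (adj_irr i) Sk Sp.
  rewrite (gap0 true _ Sp nSpp) (gap0 false _ Sk nSm) /= lam_shift // -/x /= => e.
  have nz : q * (x * q ^+ 2) != 0 by rewrite mulf_neq0 ?mulf_neq0 ?expf_neq0.
  have [e1|e1] := cs_eq nz xq e.
    by case: (absurd (x / q) 4%N) => //; rewrite -{1}e1; field.
  constructor 3; rewrite exprVn; apply: (mulIf (expf_neq0 2 q0)).
  by rewrite mulVf ?expf_neq0 // -e1; field.
have [Sm|nSm] := pselect (S (shift k i false)); last first.
  have := gap0 true _ Sk nSp; rewrite (gap0 false _ Sk nSm) /= -/x => e.
  have [e1|e1] := cs_eq xq qx e.
    by case: (absurd (x / q) 2%N) => //; rewrite {1}e1; field.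
  by constructor 1; rewrite -e1; field.
have nSmm : ~ S (shift (shift k i false) i false).
  move=> Smm; apply: no; exists (shift (shift k i false) i false).
  by split; rewrite ?(shiftNK _ i true).
have := ts_const ts ni ni (adj_irr i) Sk Sm.
rewrite (gap0 false _ Sm nSmm) (gap0 true _ Sk nSp) /= lam_shift // -/x /= => e.
have nz : x * q^-1 ^+ 2 / q != 0 by rewrite !mulf_neq0 ?expf_neq0 ?invr_eq0.
have [e1|e1] := cs_eq nz qx e.
  by case: (absurd (x * q^-1 ^+ 2 / q) 4%N) => //; rewrite {1}e1; field.
by constructor 2; rewrite -[RHS]mul1r -e1; field.
Qed.

(** Otherwise the weights take finitely many values, and one vector for each of
    them spans [V]. *)
Lemma triple_exists : exists i g, nd i /\ triple_along S i g.
Proof.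
apply: contrapT => no; apply: V_inf.
(* the square roots of the three values in [short_strings] *)
pose A := [:: 1; -1; q; -q; q^-1; -q^-1].
have inA i k : nd i -> S k -> lam i k \in A.
  move=> ni Sk; have nog : ~ (exists g, triple_along S i g).
    by move=> [g tg']; apply: no; exists i, g.
  have [||] := short_strings ni Sk nog.
  - by rewrite -{1}(expr1n F 2) => /eqP; rewrite eqf_sqr !inE => /orP[] -> ; rewrite ?orbT.
  - by move/eqP; rewrite eqf_sqr !inE => /orP[] -> ; rewrite ?orbT.
  - by move/eqP; rewrite eqf_sqr !inE => /orP[] -> ; rewrite ?orbT.
pose T := {ffun 'I_n -> 'I_6}.
pose lT (f : T) : weight F n := [ffun o => A`_(f o)].
have wtT k : S k -> exists f : T, wt q l0 k = lT f.
  move=> Sk; exists [ffun o : 'I_n => inord (index (lam o%:Z k) A)].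
  apply/ffunP => o; rewrite !ffunE inordK ?nth_index //.
    by apply: inA => //; apply/sl_nodeP; exists o.
  by rewrite -[6%N]/(size A) index_mem; apply: inA => //; apply/sl_nodeP; exists o.
have basis (f : T) : exists b : VF, forall w : VF, weight_space (lT f) (w : V) -> exists c, w = c *: b.
  have [ex|nex] := pselect (exists2 v : V, weight_space (lT f) v & v != 0).
    by have [b _ [_ bP]] := V_cp.2 (lT f) ex; exists b.
  exists 0 => w Ww; exists 0; rewrite scaler0.
  by apply/eqP/negPn/negP => w0; apply: nex; exists w.
have [b bP] := choice basis.
pose s : seq V := [seq (b f : V) | f <- enum T]; exists s.
pose P (v : VF) := exists c : 'I_(size s) -> F, v = \sum_(i < size s) c i *: (s`_i : VF).
suff PP v : P v by move=> v; have [c vE] := PP v; exists c.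
have P_add u w : P u -> P w -> P (u + w).
  move=> [c ->] [c' ->]; exists (fun i => c i + c' i).
  by rewrite -big_split; apply: eq_bigr => i _; rewrite scalerDl.
have P0 : P 0 by exists (fun=> 0); rewrite big1 // => i _; rewrite scale0r.
have P_b c f : P (c *: b f).
  have fs : (index f (enum T) < size s)%N by rewrite size_map index_mem mem_enum.
  exists (fun i => if i == Ordinal fs then c else 0).
  rewrite (bigD1 (Ordinal fs)) //= eqxx big1 ?addr0 => [|i /negPf ->]; last by rewrite scale0r.
  by congr (_ *: _); rewrite (nth_map f) ?index_mem ?mem_enum // nth_index ?mem_enum.
elim: (wspan_any q0 V_irr v0_neq0 v0_wt v) => [//|p u w _ Wu _ Pw].
apply: P_add Pw; have [->//|u0] := eqVneq u 0.
have [f fE] : exists f : T, wt q l0 p = lT f by apply: wtT; exists u.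
have := wtW_weight q0 v0_wt Wu; rewrite fE => /bP[c ->]; exact: P_b.
Qed.

Lemma sl_node0 : n = 1%N -> forall j, nd j -> j = 0.
Proof. by move=> n1 j; rewrite /sl_node n1; lia. Qed.

Lemma root_of_quadratic (a b : F) : exists x, x ^+ 2 + a * x + b = 0.
Proof.
pose p := Poly [:: b; a; 1].
have sp : size p = 3%N by rewrite (PolyK (c := 0)) //= oner_neq0.
have [x /rootP] := quadF sp; rewrite horner_Poly /= => e; exists x.
by rewrite -e; ring.
Qed.

(** With several nodes this is [good_everywhere], started from a triple.  With
    one node the Casimir value is the same at all weights, and it suffices to
    write it as [cs x]. *)
Lemma parameters_exist : exists m, good_param q nd S ell cas m.
Proof.
have S0 : S (fun=> 0) by exists v0 => //; apply: wtW_base.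
have l0' := base_l_neq0 v0_wt.
have [n1|n1] := eqVneq n 1%N; last first.
  have [i [g [ni tg']]] := triple_exists.
  apply: (good_everywhere q0 q2 q4 (lo := 0) (hi := n%:Z - 1) ts _ _ _ ni tg') => //.
  - by move=> k j [v [ks _] _] nj; apply: ks.
  by move: n_gt0 n1; lia.
have n0 : nd 0 by rewrite /sl_node n1.
have [x e] := root_of_quadratic (- cas 0 (fun=> 0)) 1.
have x0 : x != 0.
  by apply: contra_eq_neq e => ->; rewrite expr0n mulr0 !add0r oner_neq0.
have cx : cas 0 (fun=> 0) = cs x.
  apply: (mulfI x0); rewrite /cs mulrDr divff // -expr2; apply/eqP.
  by rewrite -subr_eq0 -oppr_eq0 -e; apply/eqP; ring.
have y0 := lamN0 0 (fun=> 0).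
have w0 : x / (q * lam 0 (fun=> 0)) != 0.
  by rewrite mulf_neq0 ?invr_eq0 ?mulf_neq0.
have [m [m0 mE m1]] := msq_param_exists 1 l0' w0.
exists m; split=> // i k ni Sk; have -> : i = 0 := sl_node0 n1 ni.
have g0 : good_at q ell cas m 0 (fun=> 0).
  rewrite /good_at /target /target_arg cx; congr cs; rewrite msq.unlock add0r m1 subr0 mulr0 expr0z mulr1.
  by field; rewrite q0 y0.
apply: (ts_conn ts (J := predT) (P := good_at q ell cas m 0) S0 Sk) => // p j d _ nj Sp gp Sp'.
rewrite (sl_node0 n1 nj) in Sp' *.
by apply: (good_const q0 q2 ts) => //; apply: adj_irr.
Qed.

End CasimirParameters.

(** * The extended action *)

Lemma shift_eps n (k : point) (j : 'I_n.+1) (o : 'I_n) d :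
  shift k o%:Z d j%:Z - shift k o%:Z d (j%:Z - 1) =
  k j%:Z - k (j%:Z - 1) + sgn d * eps_pairing j o.
Proof.
rewrite /shift /eps_pairing -!(inj_eq val_inj) /= /bump /=.
by do ?[case: eqP => /= ?]; lia.
Qed.

Section KbarEigenvalues.
Variables (F : fieldType) (q : F) (n : nat) (V : lmodType (Uqsl q n)).
Hypotheses (q0 : q != 0) (qf : forall m : nat, (0 < m)%N -> q ^+ m != 1).
Hypotheses (quadF : quadratically_closed F) (n_gt0 : (0 < n)%N).
Hypotheses (V_irr : irreducible_module V) (V_cp : completely_pointed V).
Hypothesis V_inf : infinite_dimensional V.
Notation VF := (restr V).
Variables (l0 : weight F n) (v0 : VF).
Hypotheses (v0_neq0 : v0 != 0) (v0_wt : weight_space l0 (v0 : V)).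

Notation ell := (base_l l0).
Notation W := (@wtW F q n V l0).
Notation lam := (lam q ell).

(** The eigenvalue of [[K; s]] where [K] has the eigenvalue [x]. *)
Definition qnum (x : F) (s : int) : F := (q - q^-1)^-1 * (q ^ s * x - q ^ (- s) * x^-1).

Lemma qnum0 x : qnum x 0 = (x - x^-1) / (q - q^-1).
Proof. by rewrite /qnum oppr0 !expr0z !mul1r mulrC. Qed.

Lemma qnum1 x : qnum x 1 = (q * x - (q * x)^-1) / (q - q^-1).
Proof. by rewrite /qnum expr1z -invr_expz expr1z invfM mulrC. Qed.

Let q2 : q ^+ 2 != 1. Proof. exact: qf. Qed.
Let tg := sl_thin_graded q0 qf V_irr V_cp v0_neq0 v0_wt.
Let e0 : q - q^-1 != 0. Proof. exact: q_subV_neq0. Qed.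

(** What the relations between the [Kbar_j] and the other generators, and the
    formula for [F_i E_i], require of the eigenvalues. *)
Definition Kbar_spec (mu : 'I_n.+1 -> point -> F) := [/\
  forall j k, mu j k != 0,
  forall (o : 'I_n) k, mu (lo o) k = mu (hi o) k * lam o%:Z k,
  forall j (o : 'I_n) k d, mu j (shift k o%:Z d) = mu j k * q ^ (sgn d * eps_pairing j o) &
  forall (o : 'I_n) k v, W k v ->
    sl_act (slF q o) (sl_act (slE q o) v) = (qnum (mu (lo o) k) 1 * qnum (mu (hi o) k) 0) *: v].

(** Only the last [Kbar_j] needs a square root; the others are its products with
    eigenvalues of the [K_i]. *)
Lemma Kbar_eigenvalues : exists mu, Kbar_spec mu.
Proof.
have [m [m0 mE gm]] := parameters_exist q0 qf quadF n_gt0 V_irr V_cp V_inf v0_neq0 v0_wt.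
have [r rE] : exists r, r ^+ 2 = m n%:Z.
  have [r e] := root_of_quadratic quadF 0 (- m n%:Z).
  by exists r; apply/eqP; rewrite -subr_eq0 -e mul0r addr0.
have r0 : r != 0 by rewrite -(sqrf_eq0 r) rE.
have l0' := base_l_neq0 v0_wt.
(* the eigenvalue of [Kbar_j] is that of the last one times those of the
   [K_i] with [j <= i < n] *)
pose mu (j : 'I_n.+1) (k : point) :=
  r * \prod_(j <= i < n) ell i%:Z * q ^ (k j%:Z - k (j%:Z - 1)).
have mu0 j k : mu j k != 0.
  rewrite !mulf_neq0 ?expfz_neq0 //.
  by rewrite prodf_seq_neq0; apply/allP => i _; apply: l0'.
have mul (o : 'I_n) k : mu (lo o) k = mu (hi o) k * lam o%:Z k.
  rewrite /mu /= (big_ltn (ltn_ord o)) lam.unlock.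
  have -> : bump 0 o = o.+1 by rewrite /bump.
  have -> : o%:Z + 1 = o.+1%:Z by lia.
  have -> : (o.+1%:Z - 1) = o%:Z by lia.
  have -> : k o%:Z - k (o%:Z - 1) = (k o.+1%:Z - k o%:Z) +
     (2 * k o%:Z - k (o%:Z - 1) - k o.+1%:Z) by lia.
  by rewrite expfzDr //; ring.
have musq j k : mu j k ^+ 2 = msq q m j%:Z k.
  have [d dE] : exists d : nat, n = (j + d)%N by exists (n - j)%N; have := ltn_ord j; lia.
  elim: d j dE => [|d IH] j dE.
    have -> : j = ord_max by apply: val_inj => /=; lia.
    rewrite /mu big_geq //= mulr1 exprMn rE msq.unlock; congr (_ * _).
    by rewrite exprnP exprz_exp mulrC.
  have jn : (j < n)%N by lia.
  pose o := Ordinal jn.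
  have -> : j = lo o by apply: val_inj.
  rewrite mul exprMn IH; last by rewrite /= /bump /=; lia.
  rewrite (msq_lam q0 k (mE o%:Z)); congr (msq q m _ k * _).
  by rewrite /= /bump /=; lia.
exists mu; split=> // [j o k d|o k v Wv].
  by rewrite /mu shift_eps expfzDr // mulrA.
have no : sl_node n o%:Z by apply/sl_nodeP; exists o.
have := XX q0 q2 tg true no Wv; rewrite /= !opXE => ->.
have [->|v00] := eqVneq v 0; first by rewrite !scaler0.
have Sk : supp W k by exists v.
congr (_ *: v); rewrite (good_gap _ (gm _ _ no Sk)) /cas_gap /target /target_arg.
have -> : msq q m (o%:Z + 1) k = mu (hi o) k ^+ 2.
  by rewrite musq; congr (msq q m _ k); rewrite /= /bump /=; lia.
have -> : lam o%:Z k = mu (lo o) k / mu (hi o) k by rewrite mul mulrC mulKf.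
have x0 := mu0 (lo o) k; have y0 := mu0 (hi o) k.
rewrite qnum0 qnum1 /cs; field.
by rewrite ?q0 ?x0 ?y0 /= subr_eq0 -expr2 q2.
Qed.

End KbarEigenvalues.

Section GlAction.
Variables (F : fieldType) (q : F) (n : nat) (V : lmodType (Uqsl q n)).
Hypotheses (q0 : q != 0) (qf : forall m : nat, (0 < m)%N -> q ^+ m != 1).
Hypotheses (V_irr : irreducible_module V) (V_cp : completely_pointed V).
Notation VF := (restr V).
Variables (l0 : weight F n) (v0 : VF).
Hypotheses (v0_neq0 : v0 != 0) (v0_wt : weight_space l0 (v0 : V)).

Notation ell := (base_l l0).
Notation W := (@wtW F q n V l0).
Notation lam := (lam q ell).

(** A weight determines its point by [wt_inj], so a function of the point is a
    function of the weight. *)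
Lemma diag_point (g : point -> F) : exists D : VF -> VF,
  linear D /\ forall k v, W k v -> D v = g k *: v.
Proof.
have [V_wt _] := V_cp.
pose g' (l : weight F n) : F :=
  if pselect (exists k, (forall j, ~~ sl_node n j -> k j = 0) /\ l = wt q l0 k) is left H
  then g (projT1 (cid H)) else 0.
have [D [Dlin Dwt]] := diag_exists V_wt g'; exists D; split=> // k v Wv.
rewrite (Dwt _ _ (wtW_weight q0 v0_wt Wv)) /g'; case: pselect => [H|]; last first.
  by case; exists k; split=> //; case: Wv.
by case: cid => k' /= [ks' /(wt_inj q0 qf v0_neq0 v0_wt Wv.1 ks') <-].
Qed.

Lemma eq_on_weights (T T' : VF -> VF) : linear T -> linear T' ->
  (forall k v, W k v -> T v = T' v) -> T =1 T'.
Proof.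
move=> lT lT' e v; apply: (wspan_ind_lin lT lT' _ (wspan_any q0 V_irr v0_neq0 v0_wt v)).
by move=> k u _; apply: e.
Qed.

Variable mu : 'I_n.+1 -> point -> F.
Hypothesis mu_spec : Kbar_spec V l0 mu.

Lemma Kbar_ops : exists K KV : 'I_n.+1 -> VF -> VF, [/\
  forall j, linear (K j), forall j, linear (KV j),
  forall j k v, W k v -> K j v = mu j k *: v &
  forall j k v, W k v -> KV j v = (mu j k)^-1 *: v].
Proof.
have [K KP] := choice (fun j => diag_point (mu j)).
have [KV KVP] := choice (fun j => diag_point (fun k => (mu j k)^-1)).
exists K, KV; split=> j; [exact: (KP j).1|exact: (KVP j).1|exact: (KP j).2|exact: (KVP j).2].
Qed.

Variables K KV : 'I_n.+1 -> VF -> VF.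
Hypotheses (K_lin : forall j, linear (K j)) (KV_lin : forall j, linear (KV j)).
Hypotheses (K_wt : forall j k v, W k v -> K j v = mu j k *: v).
Hypotheses (KV_wt : forall j k v, W k v -> KV j v = (mu j k)^-1 *: v).

Fixpoint tact (t : term F (gl_gen n)) : VF -> VF :=
  match t with
  | Gen (GE i) => sl_act (slE q i)
  | Gen (GF i) => sl_act (slF q i)
  | Gen (GK j) => K j
  | Gen (GKinv j) => KV j
  | TZero => fun=> 0
  | TOne => id
  | TOpp t => fun v => - tact t v
  | TAdd t u => fun v => tact t v + tact u v
  | TMul t u => fun v => tact t (tact u v)
  | TScale c t => fun v => c *: tact t v
  end.

Lemma tact_linear t : linear (tact t).
Proof.
elim: t => [[i|i|j|j]|||t IH|t IHt u IHu|t IHt u IHu|c t IH] a v w //=.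
- exact: sl_act_linear.
- exact: sl_act_linear.
- exact: K_lin.
- exact: KV_lin.
- by rewrite scaler0 addr0.
- by rewrite IH opprD scalerN.
- by rewrite IHt IHu scalerDr addrACA.
- by rewrite IHu IHt.
by rewrite IH scalerDr !scalerA mulrC.
Qed.

Lemma tactZ t a v : tact t (a *: v) = a *: tact t v.
Proof.
have t0 : tact t 0 = 0.
  by have := tact_linear t (-1) 0 0; rewrite scaler0 addr0 scaleN1r addNr.
by rewrite -[a *: v]addr0 tact_linear t0 addr0.
Qed.

Lemma tactD t v w : tact t (v + w) = tact t v + tact t w.
Proof. by have := tact_linear t 1 v w; rewrite !scale1r. Qed.

Lemma KZ j a v : K j (a *: v) = a *: K j v.
Proof. exact: (tactZ (Gen (GK j))). Qed.
Lemma KVZ j a v : KV j (a *: v) = a *: KV j v.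
Proof. exact: (tactZ (Gen (GKinv j))). Qed.

Lemma W_shift d (o : 'I_n) k v : W k v -> W (shift k o%:Z d) (sl_act (slX q d o) v).
Proof.
move=> Wv; rewrite -opXE; apply: wtW_X => //.
by apply/sl_nodeP; exists o.
Qed.

Lemma tact_rel t u : gl_rel q t u -> tact t =1 tact u.
Proof.
have [mu0 mul mus _] := mu_spec.
have subE (x y z w : Uqsl q n) (v : VF) : x * y - z * w = 0 ->
    sl_act x (sl_act y v) - sl_act z (sl_act w v) = 0.
  by move=> e; rewrite -!sl_actM -sl_actB e sl_act0l.
move=> r; apply: (eq_on_weights (tact_linear t) (tact_linear u)) => k v Wv.
have shX d o := W_shift d o Wv.
case: r => [j|j|i j|j i|j i|i|i j ij|i j ij|i j ij|i j ij|i j ij] /=.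
- by rewrite (KV_wt _ Wv) KZ (K_wt _ Wv) scalerA mulVf ?scale1r.
- by rewrite (K_wt _ Wv) KVZ (KV_wt _ Wv) scalerA divff ?scale1r.
- rewrite (K_wt _ Wv) (K_wt _ Wv) KZ KZ.
  by rewrite !(K_wt _ Wv) !scalerA mulrC.
- rewrite (KV_wt _ Wv) sl_actZr KZ (K_wt _ (shX true i)).
  by rewrite mus scalerA mul1r mulKf.
- rewrite (KV_wt _ Wv) sl_actZr KZ (K_wt _ (shX false i)).
  by rewrite mus scalerA mulN1r mulKf.
- rewrite -!sl_actM -sl_actB sl_relEF sl_actZ; congr (_ *: _).
  rewrite sl_actB (Wv.2 i) (slKV_act q0 v0_wt i Wv).
  rewrite (KV_wt _ Wv) (K_wt _ Wv) KZ KVZ.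
  rewrite (KV_wt _ Wv) (K_wt _ Wv) !scalerA mul; congr (_ *: _ - _ *: _).
    by rewrite mulKf.
  by rewrite invfM mulrA divff // mul1r.
- by apply: subE; rewrite sl_relEF_comm // subrr.
- by apply: subE; have := sl_relXX q true ij; rewrite /slX => ->; rewrite subrr.
- by apply: subE; have := sl_relXX q false ij; rewrite /slX => ->; rewrite subrr.
- have := sl_serre q true ij; rewrite /slX => e.
  by rewrite -!sl_actM -sl_actZ -sl_actB -sl_actD ?mulrA e sl_act0l.
have := sl_serre q false ij; rewrite /slX => e.
by rewrite -!sl_actM -sl_actZ -sl_actB -sl_actD ?mulrA e sl_act0l.
Qed.

(** An action of expressions that respects the relations respects the whole
    congruence. *)
Lemma tact_cong t u : alg_cong (@gl_rel F q n) t u -> tact t =1 tact u.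
Proof.
elim=> {t u} [t u|t|t u _ IH|u t w _ IH1 _ IH2|t t' _ IH|t t' u u' _ IH1 _ IH2|
  t t' u u' _ IH1 _ IH2|c t t' _ IH|t u w|t u|t|t|t u w|t|t|t u w|t u w|a b t|t|
  a t u|a b t|a t u|a t u] v //=.
- by apply: tact_rel.
- by rewrite IH1 IH2.
- by rewrite IH.
- by rewrite IH1 IH2.
- by rewrite IH1 IH2.
- by rewrite IH.
- by rewrite addrA.
- by rewrite addrC.
- by rewrite add0r.
- by rewrite addNr.
- by rewrite tactD.
- by rewrite scalerA.
- by rewrite scale1r.
- by rewrite scalerDr.
- by rewrite scalerDl.
by rewrite tactZ.
Qed.

Definition gl_act (x : Uqgl q n) (v : V) : V := tact (repr x) v.

Lemma gl_actE t v : gl_act (gl_class q t) v = tact t v.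
Proof. exact/tact_cong/gl_repr_class. Qed.

Lemma gl_act_module : is_module_action gl_act.
Proof.
split=> [v|a b v|a b v|a v w].
- by rewrite -[1]/(gl_class q 1) gl_actE.
- elim/gl_classW: a => t; elim/gl_classW: b => u.
  by rewrite -gl_classM !gl_actE.
- elim/gl_classW: a => t; elim/gl_classW: b => u.
  by rewrite -gl_classD !gl_actE.
elim/gl_classW: a => t; rewrite !gl_actE.
exact: tactD.
Qed.

Lemma gl_actZ c x (v : VF) : gl_act (c *: x) v = c *: (gl_act x v : VF).
Proof. by elim/gl_classW: x => t; rewrite -gl_classZ !gl_actE. Qed.

(** Both actions agree on the generators of the smaller algebra, by the relation
    between the eigenvalues of [K_i] and those of the [Kbar_j]. *)
Lemma gl_act_extends : extends_sl_action gl_act.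
Proof.
split; first exact: gl_act_module.
have [a1 aM aD _] := gl_act_module; have [mu0 mul _ _] := mu_spec.
move=> u v; have : in_sl (sl_val u) by case: u => x /= /asboolP.
have [y e] : exists y, sl_val u = y by exists (sl_val u).
rewrite e => iy; elim: iy u v e => {y} [g|| a y z iy IHy iz IHz|y z iy IHy iz IHz] x v e.
- have -> : x = sl_gen_val q g by apply: val_inj.
  case: g {e} => o; rewrite /sl_gen_gl /glE /glF /glKbar /glKbarV -?gl_classM gl_actE //=.
    change (tact (Gen (GK (lo o)) * Gen (GKinv (hi o)))%ncT v = sl_act (slK q o) v).
    apply: (eq_on_weights (tact_linear _) (sl_act_linear _)) => k w Ww /=.
    rewrite (KV_wt _ Ww) KZ (K_wt _ Ww) (Ww.2 o) scalerA mul.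
    by rewrite mulKf.
  change (tact (Gen (GK (hi o)) * Gen (GKinv (lo o)))%ncT v = sl_act (slKV q o) v).
  apply: (eq_on_weights (tact_linear _) (sl_act_linear _)) => k w Ww /=.
  rewrite (KV_wt _ Ww) KZ (K_wt _ Ww) (slKV_act q0 v0_wt o Ww).
  by rewrite scalerA mul invfM mulrC mulrA divff // mul1r.
- by have -> : x = 1 by [apply: val_inj]; rewrite a1 scale1r.
- pose y' := MkUqsl (introT (asboolP _) iy : sl_pred y).
  pose z' := MkUqsl (introT (asboolP _) iz : sl_pred z).
  have -> : x = a *: y' + z' by apply: val_inj.
  rewrite aD gl_actZ (IHy y') // (IHz z') // scalerDl; congr (_ + _).
  exact/esym/sl_actZ.
pose y' := MkUqsl (introT (asboolP _) iy : sl_pred y).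
pose z' := MkUqsl (introT (asboolP _) iz : sl_pred z).
have -> : x = y' * z' by apply: val_inj.
by rewrite aM (IHz z') // (IHy y') // scalerA.
Qed.

Lemma gl_act_bracket j s k (v : VF) : W k v ->
  gl_act (Kbar_bracket q j s) v = (qnum q (mu j k) s *: v : VF).
Proof.
move=> Wv; have aD x y w : gl_act (x + y) w = (gl_act x w : VF) + (gl_act y w : VF).
  by have [_ _ aD _] := gl_act_module; apply: aD.
rewrite /Kbar_bracket /qbracket gl_actZ -scaleNr aD !gl_actZ.
rewrite /glKbar /glKbarV !gl_actE /= (K_wt _ Wv) (KV_wt _ Wv) !scalerA -scalerDl.
by rewrite scalerA mulNr /qnum.
Qed.

End GlAction.

(** * Root vectors in terms of the generators *)

Lemma ord_range_cons n (o k : 'I_n) : (o < k)%N ->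
  [seq l : 'I_n <- enum 'I_n | (o <= l < k)%N] =
  o :: [seq l : 'I_n <- enum 'I_n | (o.+1 <= l < k)%N].
Proof.
move=> ok; pose r (a b : 'I_n) := (a < b)%N.
have rtr : transitive r by move=> a b c; apply: ltn_trans.
have rirr : irreflexive r by move=> a; apply: ltnn.
have rs : sorted r (enum 'I_n).
  by have := iota_ltn_sorted 0 n; rewrite -val_enum_ord sorted_map.
apply: (irr_sorted_eq rtr rirr); first exact: sorted_filter.
  rewrite /= path_min_sorted; first exact: sorted_filter.
  by apply/allP => l; rewrite mem_filter => /andP[/andP[]].
have inR m l : (l \in [seq l : 'I_n <- enum 'I_n | (m <= l < k)%N]) = (m <= l < k)%N.
  by rewrite mem_filter mem_enum andbT.
move=> l; rewrite inE !inR -val_eqE /=.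
by move: ok; lia.
Qed.

Lemma ord_range_nil n (k : 'I_n) : [seq l : 'I_n <- enum 'I_n | (k <= l < k)%N] = [::].
Proof.
by rewrite (eq_filter (a2 := pred0)) ?filter_pred0 // => l /=; lia.
Qed.

Lemma teval_subst (F : fieldType) (X Y : Type) (A : algType F) (g : X -> term F Y)
  (h : Y -> A) t : teval h (tsubst g t) = teval (fun x => teval h (g x)) t.
Proof. by elim: t => [x|||t IH|t IHt u IHu|t IHt u IHu|c t IH] //=; congruence. Qed.

Section BraidValue.
Variables (F : fieldType) (q : F) (n : nat) (g : 'I_n -> sl_gen n) (c c' : F).

Hypothesis braid_next : forall (A : algType F) (h : sl_gen n -> A) (i j : 'I_n),
  j = i.+1 :> nat -> teval h (lusztigT_gen q i (g j)) =
    c *: (h (g j) * h (g i)) + c' *: (h (g i) * h (g j)).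
Hypothesis braid_far : forall (A : algType F) (h : sl_gen n -> A) (i j : 'I_n),
  (i.+1 < j)%N -> teval h (lusztigT_gen q i (g j)) = h (g j).

(** The value, in any algebra, of the braid operators [T_i .. T_(k-1)] applied to
    the generator [g k].  Letting the assignment [h] vary makes it possible to
    absorb the outermost operator into [h]. *)
Definition braid_value (A : algType F) (h : sl_gen n -> A) (i : nat) (k : 'I_n) : A :=
  teval h (foldr (@lusztigT F q n) (Gen (g k)) [seq l : 'I_n <- enum 'I_n | (i <= l < k)%N]).

Definition twist (A : algType F) (h : sl_gen n -> A) (i : 'I_n) : sl_gen n -> A :=
  fun x => teval h (lusztigT_gen q i x).

Lemma twist_next (A : algType F) (h : sl_gen n -> A) (i j : 'I_n) : j = i.+1 :> nat ->
  twist h i (g j) = c *: (h (g j) * h (g i)) + c' *: (h (g i) * h (g j)).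
Proof. exact: braid_next. Qed.

Lemma twist_far (A : algType F) (h : sl_gen n -> A) (i j : 'I_n) : (i.+1 < j)%N ->
  twist h i (g j) = h (g j).
Proof. exact: braid_far. Qed.

Lemma braid_value0 (A : algType F) (h : sl_gen n -> A) (k : 'I_n) :
  braid_value h k k = h (g k).
Proof. by rewrite /braid_value ord_range_nil. Qed.

Lemma braid_valueS (A : algType F) (h : sl_gen n -> A) (i k : 'I_n) : (i < k)%N ->
  braid_value h i k = braid_value (twist h i) i.+1 k.
Proof. by move=> ik; rewrite /braid_value ord_range_cons //= teval_subst. Qed.

Lemma braid_value_eq (A : algType F) (h h' : sl_gen n -> A) (i : nat) (k : 'I_n) :
  (i <= k)%N -> (forall m : 'I_n, (i <= m)%N -> h (g m) = h' (g m)) ->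
  braid_value h i k = braid_value h' i k.
Proof.
have [d dE] : exists d : nat, (k = i + d :> nat)%N \/ (k < i)%N by exists (k - i)%N; lia.
elim: d i h h' dE => [|d IH] i h h' [] dE ik hh' //; try lia.
  have iE : i = k by lia.
  by rewrite iE !braid_value0 hh' // iE.
have ni : (i < n)%N by have := ltn_ord k; lia.
have ik' : (Ordinal ni < k)%N by move=> /=; lia.
rewrite -[i]/(nat_of_ord (Ordinal ni)) !braid_valueS //; apply: IH => /=; first by left; lia.
  by lia.
move=> m im; rewrite /twist; have [me|ml] := leqP m i.+1.
  by rewrite !braid_next /= ?hh' //=; lia.
by rewrite !braid_far //= hh' //; lia.
Qed.

Lemma braid_value_comm (A : algType F) (h : sl_gen n -> A) (a : A) (i : nat) (k : 'I_n) :
  (i <= k)%N -> (forall m : 'I_n, (i <= m)%N -> a * h (g m) = h (g m) * a) ->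
  a * braid_value h i k = braid_value h i k * a.
Proof.
have [d dE] : exists d : nat, (k = i + d :> nat)%N \/ (k < i)%N by exists (k - i)%N; lia.
elim: d i h dE => [|d IH] i h [] dE ik ah //; try lia.
  have iE : i = k by lia.
  by rewrite iE !braid_value0 ah // iE.
have ni : (i < n)%N by have := ltn_ord k; lia.
have ik' : (Ordinal ni < k)%N by move=> /=; lia.
rewrite -[i]/(nat_of_ord (Ordinal ni)) !braid_valueS //; apply: IH => /=; first by left; lia.
  by lia.
move=> m im; rewrite /twist; have [me|ml] := leqP m i.+1; last first.
  by rewrite !braid_far //= ah //; lia.
rewrite !braid_next /=; last by lia.
have ai : a * h (g (Ordinal ni)) = h (g (Ordinal ni)) * a by apply: ah.
have am : a * h (g m) = h (g m) * a by apply: ah; lia.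
rewrite mulrDr mulrDl -!scalerAr -!scalerAl.
by rewrite !mulrA ai am -!mulrA ai am.
Qed.

(** Induction on [k - i], for all assignments at once: the outermost operator
    replaces [h] by its twist, which differs from [h] only at [i + 1] among the
    generators involved and satisfies the same commutations. *)
Lemma braid_value_rec (A : algType F) (h : sl_gen n -> A) (i k : 'I_n) : (i < k)%N ->
  (forall a b : 'I_n, (a.+1 < b)%N -> (i <= a)%N -> h (g a) * h (g b) = h (g b) * h (g a)) ->
  braid_value h i k = c *: (braid_value h i.+1 k * h (g i))
                      + c' *: (h (g i) * braid_value h i.+1 k).
Proof.
have [d dE] : exists d : nat, (k = i + d.+1 :> nat)%N \/ (k <= i)%N by exists (k - i.+1)%N; lia.
elim: d i h dE => [|d IH] i h [] dE ik comm; try lia.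
  have e : i.+1 = k by lia.
  by rewrite braid_valueS // e !braid_value0 twist_next.
have ni : (i.+1 < n)%N by have := ltn_ord k; lia.
pose j := Ordinal ni; have jE : j = i.+1 :> nat by [].
rewrite braid_valueS // -jE (IH j); first last.
- move=> a b ab ja.
  have jb : (i.+1 < b)%N by move: ab ja; rewrite jE; lia.
  rewrite (twist_far h jb); have bi : h (g i) * h (g b) = h (g b) * h (g i) by apply: comm.
  have ba : h (g a) * h (g b) = h (g b) * h (g a).
    by apply: comm => //; apply: leq_trans ja; rewrite jE.
  have [aj|aj] := leqP a j; last by rewrite twist_far // -jE.
  have aE : a = i.+1 :> nat by apply/eqP; rewrite eqn_leq -jE aj ja.
  rewrite (twist_next h aE) mulrDr mulrDl -!scalerAr -!scalerAl.
  by congr (_ *: _ + _ *: _); rewrite -mulrA ?bi ?ba !mulrA ?bi ?ba.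
- by rewrite jE; lia.
- by left; rewrite jE; lia.
have e : braid_value (twist h i) j.+1 k = braid_value h j.+1 k.
  apply: braid_value_eq; first by rewrite jE; lia.
  by move=> m jm; apply: twist_far; rewrite -jE.
rewrite e (IH j) //; first last.
- by move=> a b ab ja; apply: comm => //; move: ja jE; lia.
- by rewrite jE; lia.
- by left; rewrite jE; lia.
rewrite !(twist_next h jE).
set Z := braid_value h j.+1 k.
have cZ : h (g i) * Z = Z * h (g i).
  apply: braid_value_comm; first by rewrite jE; lia.
  by move=> m jm; apply: comm.
set x := h (g i) in cZ *; set y := h (g j).
rewrite !(mulrDr, mulrDl) !scalerDr -!scalerAr -!scalerAl !scalerA !mulrA.
rewrite cZ -!mulrA cZ (mulrC c' c) -!addrA; congr (_ + _).
by rewrite addrCA.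
Qed.

End BraidValue.

(** * Products of opposite root vectors *)

Section RootVectors.
Variables (F : fieldType) (q : F) (n : nat).

Lemma braid_nextE (A : algType F) (h : sl_gen n -> A) (i j : 'I_n) : j = i.+1 :> nat ->
  teval h (lusztigT_gen q i (@SE n j)) =
    q^-1 *: (h (SE j) * h (SE i)) + (-1) *: (h (SE i) * h (SE j)).
Proof.
move=> ji; rewrite /= -val_eqE /= /adjacent ji eqxx /= scaleN1r.
by rewrite (_ : (i.+1 == i) = false) //=; apply/eqP; lia.
Qed.

Lemma braid_nextF (A : algType F) (h : sl_gen n -> A) (i j : 'I_n) : j = i.+1 :> nat ->
  teval h (lusztigT_gen q i (@SF n j)) =
    (-1) *: (h (SF j) * h (SF i)) + q *: (h (SF i) * h (SF j)).
Proof.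
move=> ji; rewrite /= -val_eqE /= /adjacent ji eqxx /= scaleN1r.
by rewrite (_ : (i.+1 == i) = false) //=; apply/eqP; lia.
Qed.

Lemma lusztig_far (i j : 'I_n) : (i.+1 < j)%N ->
  (j == i) = false /\ adjacent i j = false.
Proof. by rewrite -val_eqE /adjacent /=; split; lia. Qed.

Lemma braid_farE (A : algType F) (h : sl_gen n -> A) (i j : 'I_n) : (i.+1 < j)%N ->
  teval h (lusztigT_gen q i (@SE n j)) = h (SE j).
Proof. by move=> /lusztig_far[/= -> ->]. Qed.

Lemma braid_farF (A : algType F) (h : sl_gen n -> A) (i j : 'I_n) : (i.+1 < j)%N ->
  teval h (lusztigT_gen q i (@SF n j)) = h (SF j).
Proof. by move=> /lusztig_far[/= -> ->]. Qed.

(** The root vectors of [eps_i - eps_(k+1)] and of its opposite. *)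
Definition rootE (i : nat) (k : 'I_n) : Uqsl q n := braid_value q (@SE n) (@sl_gen_val F q n) i k.
Definition rootF (i : nat) (k : 'I_n) : Uqsl q n := braid_value q (@SF n) (@sl_gen_val F q n) i k.

Lemma root_vector_pos (i : 'I_n.+1) (k : 'I_n) : (i <= k)%N ->
  root_vector q (i, hi k) = rootE i k.
Proof. by move=> ik; rewrite /root_vector /is_pos_root /= /bump /= add1n ltnS ik /braid_term liftK. Qed.

Lemma root_vector_neg (i : 'I_n.+1) (k : 'I_n) : (i <= k)%N ->
  root_vector q (hi k, i) = rootF i k.
Proof.
move=> ik; rewrite /root_vector /is_pos_root /= /bump /= add1n.
by rewrite (_ : (k.+1 < i)%N = false) ?/braid_term ?liftK //; lia.
Qed.

Lemma rootE0 (k : 'I_n) : rootE k k = slE q k.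
Proof. exact: braid_value0. Qed.
Lemma rootF0 (k : 'I_n) : rootF k k = slF q k.
Proof. exact: braid_value0. Qed.

Lemma rootE_rec (i k : 'I_n) : (i < k)%N ->
  rootE i k = q^-1 *: (rootE i.+1 k * slE q i) - slE q i * rootE i.+1 k.
Proof.
move=> ik; rewrite /rootE (braid_value_rec braid_nextE braid_farE) ?scaleN1r // => a b ab _.
by apply: (sl_relXX q true); rewrite /distant ab.
Qed.

Lemma rootF_rec (i k : 'I_n) : (i < k)%N ->
  rootF i k = q *: (slF q i * rootF i.+1 k) - rootF i.+1 k * slF q i.
Proof.
move=> ik; rewrite /rootF (braid_value_rec braid_nextF braid_farF) ?scaleN1r 1?addrC // => a b ab _.
by apply: (sl_relXX q false); rewrite /distant ab.
Qed.

Lemma rootE_comm (j : 'I_n) (i : nat) (k : 'I_n) : (j < i)%N -> (i <= k)%N ->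
  slF q j * rootE i k = rootE i k * slF q j.
Proof.
move=> ji ik; apply: (braid_value_comm braid_nextE braid_farE) => // m im.
by apply/esym/sl_relEF_comm; rewrite -val_eqE /=; lia.
Qed.

Lemma rootF_comm (j : 'I_n) (i : nat) (k : 'I_n) : (j < i)%N -> (i <= k)%N ->
  slE q j * rootF i k = rootF i k * slE q j.
Proof.
move=> ji ik; apply: (braid_value_comm braid_nextF braid_farF) => // m im.
by apply: sl_relEF_comm; rewrite -val_eqE /=; lia.
Qed.

End RootVectors.

Section QNumbers.
Variables (F : fieldType) (q : F).
Hypotheses (q0 : q != 0) (q2 : q ^+ 2 != 1).

Lemma qnum_shift (x : F) s : qnum q (q * x) s = qnum q x (s + 1).
Proof.
rewrite /qnum opprD !expfzDr // expr1z invfM; congr (_ * (_ - _)); first by ring.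
by rewrite exprN1 mulrA.
Qed.

Lemma qnum_circle (x : F) : x != 0 ->
  qnum q x 0 ^+ 2 + qnum q x 1 ^+ 2 - (q + q^-1) * (qnum q x 0 * qnum q x 1) = 1.
Proof.
by move=> x0; rewrite qnum0 qnum1; field; rewrite ?q0 ?x0 /= subr_eq0 -expr2 q2.
Qed.

(** The commutator of [E_i] and [F_i] turns the eigenvalue of [F_i E_i] into that
    of [E_i F_i]. *)
Lemma qnum_EF (x y : F) : x != 0 -> y != 0 ->
  qnum q x 1 * qnum q y 0 + (q - q^-1)^-1 * (x / y - (x / y)^-1) =
  qnum q x 0 * qnum q y 1.
Proof.
by move=> x0 y0; rewrite !qnum0 !qnum1; field; rewrite ?q0 ?x0 ?y0 /= subr_eq0 -expr2 q2.
Qed.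

End QNumbers.

Section RootStrings.
Variables (F : fieldType) (q : F) (n : nat) (V : lmodType (Uqsl q n)).
Hypotheses (q0 : q != 0) (q2 : q ^+ 2 != 1).
Notation VF := (restr V).
Variables (l0 : weight F n) (mu : 'I_n.+1 -> point -> F).
Variable v0 : VF.
Hypotheses (v0_wt : weight_space l0 (v0 : V)) (mu_spec : Kbar_spec V l0 mu).
Notation W := (@wtW F q n V l0).

(** One step of the recursion for root vectors: [e], [f] move the weight at
    one end of an interval, [x], [y] are the root vectors of the rest. *)
Lemma root_step (e f x y : Uqsl q n) (v : VF) (a c b0 b1 : F) :
  f * x = x * f -> y * e = e * y ->
  b0 ^+ 2 + b1 ^+ 2 - (q + q^-1) * (b0 * b1) = 1 ->
  sl_act y (sl_act x v) = (b1 * c) *: v ->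
  sl_act f (sl_act e v) = (a * b0) *: v ->
  sl_act f (sl_act e (sl_act x v)) = (a * b1) *: sl_act x v ->
  sl_act y (sl_act x (sl_act e v)) = (b0 * c) *: sl_act e v ->
  sl_act (q *: (f * y) - y * f) (sl_act (q^-1 *: (x * e) - e * x) v) = (a * c) *: v.
Proof.
move=> fx ye circ yxv fev fexv yxev.
have comm2 w : sl_act f (sl_act x w) = sl_act x (sl_act f w) by rewrite -!sl_actM fx.
have comm3 w : sl_act y (sl_act e w) = sl_act e (sl_act y w) by rewrite -!sl_actM ye.
have actB z w w' : sl_act z (w - w') = sl_act z w - sl_act z w' :> VF.
  by rewrite -scaleN1r sl_actDr sl_actZr scaleN1r.
rewrite !sl_actB !sl_actZ !sl_actM !actB !sl_actZr.
rewrite yxev comm3 yxv comm2 fev fexv !sl_actZr fev yxv.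
rewrite ?scalerBr !scalerA -!scalerBl; congr (_ *: _).
transitivity (a * c * (b0 ^+ 2 + b1 ^+ 2 - (q + q^-1) * (b0 * b1))); last by rewrite circ mulr1.
by field.
Qed.

(** The effect of a root vector for [eps_i - eps_k] on the eigenvalues of the
    [Kbar_j]. *)
Definition moves (x : Uqsl q n) (i k : 'I_n.+1) : Prop := forall p v, W p v ->
  exists2 p', W p' (sl_act x v) &
    forall j, mu j p' = mu j p * q ^ ((j == i)%:Z - (j == k)%:Z).

Lemma W_lin p a (u v : VF) : W p u -> W p v -> W p (a *: u + v).
Proof.
move=> [ks ku] [_ kv]; split=> // o.
by rewrite sl_act_linear ku kv scalerDr !scalerA mulrC.
Qed.

(** The eigenvalues of the [Kbar_j] determine those of the [K_i]; this identifies
    the weight spaces reached by two different orders of steps. *)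
Lemma W_same_mu p p' (u w : VF) : W p u -> W p' w -> (forall j, mu j p = mu j p') -> W p' u.
Proof.
have [mu0 mul _ _] := mu_spec.
move=> [_ ku] [ks _] e; split=> // o; rewrite ku; congr (_ *: _).
by apply: (mulfI (mu0 (hi o) p)); rewrite -mul !e mul.
Qed.

Lemma moves_X d (o : 'I_n) : moves (slX q d o) (if d then lo o else hi o) (if d then hi o else lo o).
Proof.
move=> p v Wv; have [_ _ mus _] := mu_spec.
exists (shift p o%:Z d).
  by rewrite -opXE; apply: wtW_X => //; apply/sl_nodeP; exists o.
move=> j; rewrite mus; congr (_ * q ^ _); rewrite /eps_pairing.
by case: d => /=; lia.
Qed.

Lemma moves_val p p' (i k : 'I_n.+1) : i != k ->
  (forall j, mu j p' = mu j p * q ^ ((j == i)%:Z - (j == k)%:Z)) ->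
  [/\ mu i p' = q * mu i p, mu k p = q * mu k p' &
      forall j, j != i -> j != k -> mu j p' = mu j p].
Proof.
move=> ik e; split=> [||j ji jk]; rewrite e.
- by rewrite eqxx (negPf ik) subr0 expr1z mulrC.
- by rewrite eqxx eq_sym (negPf ik) sub0r exprN1 mulrC mulfVK.
by rewrite (negPf ji) (negPf jk) subrr expr0z mulr1.
Qed.

Lemma moves_bracket x y (i j k : 'I_n.+1) a b a' b' : moves x i j -> moves y j k ->
  moves (a *: (x * y) + b *: (y * x)) i k /\ moves (a' *: (y * x) + b' *: (x * y)) i k.
Proof.
move=> mx my; suff H p v : W p v -> exists2 p', W p' (sl_act (x * y) v) /\ W p' (sl_act (y * x) v) &
    forall l, mu l p' = mu l p * q ^ ((l == i)%:Z - (l == k)%:Z).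
  split=> p v /H[p' [W1 W2] e]; exists p' => //; rewrite sl_actD !sl_actZ.
    by apply: W_lin => //; apply: wtWZ.
  by apply: W_lin => //; apply: wtWZ.
move=> Wv; have [p1 W1 e1] := mx _ _ Wv; have [p2 W2 e2] := my _ _ Wv.
have [p12 W12 e12] := my _ _ W1; have [p21 W21 e21] := mx _ _ W2.
have E12 l : mu l p12 = mu l p * q ^ ((l == i)%:Z - (l == k)%:Z).
  by rewrite e12 e1 -mulrA -expfzDr //; congr (_ * q ^ _); lia.
have E21 l : mu l p21 = mu l p * q ^ ((l == i)%:Z - (l == k)%:Z).
  by rewrite e21 e2 -mulrA -expfzDr //; congr (_ * q ^ _); lia.
exists p12 => //; rewrite !sl_actM; split=> //.
by apply: (W_same_mu W21 W12) => l; rewrite E12 E21.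
Qed.

Lemma simple_EF (o : 'I_n) p (v : VF) : W p v ->
  sl_act (slE q o) (sl_act (slF q o) v) = (qnum q (mu (lo o) p) 0 * qnum q (mu (hi o) p) 1) *: v.
Proof.
move=> Wv; have [mu0 mul _ FE] := mu_spec.
have lamE : lam q (base_l l0) o%:Z p = mu (lo o) p / mu (hi o) p by rewrite mul mulrC mulKf.
rewrite -(qnum_EF q0 q2 (mu0 _ _) (mu0 _ _)) scalerDl -FE // -lamE.
apply/eqP; rewrite addrC -subr_eq -!sl_actM -sl_actB sl_relEF sl_actZ sl_actB (Wv.2 o).
by rewrite (slKV_act q0 v0_wt o Wv) -scalerBl scalerA.
Qed.

(** The root vectors act like a simple pair [E], [F] on an interval of
    the diagram. *)
Definition root_pair (i : 'I_n.+1) (k : 'I_n) := [/\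
  moves (rootE q i k) i (hi k), moves (rootF q i k) (hi k) i &
  forall p (v : VF), W p v ->
    sl_act (rootF q i k) (sl_act (rootE q i k) v) = (qnum q (mu i p) 1 * qnum q (mu (hi k) p) 0) *: v /\
    sl_act (rootE q i k) (sl_act (rootF q i k) v) = (qnum q (mu i p) 0 * qnum q (mu (hi k) p) 1) *: v].

(** Both products are instances of [root_step]; the second one exchanges the
    roles of positive and negative root vectors, which costs factors [- q] and
    [- q^-1] that cancel. *)
Lemma root_pair_step (o k : 'I_n) : (o < k)%N -> root_pair (hi o) k -> root_pair (lo o) k.
Proof.
move=> ok [mX mY IH]; have [mu0 mul mus FE] := mu_spec.
change (moves (rootE q o.+1 k) (hi o) (hi k)) in mX.
change (moves (rootF q o.+1 k) (hi k) (hi o)) in mY.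
have rE := rootE_rec q ok; have rF := rootF_rec q ok.
have fX := rootE_comm q (ltnSn o) ok; have eY := rootF_comm q (ltnSn o) ok.
rewrite /root_pair -[nat_of_ord (lo o)]/(nat_of_ord o).
set X := rootE q o.+1 k in mX rE fX IH *; set Y := rootF q o.+1 k in mY rF eY IH *.
have {}IH p (v : VF) : W p v ->
    sl_act Y (sl_act X v) = (qnum q (mu (hi o) p) 1 * qnum q (mu (hi k) p) 0) *: v /\
    sl_act X (sl_act Y v) = (qnum q (mu (hi o) p) 0 * qnum q (mu (hi k) p) 1) *: v := IH p v.
have lohi : lo o != hi o by rewrite -val_eqE /= /bump /=; lia.
have lohk : lo o != hi k by rewrite -val_eqE /= /bump /=; lia.
have hohk : hi o != hi k by rewrite -val_eqE /= /bump /=; lia.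
have me := moves_X true o; have mf := moves_X false o; rewrite /= /slX in me mf.
split.
- rewrite rE -scaleN1r; exact: (moves_bracket _ _ _ _ me mX).2.
- rewrite rF -scaleN1r; exact: (moves_bracket _ _ _ _ mY mf).2.
move=> p v Wv.
have [pX WX /(moves_val hohk)[X1 X2 X3]] := mX _ _ Wv.
have [pY WY /(moves_val (contra_neq esym hohk))[Y1 Y2 Y3]] := mY _ _ Wv.
have [pe We /(moves_val lohi)[e1 e2 e3]] := me _ _ Wv.
have [pf Wf /(moves_val (contra_neq esym lohi))[f1 f2 f3]] := mf _ _ Wv.
have X3o : mu (lo o) pX = mu (lo o) p by apply: X3.
have Y3o : mu (lo o) pY = mu (lo o) p by apply: Y3.
have e3k : mu (hi k) pe = mu (hi k) p by apply: e3; rewrite eq_sym.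
have f3k : mu (hi k) pf = mu (hi k) p by apply: f3; rewrite eq_sym.
split.
  rewrite rE rF.
  apply: (@root_step _ _ _ _ _ _ _ (qnum q (mu (hi o) p) 0) (qnum q (mu (hi o) p) 1)).
  - exact: fX.
  - by rewrite eY.
  - exact: qnum_circle.
  - by rewrite (IH _ _ Wv).1.
  - by rewrite (FE _ _ _ Wv).
  - by rewrite (FE _ _ _ WX) X1 X3 // qnum_shift.
  by rewrite (IH _ _ We).1 e2 qnum_shift // e3k.
have -> : rootE q o k = - q^-1 *: (q *: (slE q o * X) - X * slE q o).
  by rewrite rE scalerBr scalerA mulNr mulVf // scaleN1r scaleNr opprK addrC.
have -> : rootF q o k = - q *: (q^-1 *: (Y * slF q o) - slF q o * Y).
  by rewrite rF scalerBr scalerA mulNr mulfV // scaleN1r scaleNr opprK addrC.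
rewrite !sl_actZ sl_actZr scalerA mulrNN mulVf // scale1r.
apply: (@root_step _ _ _ _ _ _ _ (qnum q (mu (hi o) p) 1) (qnum q (mu (hi o) p) 0)).
- by rewrite eY.
- by rewrite fX.
- by rewrite [X in X - _]addrC [X in _ * X]mulrC qnum_circle.
- by rewrite (IH _ _ Wv).2.
- by rewrite (simple_EF o Wv).
- by rewrite (simple_EF o WY) Y2 qnum_shift // Y3o.
by rewrite (IH _ _ Wf).2 f1 qnum_shift // f3k.
Qed.

Lemma root_pairP (i : 'I_n.+1) (k : 'I_n) : (i <= k)%N -> root_pair i k.
Proof.
have [d dE] : exists d : nat, (k = i + d :> nat)%N \/ (k < i)%N by exists (k - i)%N; lia.
elim: d i dE => [|d IH] i [] dE ik; try lia.
  have -> : i = lo k by apply: val_inj => /=; lia.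
  have [_ _ _ FE] := mu_spec.
  rewrite /root_pair -[nat_of_ord (lo k)]/(nat_of_ord k) rootE0 rootF0; split.
  - exact: moves_X true k.
  - exact: moves_X false k.
  by move=> p v Wv; rewrite (FE _ _ _ Wv) (simple_EF k Wv).
have ni : (i < n)%N by have := ltn_ord k; lia.
pose o := Ordinal ni; have -> : i = lo o by apply: val_inj.
apply: root_pair_step; first by move=> /=; lia.
apply: IH; last by rewrite /= /bump /=; lia.
by left; rewrite /= /bump /=; lia.
Qed.

End RootStrings.

Theorem theoremI (F : fieldType) (charF : [pchar F] =i pred0)
    (quadF : quadratically_closed F)
    (q : F) (q_neq0 : q != 0)
    (q_not_root1 : forall m : nat, (0 < m)%N -> q ^+ m != 1)
    (n : nat) (n_gt0 : (0 < n)%N)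
    (V : lmodType (Uqsl q n))
    (V_irr : irreducible_module V)
    (V_inf : infinite_dimensional V)
    (V_cp : completely_pointed V)
    (vp : V) (vpP : Vplus vp) :
  exists act : Uqgl q n -> V -> V,
    [/\ extends_sl_action act,
        (forall i j : 'I_n.+1, i != j ->
           (root_vector q (j, i) * root_vector q (i, j)) *: vp
           = act (Kbar_bracket q i 1 * Kbar_bracket q j 0) vp)
      & (forall (i : 'I_n) (v : V), weight_vector v ->
           (slF q i * slE q i) *: v
           = act (Kbar_bracket q (lo i) 1 * Kbar_bracket q (hi i) 0) v)].
Proof.
have [l0 [v0 v00 v0_wt]] : exists l0, exists2 v0 : V, v0 != 0 & weight_space l0 v0.
  have [[v v_neq0] _] := V_irr; have [[dec _] _] := V_cp.
  have [s [f [_ fP vE]]] := dec v; apply: contrapT => no.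
  case/eqP: v_neq0; rewrite vE big_seq big1 // => l ls.
  by apply/eqP/negPn/negP => f0; apply: no; exists l, (f l) => //; apply: fP.
have q2 : q ^+ 2 != 1 by apply: q_not_root1.
have [mu mu_spec] := Kbar_eigenvalues q_neq0 q_not_root1 quadF n_gt0 V_irr V_cp V_inf v00 v0_wt.
have [K [KV [K_lin KV_lin K_wt KV_wt]]] := Kbar_ops q_neq0 q_not_root1 V_cp v00 v0_wt mu.
have act_bracket := gl_act_bracket q_neq0 V_irr v00 v0_wt mu_spec K_lin KV_lin K_wt KV_wt.
have act_module := gl_act_module q_neq0 V_irr v00 v0_wt mu_spec K_lin KV_lin K_wt KV_wt.
have act_ext := gl_act_extends q_neq0 V_irr v00 v0_wt mu_spec K_lin KV_lin K_wt KV_wt.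
set act := gl_act K KV in act_bracket act_module act_ext.
have act2 i j k (v : restr V) : wtW l0 k v ->
    act (Kbar_bracket q i 1 * Kbar_bracket q j 0) v =
    ((qnum q (mu i k) 1 * qnum q (mu j k) 0) *: v : restr V).
  move=> Wv; rewrite (act_M act_module) (act_bracket _ _ _ _ Wv).
  by rewrite (act_bracket _ _ k) ?scalerA 1?mulrC //; apply: wtWZ.
exists act; split=> // [i j ij|o v [v_neq0 [l lv]]]; last first.
  have [k _ Wv] := weight_lattice q_neq0 V_irr V_cp v00 v0_wt lv v_neq0.
  have [_ _ _ FE] := mu_spec.
  by rewrite (act2 _ _ _ _ Wv) -(FE _ _ _ Wv) -sl_actM.
have act_lin x : linear (act x : restr V -> restr V).
  move=> a u w; rewrite /act /gl_act; exact: tact_linear.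
rewrite sl_actE.
apply: (eq_on_weights q_neq0 V_irr v00 v0_wt (sl_act_linear _) (act_lin _)) => k v Wv.
rewrite (act2 _ _ _ _ Wv) sl_actM.
have [ltij|ltji|eij] := ltngtP i j; last by case/eqP: ij; apply: val_inj.
  have [o jE] : exists o : 'I_n, j = hi o.
    by case: (unliftP ord0 j) => [o ->|j0]; [exists o|move: ltij; rewrite j0].
  have io : (i <= o)%N by move: ltij; rewrite jE /= /bump /=; lia.
  have [_ _ H] := root_pairP q_neq0 q2 v0_wt mu_spec io.
  by rewrite jE root_vector_neg // root_vector_pos // (H _ _ Wv).1.
have [o iE] : exists o : 'I_n, i = hi o.
  by case: (unliftP ord0 i) => [o ->|i0]; [exists o|move: ltji; rewrite i0].
have jo : (j <= o)%N by move: ltji; rewrite iE /= /bump /=; lia.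
have [_ _ H] := root_pairP q_neq0 q2 v0_wt mu_spec jo.
by rewrite iE root_vector_neg // root_vector_pos // (H _ _ Wv).2 mulrC.
Qed.
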